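(* Let $k$ be a commutative ring, $G$ a finite group, and $V$ a $kG$-module that is free of finite rank as a $k$-module. Let $\mathbf{C}$ be any one of the categories $\mathbf{Cpx}(kG)$, $\mathbf{cpx}(kG)$, $\mathbf{Cpx}^*(kG)$ or $\mathbf{cpx}^*(kG)$ for $*=+,-$ or $b$. Let $\mathscr{E}$ be the collection of $V$-split sequences in $\mathbf{C}$. Then the exact category $(\mathbf{C},\mathscr{E})$, whose associated quotient category is $\mathcal{K}_{V\text{-split}}(\mathbf{C})=\mathbf{C}/\mathscr{E}\text{-}\mathbf{Proj}$, is a Frobenius category. The $\mathscr{E}$-projective objects are precisely all direct summands of objects of the form $X^*\otimes V^{\#}\otimes V$ for $X^*$ in $\mathbf{C}$. In addition, if $k$ is a field, then the category $\mathcal{K}_{V\text{-split}}(\mathbf{cpx}^b(kG))$ is a Krull-Schmidt category.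
   Context: $\mathbf{Cpx}(kG)$ is the category of cochain complexes of $kG$-modules and chain maps, $\mathbf{cpx}(kG)$ the full subcategory of complexes of finitely generated $kG$-modules; superscripts $+,-,b$ denote the full subcategories of complexes bounded above, bounded below, and both. $\otimes=\otimes_k$ with diagonal $G$-action, and $V^{\#}=\mathrm{Hom}_k(V,k)$. An exact sequence $E$ of complexes is $V$-split if $V\otimes E$ is split as a sequence of complexes. An object $P$ is $\mathscr{E}$-projective if $\mathrm{Hom}(P,-)$ sends each sequence in $\mathscr{E}$ to an exact sequence; $\mathscr{E}$-injective is dual. An exact category $(\mathbf{C},\mathscr{E})$ is Frobenius if it has enough $\mathscr{E}$-projectives and enough $\mathscr{E}$-injectives and these two classes of objects coincide. $\mathbf{C}/\mathscr{E}\text{-}\mathbf{Proj}$ has the objects of $\mathbf{C}$ and the morphisms of $\mathbf{C}$ modulo those factoring through an $\mathscr{E}$-projective object. An additive category is Krull-Schmidt if every object is a finite direct sum of indecomposable objects, uniquely up to order and isomorphism of the summands (equivalently, with indecomposables having local endomorphism rings).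
   Formalization: V is assumed free of positive finite rank; for V = 0 over a nonzero ring every exact sequence is V-split and X⊗V#⊗V = 0, while the contractible complex kG → kG is a nonzero E-projective object, so the claim fails. *)

(* Defs.v *)
From HB Require Import structures.
From mathcomp Require Import all_boot all_order all_fingroup all_algebra.
From mathcomp Require Import generic_quotient boolp functions.

Set Implicit Arguments.
Unset Strict Implicit.
Unset Printing Implicit Defensive.

Import GRing.Theory.
Local Open Scope ring_scope.
Local Open Scope quotient_scope.

(* A category is given by its data; a hom-"set" is a type of representatives
   together with an equality relation [heq], so that passing to a quotient
   category only changes [heq].  No law is built into [catData]: that [heq] is
   a congruence and all axioms of an additive category are collected in
   [is_additive], on which [exact_category] and [krull_schmidt] insist. *)

Record catData := CatData {
  ob : Type;
  hom : ob -> ob -> Type;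
  heq : forall A B, hom A B -> hom A B -> Prop;
  idm : forall A, hom A A;
  cmp : forall A B D, hom B D -> hom A B -> hom A D;
  zerom : forall A B, hom A B;
  addm : forall A B, hom A B -> hom A B -> hom A B;
  oppm : forall A B, hom A B -> hom A B
}.

Arguments heq {_ A B} f g.
Arguments idm {_} A.
Arguments cmp {_ A B D} g f.
Arguments zerom {_ A B}.
Arguments addm {_ A B} f g.
Arguments oppm {_ A B} f.

Declare Scope cat_scope.
Delimit Scope cat_scope with cat.
Notation "f == g" := (heq f g) : cat_scope.
Notation "g \o f" := (cmp g f) : cat_scope.
Notation "f + g" := (addm f g) : cat_scope.
Notation "- f" := (oppm f) : cat_scope.
Notation "f - g" := (addm f (oppm g)) : cat_scope.
Notation "0" := zerom : cat_scope.

Section Categories.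
Variable C : catData.
Local Open Scope cat_scope.
Implicit Types A B D X Y Z P Q : ob C.

Definition is_zero Z : Prop :=
  forall X, (forall f : hom X Z, f == 0) /\ (forall f : hom Z X, f == 0).

Definition isomorphic A B : Prop :=
  exists (f : hom A B) (g : hom B A), g \o f == idm A /\ f \o g == idm B.

Definition is_iso A B (f : hom A B) : Prop :=
  exists g : hom B A, g \o f == idm A /\ f \o g == idm B.

(* [A --i1--> S --p2--> B], with retraction [p1] and section [i2]. *)
Definition is_biproduct A B S (i1 : hom A S) (i2 : hom B S)
    (p1 : hom S A) (p2 : hom S B) : Prop :=
  [/\ p1 \o i1 == idm A, p2 \o i2 == idm B, p2 \o i1 == 0, p1 \o i2 == 0
    & (i1 \o p1) + (i2 \o p2) == idm S].

Definition biproduct A B S : Prop :=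
  exists i1 i2 p1 p2, @is_biproduct A B S i1 i2 p1 p2.

Record is_additive : Prop := IsAdditive {
  heq_refl : forall A B (f : hom A B), f == f;
  heq_sym : forall A B (f g : hom A B), f == g -> g == f;
  heq_trans : forall A B (f g h : hom A B), f == g -> g == h -> f == h;
  cmp_heq : forall A B D (g g' : hom B D) (f f' : hom A B),
    g == g' -> f == f' -> g \o f == g' \o f';
  addm_heq : forall A B (f f' g g' : hom A B),
    f == f' -> g == g' -> f + g == f' + g';
  oppm_heq : forall A B (f f' : hom A B), f == f' -> - f == - f';
  cmpA : forall A B D F (h : hom D F) (g : hom B D) (f : hom A B),
    h \o (g \o f) == (h \o g) \o f;
  cmp1m : forall A B (f : hom A B), idm B \o f == f;
  cmpm1 : forall A B (f : hom A B), f \o idm A == f;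
  addmA : forall A B (f g h : hom A B), f + (g + h) == (f + g) + h;
  addmC : forall A B (f g : hom A B), f + g == g + f;
  add0m : forall A B (f : hom A B), 0 + f == f;
  addNm : forall A B (f : hom A B), - f + f == 0;
  cmpDl : forall A B D (g g' : hom B D) (f : hom A B),
    (g + g') \o f == (g \o f) + (g' \o f);
  cmpDr : forall A B D (g : hom B D) (f f' : hom A B),
    g \o (f + f') == (g \o f) + (g \o f');
  has_zero : exists Z, is_zero Z;
  has_biproducts : forall A B, exists S, biproduct A B S
}.

Definition summand P Y : Prop := exists Q, biproduct P Q Y.

Definition split_seq A B D (f : hom A B) (g : hom B D) : Prop :=
  exists (s : hom D B) (r : hom B A), is_biproduct f s r g.

Definition is_kernel A B D (f : hom A B) (g : hom B D) : Prop :=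
  g \o f == 0 /\
  forall X (h : hom X B), g \o h == 0 ->
    (exists u : hom X A, f \o u == h) /\
    (forall u v : hom X A, f \o u == h -> f \o v == h -> u == v).

Definition is_cokernel A B D (f : hom A B) (g : hom B D) : Prop :=
  g \o f == 0 /\
  forall X (h : hom B X), h \o f == 0 ->
    (exists u : hom D X, u \o g == h) /\
    (forall u v : hom D X, u \o g == h -> v \o g == h -> u == v).

Definition is_pushout A B A' B' (f : hom A B) (a : hom A A')
    (b : hom B B') (f' : hom A' B') : Prop :=
  b \o f == f' \o a /\
  forall X (x : hom B X) (y : hom A' X), x \o f == y \o a ->
    (exists u : hom B' X, u \o b == x /\ u \o f' == y) /\
    (forall u v : hom B' X, u \o b == v \o b -> u \o f' == v \o f' -> u == v).

Definition is_pullback B D B' D' (g : hom B D) (d : hom D' D)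
    (b : hom B' B) (g' : hom B' D') : Prop :=
  g \o b == d \o g' /\
  forall X (x : hom X B) (y : hom X D'), g \o x == d \o y ->
    (exists u : hom X B', b \o u == x /\ g' \o u == y) /\
    (forall u v : hom X B', b \o u == b \o v -> g' \o u == g' \o v -> u == v).

Definition seqClass := forall A B D, hom A B -> hom B D -> Prop.

Variable E : seqClass.

Definition inflation A B (f : hom A B) : Prop :=
  exists D (g : hom B D), E f g.

Definition deflation B D (g : hom B D) : Prop :=
  exists A (f : hom A B), E f g.

(* Quillen's axioms. *)
Record exact_category : Prop := ExactCategory {
  exact_additive : is_additive;
  exact_kercoker : forall A B D (f : hom A B) (g : hom B D),
    E f g -> is_kernel f g /\ is_cokernel f g;
  exact_iso : forall A B D A' B' D'
      (f : hom A B) (g : hom B D) (f' : hom A' B') (g' : hom B' D')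
      (a : hom A A') (b : hom B B') (d : hom D D'),
    is_iso a -> is_iso b -> is_iso d ->
    b \o f == f' \o a -> d \o g == g' \o b -> E f g -> E f' g';
  exact_id_inflation : forall A, inflation (idm A);
  exact_id_deflation : forall A, deflation (idm A);
  exact_cmp_inflation : forall A B D (g : hom B D) (f : hom A B),
    inflation f -> inflation g -> inflation (g \o f);
  exact_cmp_deflation : forall A B D (g : hom B D) (f : hom A B),
    deflation f -> deflation g -> deflation (g \o f);
  exact_pushout : forall A B A' (f : hom A B) (a : hom A A'),
    inflation f -> exists B' (b : hom B B') (f' : hom A' B'),
      is_pushout f a b f' /\ inflation f';
  exact_pullback : forall B D D' (g : hom B D) (d : hom D' D),
    deflation g -> exists B' (b : hom B' B) (g' : hom B' D'),
      is_pullback g d b g' /\ deflation g'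
}.

(* [0 -> Hom(P,A) -> Hom(P,B) -> Hom(P,D) -> 0] is exact. *)
Definition E_projective P : Prop :=
  forall A B D (f : hom A B) (g : hom B D), E f g ->
  [/\ forall u : hom P A, f \o u == 0 -> u == 0,
      forall v : hom P B, g \o v == 0 <-> exists u : hom P A, f \o u == v
    & forall w : hom P D, exists v : hom P B, g \o v == w].

(* [0 -> Hom(D,I) -> Hom(B,I) -> Hom(A,I) -> 0] is exact. *)
Definition E_injective (I : ob C) : Prop :=
  forall A B D (f : hom A B) (g : hom B D), E f g ->
  [/\ forall u : hom D I, u \o g == 0 -> u == 0,
      forall v : hom B I, v \o f == 0 <-> exists u : hom D I, u \o g == v
    & forall w : hom A I, exists v : hom B I, v \o f == w].

Record frobenius : Prop := Frobenius {
  frob_exact : exact_category;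
  frob_proj : forall X, exists P (p : hom P X), E_projective P /\ deflation p;
  frob_inj : forall X, exists I (i : hom X I), E_injective I /\ inflation i;
  frob_coincide : forall X, E_projective X <-> E_injective X
}.

(* [C/E-Proj]: two morphisms are identified when their difference factors
   through an E-projective object. *)
Definition stable_eq A B (f g : hom A B) : Prop :=
  exists P, E_projective P /\
    exists (u : hom A P) (v : hom P B), f - g == v \o u.

Definition stable_category : catData :=
  @CatData (ob C) (@hom C) stable_eq (@idm C) (@cmp C) (@zerom C) (@addm C)
    (@oppm C).

End Categories.

Section KrullSchmidt.
Variable C : catData.
Local Open Scope cat_scope.

Definition indecomposable (X : ob C) : Prop :=
  ~ is_zero X /\
  forall A B : ob C, biproduct A B X -> is_zero A \/ is_zero B.

Definition is_direct_sum (X : ob C) (n : nat) (Y : 'I_n -> ob C) : Prop :=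
  exists (i : forall a, hom (Y a) X) (p : forall a, hom X (Y a)),
  [/\ forall a, p a \o i a == idm (Y a),
      forall a b, a <> b -> p a \o i b == 0
    & \big[@addm C X X/0]_(a < n) (i a \o p a) == idm X].

(* In an additive category: non-zero, and the non-units of [End X] are closed
   under addition. *)
Definition local_endo (X : ob C) : Prop :=
  ~ (idm X == 0) /\
  forall f g : hom X X, is_iso (f + g) -> is_iso f \/ is_iso g.

(* Uniqueness of the decomposition alone does not force local endomorphism
   rings in a general additive category; both are required here. *)
Record krull_schmidt : Prop := KrullSchmidt {
  ks_additive : is_additive C;
  ks_exists : forall X : ob C, exists n (Y : 'I_n -> ob C),
    (forall a, indecomposable (Y a)) /\ is_direct_sum X Y;
  ks_unique : forall (X : ob C) n (Y : 'I_n -> ob C) m (Z : 'I_m -> ob C),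
    (forall a, indecomposable (Y a)) -> (forall b, indecomposable (Z b)) ->
    is_direct_sum X Y -> is_direct_sum X Z ->
    exists s : 'I_n -> 'I_m, bijective s /\ forall a, isomorphic (Y a) (Z (s a));
  ks_local : forall X : ob C, indecomposable X -> local_endo X
}.

End KrullSchmidt.

Definition full_subcategory (C : catData) (S : ob C -> Prop) : catData :=
  @CatData {X : ob C | S X} (fun X Y => hom (sval X) (sval Y))
    (fun X Y f g => heq f g) (fun X => idm (sval X))
    (fun X Y Z g f => cmp g f) (fun X Y => zerom) (fun X Y f g => addm f g)
    (fun X Y f => oppm f).

Section Tensor.
Variables (k : comPzRingType) (M N : lmodType k).

Definition bilin (P : lmodType k) (f : M -> N -> P) : Prop :=
  (forall n, linear (f^~ n)) /\ (forall m, linear (f m)).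

Definition tsum (P : lmodType k) (f : M -> N -> P) (s : seq (M * N)) : P :=
  \sum_(p <- s) f p.1 p.2.

(* [M (x) N] consists of the formal sums of pairs [(m, n)], two of them being
   identified when no bilinear map separates them. *)
Definition tens_rel (s t : seq (M * N)) : bool :=
  `[< forall (P : lmodType k) (f : M -> N -> P), bilin f ->
        tsum f s = tsum f t >].

Lemma tens_relP : equiv_class_of tens_rel.
Proof.
split=> [s|s t|t s u].
- by apply/asboolP.
- by apply/asboolP/asboolP => H P f bf; rewrite H.
- move=> /asboolP H1 /asboolP H2; apply/asboolP => P f bf.
  by rewrite H1 // H2.
Qed.

Canonical tens_equiv := EquivRelPack tens_relP.
Canonical tens_encModRel := defaultEncModRel tens_rel.

Definition tens := {eq_quot tens_rel}.
HB.instance Definition _ : EqQuotient _ tens_rel tens := EqQuotient.on tens.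
HB.instance Definition _ := Choice.on tens.

Definition tens_ev (P : lmodType k) (f : M -> N -> P) (x : tens) : P :=
  tsum f (repr x).

Lemma tens_ev_pi (P : lmodType k) (f : M -> N -> P) s : bilin f -> tens_ev f (\pi_tens s) = tsum f s.
Proof.
move=> bf; rewrite /tens_ev.
have : tens_rel (repr (\pi_tens s)) s by apply/eqmodP; rewrite reprK.
by move=> /asboolP; apply.
Qed.

Lemma tens_ext (x y : tens) :
  (forall (P : lmodType k) (f : M -> N -> P), bilin f -> tens_ev f x = tens_ev f y) ->
  x = y.
Proof.
move=> H; rewrite -[x]reprK -[y]reprK; apply/eqmodP/asboolP => P f bf.
exact: H.
Qed.

Definition tens_zero : tens := \pi_tens [::].
Definition tens_add (x y : tens) : tens := \pi_tens (repr x ++ repr y).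
Definition tens_scale (a : k) (x : tens) : tens :=
  \pi_tens [seq (a *: p.1, p.2) | p <- repr x].
Definition tens_opp (x : tens) : tens :=
  \pi_tens [seq (- p.1, p.2) | p <- repr x].

Section Ev.
Variables (P : lmodType k) (f : M -> N -> P).
Hypothesis bf : bilin f.

Lemma bilinDl m m' n : f (m + m') n = f m n + f m' n.
Proof. by have := bf.1 n 1 m m'; rewrite !scale1r. Qed.

Lemma bilinDr m n n' : f m (n + n') = f m n + f m n'.
Proof. by have := bf.2 m 1 n n'; rewrite !scale1r. Qed.

Lemma bilin0l n : f 0 n = 0.
Proof. by apply: (addrI (f 0 n)); rewrite -bilinDl !addr0. Qed.

Lemma bilin0r m : f m 0 = 0.
Proof. by apply: (addrI (f m 0)); rewrite -bilinDr !addr0. Qed.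

Lemma bilinZl a m n : f (a *: m) n = a *: f m n.
Proof. by have := bf.1 n a m 0; rewrite !addr0 bilin0l addr0. Qed.

Lemma bilinZr a m n : f m (a *: n) = a *: f m n.
Proof. by have := bf.2 m a n 0; rewrite !addr0 bilin0r addr0. Qed.

Lemma bilinNl m n : f (- m) n = - f m n.
Proof. by apply: (addrI (f m n)); rewrite -bilinDl !subrr bilin0l. Qed.

Lemma tens_ev0 : tens_ev f tens_zero = 0.
Proof. by rewrite tens_ev_pi // /tsum big_nil. Qed.

Lemma tens_evD x y : tens_ev f (tens_add x y) = tens_ev f x + tens_ev f y.
Proof. by rewrite tens_ev_pi // /tsum big_cat. Qed.

Lemma tens_evZ a x : tens_ev f (tens_scale a x) = a *: tens_ev f x.
Proof.
rewrite tens_ev_pi // /tsum big_map scaler_sumr.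
by apply: eq_bigr => p _ /=; rewrite bilinZl.
Qed.

Lemma tens_evN x : tens_ev f (tens_opp x) = - tens_ev f x.
Proof.
rewrite tens_ev_pi // /tsum big_map -sumrN.
by apply: eq_bigr => p _ /=; rewrite bilinNl.
Qed.

End Ev.

Lemma tens_addA : associative tens_add.
Proof. by move=> x y z; apply: tens_ext => P f bf; rewrite !tens_evD // addrA. Qed.

Lemma tens_addC : commutative tens_add.
Proof. by move=> x y; apply: tens_ext => P f bf; rewrite !tens_evD // addrC. Qed.

Lemma tens_add0 : left_id tens_zero tens_add.
Proof.
by move=> x; apply: tens_ext => P f bf; rewrite tens_evD // tens_ev0 // add0r.
Qed.

Lemma tens_addN : left_inverse tens_zero tens_opp tens_add.
Proof.
move=> x; apply: tens_ext => P f bf.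
by rewrite tens_evD // tens_evN // tens_ev0 // addNr.
Qed.

HB.instance Definition _ :=
  GRing.isZmodule.Build tens tens_addA tens_addC tens_add0 tens_addN.

Lemma tens_scaleA a b x : tens_scale a (tens_scale b x) = tens_scale (a * b) x.
Proof. by apply: tens_ext => P f bf; rewrite !tens_evZ // scalerA. Qed.

Lemma tens_scale1 : left_id 1 tens_scale.
Proof. by move=> x; apply: tens_ext => P f bf; rewrite tens_evZ // scale1r. Qed.

Lemma tens_scaleDr : right_distributive tens_scale +%R.
Proof.
move=> a x y; apply: tens_ext => P f bf.
by rewrite tens_evZ // !tens_evD // !tens_evZ // scalerDr.
Qed.

Lemma tens_scaleDl x : {morph tens_scale^~ x : a b / a + b}.
Proof.
move=> a b; apply: tens_ext => P f bf.
by rewrite tens_evD // !tens_evZ // scalerDl.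
Qed.

HB.instance Definition _ := GRing.Zmodule_isLmodule.Build k tens
  tens_scaleA tens_scale1 tens_scaleDr tens_scaleDl.

Definition tmul (m : M) (n : N) : tens := \pi_tens [:: (m, n)].

Lemma tens_ev_tmul (P : lmodType k) (f : M -> N -> P) m n : bilin f -> tens_ev f (tmul m n) = f m n.
Proof. by move=> bf; rewrite tens_ev_pi // /tsum big_seq1. Qed.

Lemma tmul_bilin : bilin tmul.
Proof.
split=> [n|m] a x y; apply: tens_ext => P f bf.
  rewrite tens_evD // tens_evZ // !tens_ev_tmul //.
  by rewrite bilinDl // bilinZl.
rewrite tens_evD // tens_evZ // !tens_ev_tmul //.
by rewrite bilinDr // bilinZr.
Qed.

Lemma tens_ev_linear (P : lmodType k) (f : M -> N -> P) : bilin f -> linear (tens_ev f).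
Proof. by move=> bf a x y; rewrite tens_evD // tens_evZ. Qed.

Lemma tens_sumE (x : tens) : x = \sum_(p <- repr x) tmul p.1 p.2.
Proof.
apply: tens_ext => P f bf.
rewrite (big_morph (tens_ev f) (tens_evD bf) (tens_ev0 bf)).
by apply: eq_bigr => p _; rewrite tens_ev_tmul.
Qed.

Lemma tens_ind (Q : tens -> Prop) :
  Q 0 -> (forall x y, Q x -> Q y -> Q (x + y)) ->
  (forall m n, Q (tmul m n)) -> forall x, Q x.
Proof.
move=> Q0 QD Qt x; rewrite [x]tens_sumE; elim/big_rec: _ => // p y _.
exact: QD.
Qed.

Section Lift.
Variables (P : lmodType k) (f : M -> N -> P) (bf : bilin f).

Definition tens_lift : {linear tens -> P} :=
  HB.pack (tens_ev f)
    (GRing.isLinear.Build k tens P *:%R (tens_ev f) (tens_ev_linear bf)).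

Lemma tens_lift_tmul m n : tens_lift (tmul m n) = f m n.
Proof. exact: tens_ev_tmul. Qed.

Lemma tens_lift_unique (h : {linear tens -> P}) :
  (forall m n, h (tmul m n) = f m n) -> h =1 tens_lift.
Proof.
move=> Hh; elim/tens_ind => [|x y Hx Hy|m n]; first by rewrite !linear0.
  by rewrite !linearD Hx Hy.
by rewrite Hh tens_lift_tmul.
Qed.

End Lift.

End Tensor.

Section TensorMap.
Variables (k : comPzRingType) (M N M' N' : lmodType k).
Variables (f : {linear M -> M'}) (g : {linear N -> N'}).

Lemma tens_map_bilin : bilin (fun m n => tmul (f m) (g n)).
Proof.
split=> [n|m] a x y.
  by rewrite linearP (tmul_bilin M' N').1.
by rewrite linearP (tmul_bilin M' N').2.
Qed.

Definition tens_map : {linear tens M N -> tens M' N'} :=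
  tens_lift tens_map_bilin.

Lemma tens_map_tmul m n : tens_map (tmul m n) = tmul (f m) (g n).
Proof. exact: tens_lift_tmul. Qed.

End TensorMap.

Section TensorMapTheory.
Variable k : comPzRingType.

Lemma tens_map_id (M N : lmodType k)
    (f : {linear M -> M}) (g : {linear N -> N}) :
  f =1 id -> g =1 id -> forall x, tens_map f g x = x.
Proof.
move=> Hf Hg; elim/tens_ind => [|x y Hx Hy|m n]; first by rewrite linear0.
  by rewrite linearD Hx Hy.
by rewrite tens_map_tmul Hf Hg.
Qed.

Lemma tens_map_comp (M N M' N' M'' N'' : lmodType k)
    (f : {linear M -> M'}) (g : {linear N -> N'})
    (f' : {linear M' -> M''}) (g' : {linear N' -> N''})
    (h : {linear M -> M''}) (l : {linear N -> N''}) :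
  f' \o f =1 h -> g' \o g =1 l ->
  forall x, tens_map f' g' (tens_map f g x) = tens_map h l x.
Proof.
move=> Hf Hg; elim/tens_ind => [|x y Hx Hy|m n]; first by rewrite !linear0.
  by rewrite !linearD Hx Hy.
by rewrite !tens_map_tmul -Hf -Hg.
Qed.

Lemma tens_map_square (M N M1 N1 M2 N2 M3 N3 : lmodType k)
    (f : {linear M -> M1}) (g : {linear N -> N1})
    (f' : {linear M1 -> M3}) (g' : {linear N1 -> N3})
    (h : {linear M -> M2}) (l : {linear N -> N2})
    (h' : {linear M2 -> M3}) (l' : {linear N2 -> N3}) :
  f' \o f =1 h' \o h -> g' \o g =1 l' \o l ->
  forall x, tens_map f' g' (tens_map f g x) = tens_map h' l' (tens_map h l x).
Proof.
move=> Hf Hg x.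
rewrite (tens_map_comp (h := f' \o f) (l := g' \o g)) //; apply/esym.
by apply: tens_map_comp => y; apply/esym; [apply: Hf|apply: Hg].
Qed.

Lemma tens_map_eq0l (M N M' N' : lmodType k)
    (f : {linear M -> M'}) (g : {linear N -> N'}) :
  (forall m, f m = 0) -> forall x, tens_map f g x = 0.
Proof.
move=> Hf; elim/tens_ind => [|x y Hx Hy|m n]; first by rewrite linear0.
  by rewrite linearD Hx Hy addr0.
by rewrite tens_map_tmul Hf (bilin0l (tmul_bilin _ _)).
Qed.

Lemma tens_map_eq0r (M N M' N' : lmodType k)
    (f : {linear M -> M'}) (g : {linear N -> N'}) :
  (forall n, g n = 0) -> forall x, tens_map f g x = 0.
Proof.
move=> Hg; elim/tens_ind => [|x y Hx Hy|m n]; first by rewrite linear0.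
  by rewrite linearD Hx Hy addr0.
by rewrite tens_map_tmul Hg (bilin0r (tmul_bilin _ _)).
Qed.

End TensorMapTheory.

(* A module over the group algebra kG is encoded as a k-module with a k-linear
   left action of G. *)

Section KG.
Variables (k : comPzRingType) (gT : finGroupType).

Record kGmod := KGMod {
  kG_car :> lmodType k;
  kG_act : gT -> {linear kG_car -> kG_car};
  kG_act1 : forall x, kG_act 1%g x = x;
  kG_actM : forall g h x, kG_act (g * h)%g x = kG_act g (kG_act h x)
}.

Record kGhom (M N : kGmod) := KGHom {
  kG_fun :> {linear M -> N};
  kG_equiv : forall g x, kG_fun (kG_act M g x) = kG_act N g (kG_fun x)
}.

Definition kG_finite_gen (M : kGmod) : Prop :=
  exists n (e : 'I_n -> M), forall x : M, exists c : gT -> 'I_n -> k,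
    x = \sum_g \sum_(i < n) c g i *: kG_act M g (e i).

(* For V = 0 over a non-zero ring every short exact sequence is V-split whereas
   X (x) V^# (x) V = 0, so results on V-split sequences need a rank r > 0.  Over
   the zero ring, V = 0 is also free of rank 1. *)
Definition free_of_rank (V : lmodType k) (r : nat) : Prop :=
  exists e : 'I_r -> V, forall x : V,
    exists! c : {ffun 'I_r -> k}, x = \sum_(i < r) c i *: e i.

Section Homs.
Variables M N P : kGmod.

Definition kG_id : kGhom M M.
Proof. by exists (idfun : {linear M -> M}). Defined.

Definition kG_comp (g : kGhom N P) (f : kGhom M N) : kGhom M P.
Proof.
exists (g \o f : {linear M -> P}).
by move=> a x; rewrite /= !kG_equiv.
Defined.

Definition kG_zero : kGhom M N.
Proof.
exists (\0 : {linear M -> N}).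
by move=> a x; rewrite /= linear0.
Defined.

Definition kG_add (f g : kGhom M N) : kGhom M N.
Proof.
exists (f \+ g : {linear M -> N}).
by move=> a x; rewrite /= !kG_equiv linearD.
Defined.

Definition kG_opp (f : kGhom M N) : kGhom M N.
Proof.
exists (\- f : {linear M -> N}).
by move=> a x; rewrite /= !kG_equiv linearN.
Defined.

End Homs.

Definition kG_tens (M N : kGmod) : kGmod.
Proof.
exists (tens M N) (fun g => tens_map (kG_act M g) (kG_act N g)).
- by apply: tens_map_id; apply: kG_act1.
- move=> g h x; apply/esym; move: x.
  by apply: tens_map_comp => y; rewrite /= kG_actM.
Defined.

Definition kG_tens_hom (M N M' N' : kGmod) (f : kGhom M M') (g : kGhom N N') :
  kGhom (kG_tens M N) (kG_tens M' N').
Proof.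
exists (tens_map f g : {linear kG_tens M N -> kG_tens M' N'}).
by move=> a; apply: tens_map_square => y; rewrite /= kG_equiv.
Defined.

Section Dual.
Variable V : lmodType k.

Definition linear_form : {pred V -> k^o} := fun f => `[< linear f >].

Lemma linear_form_submod : submod_closed linear_form.
Proof.
split; first by apply/asboolP => a x y; rewrite scaler0 addr0.
move=> b f g /asboolP Lf /asboolP Lg; apply/asboolP => a x y.
rewrite !fctE /= Lf Lg !scalerDr !scalerA (mulrC b a) -!addrA.
by congr (_ + _); rewrite addrCA.
Qed.

HB.instance Definition _ :=
  GRing.isSubmodClosed.Build k (V -> k^o) linear_form linear_form_submod.

Record dual := Dual { dual_fun :> V -> k^o; _ : dual_fun \in linear_form }.
HB.instance Definition _ := [isSub for dual_fun].
HB.instance Definition _ := [Choice of dual by <:].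
HB.instance Definition _ := [SubChoice_isSubLmodule of dual by <:].

Lemma dual_linear (f : dual) : linear f.
Proof. by case: f => f /= /asboolP. Qed.

End Dual.

Section DualAct.
Variables (V : lmodType k) (a : {linear V -> V}).

Lemma dual_precomp_subproof (f : dual V) :
  (fun v => f (a v)) \in @linear_form V.
Proof. by apply/asboolP => b x y; rewrite linearP dual_linear. Qed.

Definition dual_precomp_fun (f : dual V) : dual V :=
  Dual (dual_precomp_subproof f).

Lemma dual_precomp_linear : linear dual_precomp_fun.
Proof. by move=> b f g; apply/val_inj/funext. Qed.

Definition dual_precomp : {linear dual V -> dual V} :=
  HB.pack dual_precomp_fun
    (GRing.isLinear.Build k (dual V) (dual V) *:%R _ dual_precomp_linear).

End DualAct.

Definition kG_dual (V : kGmod) : kGmod.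
Proof.
exists (dual V) (fun g => dual_precomp (kG_act V g^-1%g)).
- by move=> f; apply/val_inj/funext => v; rewrite /= invg1 kG_act1.
- by move=> g h f; apply/val_inj/funext => v; rewrite /= invMg kG_actM.
Defined.

Record complex := Complex {
  cx_ob :> int -> kGmod;
  cx_d : forall i, kGhom (cx_ob i) (cx_ob (i + 1));
  cx_dd : forall i x, cx_d (i + 1) (cx_d i x) = 0
}.

Record chmap (X Y : complex) := ChMap {
  ch_fun :> forall i, kGhom (X i) (Y i);
  ch_comm : forall i x, ch_fun (i + 1) (cx_d X i x) = cx_d Y i (ch_fun i x)
}.

Definition ch_id X : chmap X X.
Proof. by exists (fun i => kG_id (X i)). Defined.

Definition ch_comp X Y Z (g : chmap Y Z) (f : chmap X Y) : chmap X Z.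
Proof.
exists (fun i => kG_comp (g i) (f i)).
by move=> i x; rewrite /= !ch_comm.
Defined.

Definition ch_zero X Y : chmap X Y.
Proof.
exists (fun i => kG_zero (X i) (Y i)).
by move=> i x; rewrite /= linear0.
Defined.

Definition ch_add X Y (f g : chmap X Y) : chmap X Y.
Proof.
exists (fun i => kG_add (f i) (g i)).
by move=> i x; rewrite /= !ch_comm linearD.
Defined.

Definition ch_opp X Y (f : chmap X Y) : chmap X Y.
Proof.
exists (fun i => kG_opp (f i)).
by move=> i x; rewrite /= !ch_comm linearN.
Defined.

Definition Cpx : catData :=
  @CatData complex chmap (fun X Y f g => forall i x, f i x = g i x)
    ch_id ch_comp ch_zero ch_add ch_opp.

(* A module is a complex concentrated in degree 0, so no sign occurs in the
   differential of [V (x) X] or [X (x) V]. *)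
Definition cx_tensl (V : kGmod) (X : complex) : complex.
Proof.
exists (fun i => kG_tens V (X i)) (fun i => kG_tens_hom (kG_id V) (cx_d X i)).
move=> i x.
rewrite [LHS](tens_map_comp (h := idfun) (l := cx_d X (i + 1) \o cx_d X i)) //.
by apply: tens_map_eq0r => y; apply: cx_dd.
Defined.

Definition cx_tensr (X : complex) (V : kGmod) : complex.
Proof.
exists (fun i => kG_tens (X i) V) (fun i => kG_tens_hom (cx_d X i) (kG_id V)).
move=> i x.
rewrite [LHS](tens_map_comp (h := cx_d X (i + 1) \o cx_d X i) (l := idfun)) //.
by apply: tens_map_eq0l => y; apply: cx_dd.
Defined.

Definition cx_tensl_map (V : kGmod) X Y (f : chmap X Y) :
  chmap (cx_tensl V X) (cx_tensl V Y).
Proof.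
exists (fun i => kG_tens_hom (kG_id V) (f i)).
by move=> i; apply: tens_map_square => y //=; rewrite ch_comm.
Defined.

Definition short_exact X Y Z (f : chmap X Y) (g : chmap Y Z) : Prop :=
  forall i, [/\ injective (f i), (forall z, exists y, g i y = z)
    & forall y, g i y = 0 <-> exists x, f i x = y].

Inductive boundedness := Unbounded | BoundedAbove | BoundedBelow | Bounded.

Definition bounded_above (X : complex) : Prop :=
  exists N : int, forall i, N < i -> forall x : X i, x = 0.

Definition bounded_below (X : complex) : Prop :=
  exists N : int, forall i, i < N -> forall x : X i, x = 0.

(* [fg] selects [cpx] against [Cpx]. *)
Definition in_cpx (fg : bool) (b : boundedness) (X : complex) : Prop :=
  (fg -> forall i, kG_finite_gen (X i)) /\
  match b with
  | Unbounded => True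
  | BoundedAbove => bounded_above X
  | BoundedBelow => bounded_below X
  | Bounded => bounded_above X /\ bounded_below X
  end.

Definition CpxSub (fg : bool) (b : boundedness) : catData :=
  full_subcategory (C := Cpx) (in_cpx fg b).

Definition V_split (V : kGmod) fg b : seqClass (CpxSub fg b) :=
  fun A B D f g => short_exact f g /\
    split_seq (C := Cpx) (cx_tensl_map V f) (cx_tensl_map V g).

Definition K_V_split (V : kGmod) fg b : catData :=
  stable_category (@V_split V fg b).

End KG.

Definition is_field (k : comPzRingType) : Prop :=
  (1 : k) <> 0 /\ forall x : k, x <> 0 -> exists y : k, x * y = 1.

(* Main.v *)
From Corelib Require Import Setoid Morphisms.
Require Import Defs.
From HB Require Import structures.
From mathcomp Require Import all_boot all_order all_fingroup all_algebra.
From mathcomp Require Import generic_quotient boolp functions.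

(* Choosing a basis of V identifies V (x) X with a twisted power X^r, on which G
   also mixes the copies through the matrices rho of V, and V^# (x) X with the
   power twisted by the dual matrices sigma; write W and W' for these functors.
   Matrix identities make W and W' adjoint to each other on both sides, so a
   V-split (that is, W-split) sequence admits lifting from, and extension to, the
   objects W' W X.  The counit W' W X -> X is a V-split deflation and the unit
   X -> W' W X a V-split inflation (this is where r > 0 is needed), so the
   projective and the injective objects are both the direct summands of the
   W' W X, which are the X (x) V^# (x) V.

   Over a field, the Cayley-Hamilton theorem in each of the finitely many non-zero
   degrees shows that a chain endomorphism f satisfies f^n = a f^(n+1) for some
   polynomial a in f.  The idempotent a^n f^n splits, which is a Fitting
   decomposition for f; it passes to the stable category.  Hence indecomposable
   objects of the stable category have local endomorphism rings, and every object
   decomposes by induction on the total number of generators.  Uniqueness is the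
   matching of two complete families of orthogonal local idempotents in the
   endomorphism ring. *)

Set Implicit Arguments.
Unset Strict Implicit.
Unset Printing Implicit Defensive.

Import Order.TTheory GRing.Theory Num.Theory.
Local Open Scope ring_scope.

(** * Submodules and quotient modules *)

(** Over an arbitrary [k] the kernel of a map between finitely generated modules need not be
    finitely generated, so kernels may leave the category. A V-split deflation is safe: its
    splitting makes [W A] a quotient of [W B], and since [r > 0], finiteness and boundedness descend
    from [W A] to [A]. Pullbacks are therefore built as kernels of maps already known to be
    deflations. In the stable category a stably zero object can be large: sizes make sense only
    before the quotient, indecomposability only after it. No idempotent is lifted to bridge this.
    The idempotent of a stable splitting is represented by an ordinary chain map, whose Fitting
    decomposition is taken among complexes. Either the chain map is nilpotent or invertible, which
    is impossible for a non-trivial stable idempotent, or the complex splits into strictly smaller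
    ones. *)

Section SubQuotientModules.
Local Open Scope quotient_scope.
Variables (k : comPzRingType) (gT : finGroupType) (M : kGmod k gT).

Definition is_submod (S : M -> Prop) : Prop :=
  [/\ S 0, forall a x y, S x -> S y -> S (a *: x + y)
    & forall g x, S x -> S (kG_act M g x)].

Variables (S : M -> Prop) (hS : is_submod S).

Let submod0 : S 0. Proof. by case: hS. Qed.

Let submodP a x y : S x -> S y -> S (a *: x + y).
Proof. by case: hS => _ + _; apply. Qed.

Let submodN x : S x -> S (- x).
Proof. by move=> Sx; rewrite -scaleN1r -[X in S X]addr0; apply: submodP. Qed.

Let submodD x y : S x -> S y -> S (x + y).
Proof. by move=> Sx Sy; rewrite -[x]scale1r; apply: submodP. Qed.

(** The phantom argument keeps the closure proof in the term, so that the closure instance, valid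
    only for a submodule, has something to be attached to. [quotmod] carries one for the same
    reason. *)
Definition submod_pred (_ : is_submod S) : {pred M} := fun x => `[< S x >].

Lemma submod_pred_closed : submod_closed (submod_pred hS).
Proof.
split; first exact/asboolP.
by move=> a x y /asboolP Sx /asboolP Sy; apply/asboolP; apply: submodP.
Qed.

HB.instance Definition _ :=
  GRing.isSubmodClosed.Build k M (submod_pred hS) submod_pred_closed.

Record submod := Submod { submod_val : M; _ : submod_val \in submod_pred hS }.
HB.instance Definition _ := [isSub for submod_val].
HB.instance Definition _ := [Choice of submod by <:].
HB.instance Definition _ := [SubChoice_isSubLmodule of submod by <:].

Lemma submod_valP (x : submod) : S (val x).
Proof. by case: x => x /= /asboolP. Qed.

Definition to_submod x (Sx : S x) : submod :=
  Submod (introT (asboolP _) Sx : x \in submod_pred hS).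

Lemma submod_act_subproof g (x : submod) : S (kG_act M g (val x)).
Proof. by have [_ _ SA] := hS; apply/SA/submod_valP. Qed.

Definition submod_act_fun g (x : submod) : submod :=
  to_submod (submod_act_subproof g x).

Lemma submod_act_linear g : linear (submod_act_fun g).
Proof. by move=> a x y; apply/val_inj; rewrite /= linearP. Qed.

Definition submod_act g : {linear submod -> submod} :=
  HB.pack (submod_act_fun g)
    (GRing.isLinear.Build k submod submod *:%R _ (submod_act_linear g)).

Definition kG_sub : kGmod k gT.
Proof.
exists submod submod_act.
- by move=> x; apply/val_inj; rewrite /= kG_act1.
- by move=> g h x; apply/val_inj; rewrite /= kG_actM.
Defined.

Lemma submod_val_linear : linear (val : submod -> M).
Proof. by []. Qed.

Definition submod_incl : {linear submod -> M} :=
  HB.pack (val : submod -> M)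
    (GRing.isLinear.Build k submod M *:%R _ submod_val_linear).

Definition kG_sub_incl : kGhom kG_sub M.
Proof. by exists submod_incl. Defined.

Definition submod_rel (x y : M) : bool := `[< S (x - y) >].

Lemma submod_relP : equiv_class_of submod_rel.
Proof.
split=> [x|x y|y x z].
- by apply/asboolP; rewrite subrr.
- by apply/asboolP/asboolP => /submodN; rewrite opprB.
- move=> /asboolP H1 /asboolP H2; apply/asboolP.
  by rewrite -(subrKA y); apply: submodD.
Qed.

Canonical submod_equiv := EquivRelPack submod_relP.
Canonical submod_encModRel := defaultEncModRel submod_rel.

Definition quotmod (_ : is_submod S) := {eq_quot submod_rel}.
Local Notation Q := (quotmod hS).
HB.instance Definition _ : EqQuotient _ submod_rel Q := EqQuotient.on Q.
HB.instance Definition _ := Choice.on Q.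

Let pi (x : M) : Q := \pi_Q x.

Let piP x y : pi x = pi y <-> S (x - y).
Proof. by split=> [/eqmodP/asboolP|H] //; apply/eqmodP/asboolP. Qed.

Let repr_pi x : S (repr (pi x) - x).
Proof. by apply/piP; rewrite /pi reprK. Qed.

Let quot_add (x y : Q) : Q := pi (repr x + repr y).
Let quot_opp (x : Q) : Q := pi (- repr x).
Let quot_scale a (x : Q) : Q := pi (a *: repr x).
Let quot_act_fun g (x : Q) : Q := pi (kG_act M g (repr x)).

Let piD x y : quot_add (pi x) (pi y) = pi (x + y).
Proof. by apply/piP; rewrite opprD addrACA; apply: submodD. Qed.

Let piZ a x : quot_scale a (pi x) = pi (a *: x).
Proof. by apply/piP; rewrite -scalerBr -[_ *: _]addr0; apply: submodP. Qed.

Let piN x : quot_opp (pi x) = pi (- x).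
Proof. by apply/piP; rewrite -opprD; apply: submodN. Qed.

Let quot_ind (T : Q -> Prop) : (forall x, T (pi x)) -> forall x, T x.
Proof. by move=> H x; rewrite -[x]reprK; apply: H. Qed.

Let quot_addA : associative quot_add.
Proof.
by do 3!elim/quot_ind => ?; rewrite !piD addrA.
Qed.

Let quot_addC : commutative quot_add.
Proof. by do 2!elim/quot_ind => ?; rewrite !piD addrC. Qed.

Let quot_add0 : left_id (pi 0) quot_add.
Proof. by elim/quot_ind => ?; rewrite !piD add0r. Qed.

Let quot_addN : left_inverse (pi 0) quot_opp quot_add.
Proof. by elim/quot_ind => ?; rewrite piN piD addNr. Qed.

HB.instance Definition _ :=
  GRing.isZmodule.Build Q quot_addA quot_addC quot_add0 quot_addN.

Let add_pi x y : pi x + pi y = pi (x + y). Proof. exact: piD. Qed.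

Let quot_scaleA a b x : quot_scale a (quot_scale b x) = quot_scale (a * b) x.
Proof. by elim/quot_ind: x => ?; rewrite !piZ scalerA. Qed.

Let quot_scale1 : left_id 1 quot_scale.
Proof. by elim/quot_ind => ?; rewrite piZ scale1r. Qed.

Let quot_scaleDr : right_distributive quot_scale +%R.
Proof.
by move=> a; do 2!elim/quot_ind => ?; rewrite !(add_pi, piZ) scalerDr.
Qed.

Let quot_scaleDl x : {morph quot_scale^~ x : a b / a + b}.
Proof.
by move=> a b; elim/quot_ind: x => ?; rewrite !piZ add_pi scalerDl.
Qed.

HB.instance Definition _ := GRing.Zmodule_isLmodule.Build k Q
  quot_scaleA quot_scale1 quot_scaleDr quot_scaleDl.

Let pi_linear : linear pi.
Proof. by move=> a x y; rewrite -add_pi -piZ. Qed.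

Let pi_act g x : quot_act_fun g (pi x) = pi (kG_act M g x).
Proof. by apply/piP; rewrite -linearB; have [_ _ SA] := hS; apply: SA. Qed.

Let quot_act_linear g : linear (quot_act_fun g).
Proof.
move=> a; elim/quot_ind => x; elim/quot_ind => y.
by rewrite -pi_linear !pi_act linearP pi_linear.
Qed.

Definition quot_act g : {linear Q -> Q} :=
  HB.pack (quot_act_fun g)
    (GRing.isLinear.Build k Q Q *:%R _ (quot_act_linear g)).

Definition kG_quot : kGmod k gT.
Proof.
exists Q quot_act.
- by elim/quot_ind => x; rewrite [LHS]pi_act kG_act1.
- move=> g h; elim/quot_ind => x.
  by rewrite [LHS]pi_act /= !pi_act kG_actM.
Defined.

Let quot_proj : {linear M -> Q} :=
  HB.pack pi (GRing.isLinear.Build k M Q *:%R _ pi_linear).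

Definition kG_quot_proj : kGhom M kG_quot.
Proof.
exists quot_proj.
by move=> g x; rewrite /= pi_act.
Defined.

Lemma kG_quot_proj_surj (y : kG_quot) : exists x, kG_quot_proj x = y.
Proof. by exists (repr y); apply: reprK. Qed.

Lemma kG_quot_proj_eq0 x : kG_quot_proj x = 0 <-> S x.
Proof. by rewrite [_ = 0]piP subr0. Qed.

End SubQuotientModules.

(** * Complexes *)

Section Complexes.
Variables (k : comPzRingType) (gT : finGroupType).
Local Notation kGmod := (kGmod k gT).
Local Notation complex := (complex k gT).
Local Notation Cpx := (Cpx k gT).

Definition mk_kGhom (M N : kGmod) (f : M -> N) (f_lin : linear f)
  (f_eqv : forall g x, f (kG_act M g x) = kG_act N g (f x)) : kGhom M N :=
  @KGHom k gT M N
    (HB.pack_for {linear M -> N} f (GRing.isLinear.Build k M N *:%R f f_lin))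
    f_eqv.

(** Any choice of preimages is a homomorphism, since each required equation can be tested after the
    injective [f]. The sigma type lets a lift be selected in every degree at once. *)
Lemma kG_lift_mono (A B X : kGmod) (f : kGhom A B) (h : kGhom X B) :
  injective f -> (forall x, exists a, f a = h x) ->
  {u : kGhom X A | forall x, f (u x) = h x}.
Proof.
move=> f_inj fh; pose u x := sval (cid (fh x)).
have uE x : f (u x) = h x by rewrite /u; case: cid.
have u_lin : linear u by move=> a x y; apply: f_inj; rewrite uE !linearP !uE.
have u_eqv g x : u (kG_act X g x) = kG_act A g (u x).
  by apply: f_inj; rewrite uE !kG_equiv uE.
by exists (mk_kGhom u_lin u_eqv).
Qed.

(** [h] is constant on the fibres of [g], so its composite with an arbitrary set-theoretic section
    of [g] is linear and equivariant. *)
Lemma kG_factor_epi (B D X : kGmod) (g : kGhom B D) (h : kGhom B X) :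
  (forall z, exists y, g y = z) -> (forall y, g y = 0 -> h y = 0) ->
  {u : kGhom D X | forall y, u (g y) = h y}.
Proof.
move=> g_surj gh; pose s z := sval (cid (g_surj z)).
have sE z : g (s z) = z by rewrite /s; case: cid.
have hs y z : g y = z -> h (s z) = h y.
  move=> gy; apply/eqP; rewrite -subr_eq0 -linearB gh //.
  by rewrite linearB /= sE gy subrr.
have u_lin : linear (h \o s).
  by move=> a x y /=; rewrite -linearP; apply: hs; rewrite linearP !sE.
have u_eqv a x : (h \o s) (kG_act D a x) = kG_act X a ((h \o s) x).
  by rewrite /= -kG_equiv; apply: hs; rewrite kG_equiv sE.
by exists (mk_kGhom u_lin u_eqv) => y; apply: hs.
Qed.

Section ChainMaps.
Variables A B D X : complex.

Lemma ch_lift_mono (f : chmap A B) (h : chmap X B) :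
  (forall i, injective (f i)) -> (forall i x, exists a, f i a = h i x) ->
  exists u : chmap X A, forall i x, f i (u i x) = h i x.
Proof.
move=> f_inj fh; pose u i := kG_lift_mono (f_inj i) (fh i).
have uE i x : f i (sval (u i) x) = h i x by case: (u i).
have u_comm i x : sval (u (i + 1)) (cx_d X i x) = cx_d A i (sval (u i) x).
  by apply: (f_inj _); rewrite uE !ch_comm uE.
by exists (ChMap u_comm).
Qed.

Lemma ch_factor_epi (g : chmap B D) (h : chmap B X) :
  (forall i z, exists y, g i y = z) -> (forall i y, g i y = 0 -> h i y = 0) ->
  exists u : chmap D X, forall i y, u i (g i y) = h i y.
Proof.
move=> g_surj gh; pose u i := kG_factor_epi (g_surj i) (gh i).
have uE i y : sval (u i) (g i y) = h i y by case: (u i).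
have u_comm i x : sval (u (i + 1)) (cx_d D i x) = cx_d X i (sval (u i) x).
  by have [y <-] := g_surj i x; rewrite -ch_comm !uE ch_comm.
by exists (ChMap u_comm).
Qed.

End ChainMaps.

Definition is_subcx (X : complex) (S : forall i, X i -> Prop) : Prop :=
  (forall i, is_submod (@S i)) /\
  (forall i x, S i x -> S (i + 1) (cx_d X i x)).

Lemma subcx_exists (X : complex) (S : forall i, X i -> Prop) : is_subcx S ->
  exists (Y : complex) (f : chmap Y X), (forall i, injective (f i)) /\
    forall i x, S i x <-> exists y, f i y = x.
Proof.
move=> [S_sub S_d]; pose Y i := kG_sub (S_sub i).
pose f i : kGhom (Y i) (X i) := kG_sub_incl (S_sub i).
have f_inj i : injective (f i) by apply: val_inj.
have fP i x : S i x -> exists y, f i y = x.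
  by move=> Sx; exists (to_submod (S_sub i) Sx).
have dP i (y : Y i) : exists z, f (i + 1) z = kG_comp (cx_d X i) (f i) y.
  by apply/fP/S_d/(submod_valP y).
pose d i := kG_lift_mono (f_inj (i + 1)) (dP i).
have dE i y : f (i + 1) (sval (d i) y) = cx_d X i (f i y).
  by case: (d i) => u /= ->.
have dd i y : sval (d (i + 1)) (sval (d i) y) = 0.
  by apply: (f_inj _); rewrite !dE cx_dd linear0.
exists (Complex dd); exists (@ChMap _ _ (Complex dd) X f dE); split=> // i x.
by split=> [/fP//|[y <-]]; apply: (submod_valP y).
Qed.

Lemma quotcx_exists (X : complex) (S : forall i, X i -> Prop) : is_subcx S ->
  exists (Y : complex) (g : chmap X Y), (forall i z, exists y, g i y = z) /\
    forall i x, g i x = 0 <-> S i x.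
Proof.
move=> [S_sub S_d]; pose Y i := kG_quot (S_sub i).
pose g i : kGhom (X i) (Y i) := kG_quot_proj (S_sub i).
have g_surj i z : exists x, g i x = z by apply: kG_quot_proj_surj.
have gP i x : g i x = 0 <-> S i x by apply: kG_quot_proj_eq0.
have dP i x : g i x = 0 -> kG_comp (g (i + 1)) (cx_d X i) x = 0.
  by move=> /gP/S_d; apply: (gP _ _).2.
pose d i := kG_factor_epi (g_surj i) (dP i).
have dE i x : sval (d i) (g i x) = g (i + 1) (cx_d X i x).
  by case: (d i) => u /= ->.
have dd i y : sval (d (i + 1)) (sval (d i) y) = 0.
  by have [x <-] := g_surj i y; rewrite !dE cx_dd linear0.
exists (Complex dd).
by exists (@ChMap _ _ X (Complex dd) g (fun i x => esym (dE i x))).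
Qed.

Lemma kernel_exists (B D : complex) (g : chmap B D) :
  (forall i z, exists y, g i y = z) ->
  exists A (f : chmap A B), short_exact f g.
Proof.
move=> g_surj; pose S i (x : B i) := g i x = 0.
have S_sub : is_subcx S.
  split=> i; last by move=> x; rewrite /S ch_comm => ->; rewrite linear0.
  rewrite /S; split=> [|a x y gx gy|a x gx]; first exact: linear0.
    by rewrite linearP gx gy scaler0 addr0.
  by rewrite kG_equiv gx linear0.
have [A [f [f_inj fP]]] := subcx_exists S_sub.
by exists A, f => i; split=> //; apply: fP.
Qed.

Lemma cokernel_exists (A B : complex) (f : chmap A B) :
  (forall i, injective (f i)) -> exists D (g : chmap B D), short_exact f g.
Proof.
move=> f_inj; pose S i (x : B i) := exists a, f i a = x.
have S_sub : is_subcx S.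
  split=> i; last by move=> _ [x <-]; exists (cx_d A i x); rewrite ch_comm.
  split=> [|a _ _ [x <-] [y <-]|a _ [x <-]]; first by exists 0; apply: linear0.
    by exists (a *: x + y); rewrite linearP.
  by exists (kG_act (A i) a x); rewrite kG_equiv.
have [D [g [g_surj gP]]] := quotcx_exists S_sub.
by exists D, g => i; split=> //; apply: gP.
Qed.

Definition prod_act (M N : kGmod) a (p : M * N) :=
  (kG_act M a p.1, kG_act N a p.2).

Lemma prod_act_linear M N a : linear (@prod_act M N a).
Proof. by move=> b x y; rewrite /prod_act /= !linearP. Qed.

Definition prod_act_lin (M N : kGmod) a :
    {linear (M * N)%type -> (M * N)%type} :=
  HB.pack (@prod_act M N a) (GRing.isLinear.Build k (M * N)%type (M * N)%type
    *:%R _ (@prod_act_linear M N a)).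

Definition kG_prod (M N : kGmod) : kGmod.
Proof.
exists (M * N)%type (fun a => prod_act_lin M N a).
- by case=> x y; rewrite /= /prod_act !kG_act1.
- by move=> g h [x y]; rewrite /= /prod_act /= !kG_actM.
Defined.

Definition kG_fst M N : kGhom (kG_prod M N) M.
Proof. by apply: (@mk_kGhom (kG_prod M N) M fst). Defined.

Definition kG_snd M N : kGhom (kG_prod M N) N.
Proof. by apply: (@mk_kGhom (kG_prod M N) N snd). Defined.

Definition kG_pair (X M N : kGmod) (f : kGhom X M) (g : kGhom X N) :
  kGhom X (kG_prod M N).
Proof.
apply: (@mk_kGhom X (kG_prod M N) (fun x => (f x, g x))).
- by move=> a x y; rewrite /= !linearP.
- by move=> a x; rewrite /= /prod_act /= !kG_equiv.
Defined.

Definition cx_prod (X Y : complex) : complex.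
Proof.
exists (fun i => kG_prod (X i) (Y i))
  (fun i => kG_pair (kG_comp (cx_d X i) (kG_fst (X i) (Y i)))
                    (kG_comp (cx_d Y i) (kG_snd (X i) (Y i)))).
by move=> i [x y]; rewrite /= !cx_dd.
Defined.

Lemma cx_biproduct (X Y : complex) : biproduct (C := Cpx) X Y (cx_prod X Y).
Proof.
exists (@ChMap _ _ X (cx_prod X Y) (fun i => kG_pair (kG_id _) (kG_zero _ _))
  (fun i x => congr1 (pair _) (esym (linear0 (cx_d Y i))))).
exists (@ChMap _ _ Y (cx_prod X Y) (fun i => kG_pair (kG_zero _ _) (kG_id _))
  (fun i x => congr1 (pair^~ _) (esym (linear0 (cx_d X i))))).
exists (@ChMap _ _ (cx_prod X Y) X (fun i => kG_fst _ _) (fun i x => erefl)).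
exists (@ChMap _ _ (cx_prod X Y) Y (fun i => kG_snd _ _) (fun i x => erefl)).
split=> // i [x y] /=; congr (_, _); [exact: addr0|exact: add0r].
Qed.

Definition kG_null : kGmod.
Proof. by exists 'rV[k]_0 (fun=> idfun). Defined.

Definition cx_null : complex.
Proof. by exists (fun=> kG_null) (fun=> kG_zero _ _). Defined.

Lemma cx_null_eq0 i (x : cx_null i) : x = 0.
Proof. exact: thinmx0. Qed.

Lemma cx_null_is_zero : is_zero (C := Cpx) cx_null.
Proof.
move=> X; split=> f i x; first exact: cx_null_eq0.
by rewrite [x]cx_null_eq0 linear0.
Qed.

Lemma Cpx_additive : is_additive Cpx.
Proof.
split.
- by [].
- by move=> A B f g fg i x.
- by move=> A B f g h fg gh i x; rewrite fg gh.
- by move=> A B D g g' f f' gg ff i x /=; rewrite ff gg.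
- by move=> A B f f' g g' ff gg i x /=; rewrite ff gg.
- by move=> A B f f' ff i x /=; rewrite ff.
- by [].
- by [].
- by [].
- by move=> A B f g h i x /=; rewrite addrA.
- by move=> A B f g i x /=; rewrite addrC.
- by move=> A B f i x /=; rewrite add0r.
- by move=> A B f i x /=; rewrite addNr.
- by [].
- by move=> A B D g f f' i x /=; rewrite linearD.
- by exists cx_null; apply: cx_null_is_zero.
- by move=> A B; exists (cx_prod A B); apply: cx_biproduct.
Qed.

Lemma biproduct_short_exact (A B S : complex) (i1 : chmap A S) (i2 : chmap B S)
    (p1 : chmap S A) (p2 : chmap S B) :
  is_biproduct (C := Cpx) i1 i2 p1 p2 -> short_exact i1 p2.
Proof.
move=> [p1i1 p2i2 p2i1 p1i2 sumE] i; split.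
- by apply: (can_inj (g := p1 i)) => x; apply: p1i1.
- by move=> z; exists (i2 i z); apply: p2i2.
- move=> y; split=> [p2y|[x <-]]; last exact: p2i1.
  exists (p1 i y); have /= := sumE i y.
  by rewrite p2y linear0 addr0.
Qed.

Section ShortExact.
Variables (A B D : complex) (f : chmap A B) (g : chmap B D).
Hypothesis fg : short_exact f g.

Lemma short_exact_comp0 i x : g i (f i x) = 0.
Proof. by have [_ _ gf] := fg i; apply/gf; exists x. Qed.

Lemma short_exact_lift X (h : chmap X B) : (forall i x, g i (h i x) = 0) ->
  exists u : chmap X A, forall i x, f i (u i x) = h i x.
Proof.
move=> gh; apply: ch_lift_mono => i; first by have [] := fg i.
by move=> x; have [_ _ gf] := fg i; apply/gf.
Qed.

Lemma short_exact_factor X (h : chmap B X) : (forall i x, h i (f i x) = 0) ->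
  exists u : chmap D X, forall i y, u i (g i y) = h i y.
Proof.
move=> hf; apply: ch_factor_epi => i; first by have [] := fg i.
by move=> y; have [_ _ gf] := fg i => /gf [x <-].
Qed.

Lemma short_exact_retraction (r : chmap B A) :
  (forall i x, r i (f i x) = x) -> split_seq (C := Cpx) f g.
Proof.
(* [id - f r] kills the image of [f], so it factors through [g]; the factor is the section
   complementary to [r]. *)
move=> rf; pose h := ch_add (ch_id B) (ch_opp (ch_comp f r)).
have hf i x : h i (f i x) = 0 by rewrite /= rf subrr.
have [s sg] := short_exact_factor hf.
have gs i z : g i (s i z) = z.
  have [_ /(_ z) [y <-] _] := fg i.
  by rewrite sg /= linearB /= short_exact_comp0 subr0.
exists s, r; split=> // i x /=.
- exact: short_exact_comp0.
- have [_ /(_ x) [y <-] _] := fg i.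
  by rewrite sg /= linearB /= rf subrr.
- by rewrite sg /= addrC subrK.
Qed.

Lemma short_exact_section (s : chmap D B) :
  (forall i z, g i (s i z) = z) -> split_seq (C := Cpx) f g.
Proof.
move=> gs; pose h := ch_add (ch_id B) (ch_opp (ch_comp s g)).
have gh i y : g i (h i y) = 0 by rewrite /= linearB /= gs subrr.
have [r fr] := short_exact_lift gh.
apply: (short_exact_retraction (r := r)) => i x.
have [f_inj _ _] := fg i; apply: f_inj.
by rewrite fr /= short_exact_comp0 linear0 subr0.
Qed.

End ShortExact.

End Complexes.

(** * Twisted powers and their adjunctions *)

Section TwistedPowers.
Variables (k : comPzRingType) (gT : finGroupType) (r : nat).
Local Notation kGmod := (kGmod k gT).
Local Notation complex := (complex k gT).
Local Notation Cpx := (Cpx k gT).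

Lemma sum_delta (M : nmodType) (F : 'I_r -> M) i :
  \sum_j F j *+ (i == j) = F i.
Proof.
by rewrite (bigD1 i) //= eqxx big1 ?addr0 // => j /negPf; rewrite eq_sym => ->.
Qed.

Record matrep := MatRep {
  rep_mx :> gT -> 'M[k]_r;
  rep_mx1 : rep_mx 1%g = 1%:M;
  rep_mxM : forall g h, rep_mx (g * h)%g = rep_mx g *m rep_mx h
}.

(** [sigma g] is the inverse transpose of [rho g]. The first relation makes the unit below
    equivariant, the second the counit. *)
Definition dual_reps (rho sigma : matrep) : Prop :=
  forall g, rho g *m (sigma g)^T = 1%:M /\ (rho g)^T *m sigma g = 1%:M.

Lemma dual_repsC rho sigma : dual_reps rho sigma -> dual_reps sigma rho.
Proof.
by move=> rs g; have [r1 r2] := rs g;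
  split; apply: trmx_inj; rewrite trmx_mul trmxK trmx1.
Qed.

Section Power.
Variables (rho : matrep) (M : kGmod).

(** A function [m] stands for the sum of the tensors of the i-th basis vector of a module with
    matrices [rho] and [m i]; the formula is the diagonal action in these coordinates. *)
Definition pow_act_fun g (m : {ffun 'I_r -> M}) : {ffun 'I_r -> M} :=
  [ffun i => \sum_j rho g i j *: kG_act M g (m j)].

Lemma pow_act_linear g : linear (pow_act_fun g).
Proof.
move=> a x y; apply/ffunP => i; rewrite !ffunE scaler_sumr -big_split /=.
apply: eq_bigr => j _; rewrite !ffunE linearP scalerDr !scalerA.
by rewrite [_ * a]mulrC.
Qed.

Definition pow_act g : {linear {ffun 'I_r -> M} -> {ffun 'I_r -> M}} :=
  HB.pack (pow_act_fun g) (GRing.isLinear.Build k {ffun 'I_r -> M}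
    {ffun 'I_r -> M} *:%R _ (pow_act_linear g)).

Definition kG_pow : kGmod.
Proof.
exists {ffun 'I_r -> M} pow_act.
- move=> m; apply/ffunP => i; rewrite ffunE -[RHS](sum_delta m).
  apply: eq_bigr => j _.
  by rewrite rep_mx1 kG_act1 mxE eq_sym scaler_nat eq_sym.
- move=> g h m; apply/ffunP => i; rewrite !ffunE.
  under [RHS]eq_bigr => j _ do rewrite ffunE linear_sum scaler_sumr.
  rewrite exchange_big; apply: eq_bigr => j _.
  rewrite rep_mxM kG_actM mxE scaler_suml; apply: eq_bigr => l _.
  by rewrite linearZ scalerA.
Defined.

End Power.

Definition kG_pow_map (rho : matrep) (M N : kGmod) (f : kGhom M N) :
  kGhom (kG_pow rho M) (kG_pow rho N).
Proof.
apply: (@mk_kGhom k gT (kG_pow rho M) (kG_pow rho N)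
  (fun m => [ffun i => f (m i)])).
- by move=> a x y; apply/ffunP => i; rewrite !ffunE linearP.
- move=> g x; apply/ffunP => i; rewrite !ffunE linear_sum.
  by apply: eq_bigr => j _; rewrite linearZ ffunE kG_equiv.
Defined.

Lemma kG_pow_mapE (rho : matrep) (M N : kGmod) (f : kGhom M N) m i :
  kG_pow_map rho f m i = f (m i).
Proof. exact: ffunE. Qed.

Definition cx_pow (rho : matrep) (X : complex) : complex.
Proof.
exists (fun i => kG_pow rho (X i)) (fun i => kG_pow_map rho (cx_d X i)).
by move=> i x; apply/ffunP => a; rewrite !kG_pow_mapE cx_dd ffunE.
Defined.

Definition cx_pow_map (rho : matrep) (X Y : complex) (f : chmap X Y) :
  chmap (cx_pow rho X) (cx_pow rho Y).
Proof.
exists (fun i => kG_pow_map rho (f i)).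
by move=> i x; apply/ffunP => a; rewrite !kG_pow_mapE ch_comm.
Defined.

Lemma cx_pow_mapE rho (X Y : complex) (f : chmap X Y) i (x : cx_pow rho X i) a :
  cx_pow_map rho f i x a = f i (x a).
Proof. exact: ffunE. Qed.

Lemma pow_short_exact rho (A B D : complex) (f : chmap A B) (g : chmap B D) :
  short_exact f g -> short_exact (cx_pow_map rho f) (cx_pow_map rho g).
Proof.
move=> fg i; have [f_inj g_surj gf] := fg i; split.
- move=> x y /ffunP xy; apply/ffunP => a; apply: f_inj.
  by have := xy a; rewrite !cx_pow_mapE.
- move=> z; have [y yE] := fin_all_exists (fun a => g_surj (z a)).
  by exists (finfun y); apply/ffunP => a; rewrite cx_pow_mapE ffunE.
- move=> y; split=> [/ffunP gy|[x <-]].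
    have fx a : exists x, f i x = y a.
      by apply/gf; have := gy a; rewrite cx_pow_mapE ffunE.
    have [x xE] := fin_all_exists fx.
    by exists (finfun x); apply/ffunP => a; rewrite cx_pow_mapE ffunE.
  apply/ffunP => a; rewrite !cx_pow_mapE ffunE.
  exact: (short_exact_comp0 fg).
Qed.

Section Adjunction.
Variables (rho sigma : matrep) (rs : dual_reps rho sigma).

Let dual_reps_rows g i j : \sum_l rho g i l * sigma g j l = (i == j)%:R.
Proof.
have [/matrixP/(_ i j) + _] := rs g; rewrite !mxE => <-.
by apply: eq_bigr => l _; rewrite mxE.
Qed.

Let dual_reps_cols g i j : \sum_l rho g l i * sigma g l j = (i == j)%:R.
Proof.
have [_ /matrixP/(_ i j)] := rs g; rewrite !mxE => <-.
by apply: eq_bigr => l _; rewrite mxE.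
Qed.

(** The coevaluation in coordinates: [x] is tensored with the sum of basis vectors paired with their
    dual vectors, which gives the scalar matrix of [x]. *)
Definition kG_unit (M : kGmod) : kGhom M (kG_pow rho (kG_pow sigma M)).
Proof.
apply: (@mk_kGhom k gT M (kG_pow rho (kG_pow sigma M))
  (fun x => [ffun i => [ffun j => x *+ (i == j)]])).
- move=> a x y; apply/ffunP => i; apply/ffunP => j.
  by rewrite !ffunE mulrnDl scalerMnr.
- move=> g x; apply/ffunP => i; apply/ffunP => j.
  rewrite !ffunE sum_ffunE.
  under eq_bigr => a _.
    rewrite !ffunE.
    under eq_bigr => b _ do rewrite !ffunE raddfMn -scalerMnr.
    rewrite (sum_delta (fun b => sigma g j b *: kG_act M g x)) scalerA.
    over.
  by rewrite -scaler_suml dual_reps_rows scaler_nat.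
Defined.

Lemma kG_unitE M x i j : kG_unit M x i j = x *+ (i == j).
Proof. by rewrite /= !ffunE. Qed.

(** The trace, that is, the evaluation pairing in coordinates. *)
Definition kG_counit (M : kGmod) : kGhom (kG_pow rho (kG_pow sigma M)) M.
Proof.
apply: (@mk_kGhom k gT (kG_pow rho (kG_pow sigma M)) M (fun n => \sum_i n i i)).
- move=> a x y; rewrite scaler_sumr -big_split /=.
  by apply: eq_bigr => i _; rewrite !ffunE.
- move=> g n; rewrite linear_sum /=.
  under eq_bigr => i _.
    rewrite ffunE sum_ffunE.
    under eq_bigr => a _ do rewrite !ffunE scaler_sumr.
    over.
  rewrite exchange_big /=; apply: eq_bigr => a _.
  rewrite exchange_big /= -[RHS](sum_delta (fun b => kG_act M g (n a b))).
  apply: eq_bigr => b _; under eq_bigr => i _ do rewrite scalerA.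
  by rewrite -scaler_suml dual_reps_cols scaler_nat.
Defined.

Lemma kG_counitE M n : kG_counit M n = \sum_i n i i.
Proof. by []. Qed.

Definition cx_unit (X : complex) : chmap X (cx_pow rho (cx_pow sigma X)).
Proof.
exists (fun i => kG_unit (X i)) => i x; apply/ffunP => a; apply/ffunP => b.
by rewrite kG_unitE !kG_pow_mapE kG_unitE raddfMn.
Defined.

Definition cx_counit (X : complex) : chmap (cx_pow rho (cx_pow sigma X)) X.
Proof.
exists (fun i => kG_counit (X i)) => i n; rewrite !kG_counitE linear_sum.
by apply: eq_bigr => a _; rewrite !kG_pow_mapE.
Defined.

Lemma cx_unitE X i x a b : cx_unit X i x a b = x *+ (a == b).
Proof. exact: kG_unitE. Qed.

Lemma cx_counitE X i (n : cx_pow rho (cx_pow sigma X) i) :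
  cx_counit X i n = \sum_a (n a : cx_pow sigma X i) a.
Proof. by []. Qed.

Lemma cx_unit_nat (X Y : complex) (f : chmap X Y) i x :
  cx_pow_map rho (cx_pow_map sigma f) i (cx_unit X i x) = cx_unit Y i (f i x).
Proof.
apply/ffunP => a; apply/ffunP => b.
by rewrite !cx_pow_mapE !cx_unitE raddfMn.
Qed.

Lemma cx_counit_nat (X Y : complex) (f : chmap X Y) i n :
  cx_counit Y i (cx_pow_map rho (cx_pow_map sigma f) i n) =
  f i (cx_counit X i n).
Proof.
rewrite !cx_counitE linear_sum.
by apply: eq_bigr => a _; rewrite !cx_pow_mapE.
Qed.

Hypothesis r_gt0 : (0 < r)%N.

Lemma cx_unit_inj (X : complex) i : injective (cx_unit X i).
Proof.
move=> x y /ffunP/(_ (Ordinal r_gt0))/ffunP/(_ (Ordinal r_gt0)).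
by rewrite !cx_unitE eqxx.
Qed.

Lemma cx_counit_surj (X : complex) i x : exists n, cx_counit X i n = x.
Proof.
pose a := Ordinal r_gt0.
exists [ffun b => [ffun c => x *+ (a == b)]]; rewrite cx_counitE.
rewrite -[RHS](sum_delta (fun=> x) a).
by apply: eq_bigr => b _; rewrite !ffunE.
Qed.

End Adjunction.

Section Triangles.
Variables (rho sigma : matrep) (rs : dual_reps rho sigma).
Variables (sr : dual_reps sigma rho).

(** With the next lemma, the two triangle identities that make the power by [rho] left adjoint to
    the power by [sigma]. Exchanging the two representations gives the adjunction on the other
    side. *)
Lemma cx_triangle (X : complex) i x :
  cx_counit rs (cx_pow rho X) i (cx_pow_map rho (cx_unit sr X) i x) = x.
Proof.
rewrite cx_counitE; apply/ffunP => c; rewrite sum_ffunE -[RHS](sum_delta x).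
by apply: eq_bigr => a _; rewrite cx_pow_mapE cx_unitE eq_sym.
Qed.

Lemma cx_triangle' (X : complex) i x :
  cx_pow_map sigma (cx_counit rs X) i (cx_unit sr (cx_pow sigma X) i x) = x.
Proof.
apply/ffunP => a; rewrite cx_pow_mapE cx_counitE -[RHS](sum_delta x).
apply: eq_bigr => b _; have := cx_unitE sr x a b.
by move=> ->; rewrite ffunMnE.
Qed.

End Triangles.

(** The symmetry of the two outer tensor factors, as transposition of matrices; it is equivariant
    because scalars of [k] commute. *)
Definition kG_pow_swap (rho sigma : matrep) (M : kGmod) :
  kGhom (kG_pow rho (kG_pow sigma M)) (kG_pow sigma (kG_pow rho M)).
Proof.
apply: (@mk_kGhom k gT (kG_pow rho (kG_pow sigma M)) (kG_pow sigma (kG_pow rho M))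
  (fun n => [ffun a => [ffun b => n b a]])).
- by move=> a x y; apply/ffunP => b; apply/ffunP => c; rewrite !ffunE.
- move=> g n; apply/ffunP => b; apply/ffunP => a; rewrite !ffunE !sum_ffunE.
  under eq_bigr => c _.
    rewrite !ffunE scaler_sumr.
    under eq_bigr => d _ do rewrite scalerA mulrC -scalerA.
    over.
  rewrite exchange_big; apply: eq_bigr => c _.
  by rewrite !ffunE scaler_sumr; apply: eq_bigr => d _; rewrite !ffunE.
Defined.

Lemma kG_pow_swapE rho sigma M n a b : kG_pow_swap rho sigma M n a b = n b a.
Proof. by rewrite /= !ffunE. Qed.

Definition cx_pow_swap (rho sigma : matrep) (X : complex) :
  chmap (cx_pow rho (cx_pow sigma X)) (cx_pow sigma (cx_pow rho X)).
Proof.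
exists (fun i => kG_pow_swap rho sigma (X i)).
move=> i n; apply/ffunP => a; apply/ffunP => b.
by rewrite kG_pow_swapE !kG_pow_mapE kG_pow_swapE.
Defined.

Lemma cx_pow_swapK rho sigma X i n :
  cx_pow_swap sigma rho X i (cx_pow_swap rho sigma X i n) = n.
Proof.
by apply/ffunP => a; apply/ffunP => b; rewrite !kG_pow_swapE.
Qed.

End TwistedPowers.

(** * Tensor products in coordinates *)

Section Coordinates.
Variables (k : comPzRingType) (gT : finGroupType) (r : nat).
Local Notation kGmod := (kGmod k gT).
Local Notation complex := (complex k gT).
Local Notation Cpx := (Cpx k gT).
Local Notation matrep := (matrep k gT r).

(** Coordinate functions travel with the basis, so that the unique existence in [free_of_rank] is
    unfolded only once. *)
Definition is_coords (U : lmodType k) (e : 'I_r -> U) (c : 'I_r -> U -> k^o) :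
    Prop :=
  [/\ forall i, linear (c i), forall u, u = \sum_i c i u *: e i
    & forall i j, c i (e j) = (i == j)%:R].

Lemma coords_exist (U : lmodType k) :
  free_of_rank U r -> exists e c, @is_coords U e c.
Proof.
move=> [e e_free]; have [c cP] := choice e_free; exists e, (fun i u => c u i).
have cE u : u = \sum_i c u i *: e i by have [] := cP u.
have c_uniq u c' : u = \sum_i c' i *: e i -> forall i, c u i = c' i.
  move=> uE i; have [_ /(_ (finfun c')) ->] := cP u; first by rewrite ffunE.
  by rewrite {1}uE; apply: eq_bigr => j _; rewrite ffunE.
split=> // [i a x y|i j].
  apply: (c_uniq _ (fun i => a *: (c x i : k^o) + c y i)).
  rewrite {1}[x]cE {1}[y]cE scaler_sumr -big_split /=.
  by apply: eq_bigr => l _; rewrite scalerDl scalerA.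
apply: (c_uniq _ (fun i => (i == j)%:R)).
rewrite -[LHS](sum_delta e); apply: eq_bigr => l _.
by rewrite scaler_nat eq_sym.
Qed.

Section Basis.
Variables (U : kGmod) (e : 'I_r -> U) (c : 'I_r -> U -> k^o).
Hypothesis ec : is_coords e c.

Let c_lin i : linear (c i). Proof. by case: ec. Qed.
Let cE u : u = \sum_i c i u *: e i. Proof. by case: ec. Qed.
Let ce i j : c i (e j) = (i == j)%:R. Proof. by case: ec. Qed.
Let cl i : {linear U -> k^o} :=
  HB.pack (c i) (GRing.isLinear.Build k U k^o *:%R _ (c_lin i)).

Lemma coords_sum i (a : 'I_r -> k) (x : 'I_r -> U) :
  c i (\sum_j a j *: x j) = \sum_j a j * c i (x j).
Proof.
rewrite -[LHS]/(cl i (\sum_j a j *: x j)) linear_sum.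
by apply: eq_bigr => j _; rewrite linearZ.
Qed.

Lemma coords_actE i g u :
  c i (kG_act U g u) = \sum_j c i (kG_act U g (e j)) * c j u.
Proof.
rewrite {1}[u]cE linear_sum.
under eq_bigr => j _ do rewrite linearZ.
by rewrite coords_sum; apply: eq_bigr => j _; rewrite mulrC.
Qed.

Definition basis_rep : matrep.
Proof.
exists (fun g => \matrix_(i, j) (c i (kG_act U g (e j)) : k)).
- by apply/matrixP => i j; rewrite !mxE kG_act1 ce.
- move=> g h; apply/matrixP => i j; rewrite !mxE kG_actM coords_actE.
  by apply: eq_bigr => l _; rewrite !mxE.
Defined.

Lemma basis_repE g i j : basis_rep g i j = c i (kG_act U g (e j)).
Proof. exact: mxE. Qed.

Lemma dual_basis_subproof i : c i \in @linear_form k U.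
Proof. exact/asboolP. Qed.

Definition dual_basis i : kG_dual U := Dual (dual_basis_subproof i).

Lemma dual_coords : is_coords dual_basis (fun i (phi : dual U) => phi (e i)).
Proof.
split=> [i a x y|phi|i j] //; last by rewrite /= ce eq_sym.
apply/val_inj/funext => u.
have phi_lin := dual_linear phi.
pose l : {linear U -> k^o} :=
  HB.pack (dual_fun phi) (GRing.isLinear.Build k U k^o *:%R _ phi_lin).
rewrite raddf_sum fct_sumE /= -[LHS]/(l u) {1}[u]cE linear_sum.
by apply: eq_bigr => j _; rewrite linearZ /= [_ *: _]mulrC.
Qed.

Section Tensor.
Variable M : kGmod.

Lemma tensl_bilin :
  bilin (fun (u : U) (m : M) => [ffun i => (c i u : k) *: m] : {ffun 'I_r -> M}).
Proof.
split=> [m a x y|u a x y]; apply/ffunP => i; rewrite !ffunE.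
  by rewrite c_lin scalerDl scalerA.
by rewrite scalerDr !scalerA mulrC.
Qed.

Lemma tensr_bilin :
  bilin (fun (m : M) (u : U) => [ffun i => (c i u : k) *: m] : {ffun 'I_r -> M}).
Proof. by have [b1 b2] := tensl_bilin. Qed.

Lemma coords_pow_act g u (m : M) :
  [ffun i => (c i (kG_act U g u) : k) *: kG_act M g m] =
  kG_act (kG_pow basis_rep M) g [ffun i => (c i u : k) *: m].
Proof.
apply/ffunP => i; rewrite !ffunE coords_actE scaler_suml.
by apply: eq_bigr => j _; rewrite ffunE linearZ scalerA basis_repE.
Qed.

Definition tensl_pow : kGhom (kG_tens U M) (kG_pow basis_rep M).
Proof.
exists (tens_lift tensl_bilin : {linear kG_tens U M -> kG_pow basis_rep M}).
move=> g; elim/tens_ind => [|x y Hx Hy|u m]; first by rewrite !linear0.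
  by rewrite !linearD Hx Hy.
by rewrite [kG_act _ _ _]tens_map_tmul !tens_lift_tmul coords_pow_act.
Defined.

Definition tensr_pow : kGhom (kG_tens M U) (kG_pow basis_rep M).
Proof.
exists (tens_lift tensr_bilin : {linear kG_tens M U -> kG_pow basis_rep M}).
move=> g; elim/tens_ind => [|x y Hx Hy|m u]; first by rewrite !linear0.
  by rewrite !linearD Hx Hy.
by rewrite [kG_act _ _ _]tens_map_tmul !tens_lift_tmul coords_pow_act.
Defined.

Lemma tensl_pow_tmul u m : tensl_pow (tmul u m) = [ffun i => (c i u : k) *: m].
Proof. exact: tens_lift_tmul. Qed.

Lemma tensr_pow_tmul m u : tensr_pow (tmul m u) = [ffun i => (c i u : k) *: m].
Proof. exact: tens_lift_tmul. Qed.

Lemma tensl_pow_inj : injective tensl_pow.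
Proof.
(* The inverse in coordinates; as it is additive, the identity need only be checked on pure
   tensors. *)
pose s (m : kG_pow basis_rep M) : kG_tens U M := \sum_i tmul (e i) (m i).
have s0 : s 0 = 0.
  by apply: big1 => i _; rewrite ffunE (bilin0r (tmul_bilin _ _)).
have sD x y : s (x + y) = s x + s y.
  rewrite -big_split; apply: eq_bigr => i _.
  by rewrite ffunE (bilinDr (tmul_bilin _ _)).
apply: (can_inj (g := s)); elim/tens_ind => [|x y Hx Hy|u m].
- by rewrite linear0.
- by rewrite linearD sD Hx Hy.
- rewrite tensl_pow_tmul {2}[u]cE.
  rewrite (big_morph (fun u => tmul u m) (fun x y => bilinDl (tmul_bilin U M) x y m)
             (bilin0l (tmul_bilin _ _) m)).
  apply: eq_bigr => i _; rewrite ffunE.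
  by rewrite (bilinZr (tmul_bilin _ _)) (bilinZl (tmul_bilin _ _)).
Qed.

Lemma tensr_pow_inj : injective tensr_pow.
Proof.
pose s (m : kG_pow basis_rep M) : kG_tens M U := \sum_i tmul (m i) (e i).
have s0 : s 0 = 0.
  by apply: big1 => i _; rewrite ffunE (bilin0l (tmul_bilin _ _)).
have sD x y : s (x + y) = s x + s y.
  rewrite -big_split; apply: eq_bigr => i _.
  by rewrite ffunE (bilinDl (tmul_bilin _ _)).
apply: (can_inj (g := s)); elim/tens_ind => [|x y Hx Hy|m u].
- by rewrite linear0.
- by rewrite linearD sD Hx Hy.
- rewrite tensr_pow_tmul {2}[u]cE.
  rewrite (big_morph (tmul m) (bilinDr (tmul_bilin _ _) _)
             (bilin0r (tmul_bilin _ _) m)).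
  apply: eq_bigr => i _; rewrite ffunE.
  by rewrite (bilinZr (tmul_bilin _ _)) (bilinZl (tmul_bilin _ _)).
Qed.

Lemma coords_pow_sum (m : kG_pow basis_rep M) :
  \sum_j [ffun i => (c i (e j) : k) *: m j] = m.
Proof.
apply/ffunP => i; rewrite sum_ffunE -[RHS](sum_delta m).
by apply: eq_bigr => j _; rewrite ffunE ce scaler_nat.
Qed.

Lemma tensl_pow_surj m : exists t, tensl_pow t = m.
Proof.
exists (\sum_i tmul (e i) (m i)); rewrite linear_sum.
by under eq_bigr => i _ do rewrite tensl_pow_tmul; apply: coords_pow_sum.
Qed.

Lemma tensr_pow_surj m : exists t, tensr_pow t = m.
Proof.
exists (\sum_i tmul (m i) (e i)); rewrite linear_sum.
by under eq_bigr => i _ do rewrite tensr_pow_tmul; apply: coords_pow_sum.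
Qed.

End Tensor.

Lemma tensl_pow_nat (M N : kGmod) (f : kGhom M N) t :
  tensl_pow N (kG_tens_hom (kG_id U) f t) =
  kG_pow_map basis_rep f (tensl_pow M t).
Proof.
elim/tens_ind: t => [|x y Hx Hy|u m]; first by rewrite !linear0.
  by rewrite !linearD Hx Hy.
rewrite [kG_tens_hom _ _ _]tens_map_tmul !tensl_pow_tmul.
by apply/ffunP => i; rewrite !ffunE linearZ.
Qed.

Lemma tensr_pow_nat (M N : kGmod) (f : kGhom M N) t :
  tensr_pow N (kG_tens_hom f (kG_id U) t) =
  kG_pow_map basis_rep f (tensr_pow M t).
Proof.
elim/tens_ind: t => [|x y Hx Hy|u m]; first by rewrite !linear0.
  by rewrite !linearD Hx Hy.
rewrite [kG_tens_hom _ _ _]tens_map_tmul !tensr_pow_tmul.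
by apply/ffunP => i; rewrite !ffunE linearZ.
Qed.

Definition cx_tensl_pow (X : complex) :
    chmap (cx_tensl U X) (cx_pow basis_rep X) :=
  @ChMap _ _ (cx_tensl U X) (cx_pow basis_rep X) (fun i => tensl_pow (X i))
    (fun i => tensl_pow_nat (cx_d X i)).

Definition cx_tensr_pow (X : complex) :
    chmap (cx_tensr X U) (cx_pow basis_rep X) :=
  @ChMap _ _ (cx_tensr X U) (cx_pow basis_rep X) (fun i => tensr_pow (X i))
    (fun i => tensr_pow_nat (cx_d X i)).

End Basis.

(** [g] acts on the dual by precomposition with its inverse, so its matrix there is the transpose of
    the matrix of the inverse of [g]. *)
Lemma dual_basis_reps (U : kGmod) (e : 'I_r -> U) (c : 'I_r -> U -> k^o)
    (ec : is_coords e c) :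
  dual_reps (basis_rep ec) (basis_rep (dual_coords ec)).
Proof.
move=> g; have -> : basis_rep (dual_coords ec) g = (basis_rep ec g^-1%g)^T.
  by apply/matrixP => i j; rewrite basis_repE !mxE.
by rewrite -trmx_mul trmxK -!rep_mxM mulgV mulVg !rep_mx1 trmx1.
Qed.

Lemma ch_inv (X Y : complex) (f : chmap X Y) :
  (forall i, injective (f i)) -> (forall i y, exists x, f i x = y) ->
  exists g : chmap Y X,
    (forall i x, g i (f i x) = x) /\ (forall i y, f i (g i y) = y).
Proof.
move=> f_inj f_surj; have [g fg] := ch_lift_mono (h := ch_id Y) f_inj f_surj.
by exists g; split=> // i x; apply: (f_inj i); rewrite fg.
Qed.

Lemma split_seq_transport (A B D A' B' D' : complex)
    (f : chmap A B) (g : chmap B D) (f' : chmap A' B') (g' : chmap B' D')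
    (a : chmap A A') (b : chmap B B') (d : chmap D D')
    (a' : chmap A' A) (b' : chmap B' B) (d' : chmap D' D) :
  (forall i x, a' i (a i x) = x) -> (forall i x, a i (a' i x) = x) ->
  (forall i x, b' i (b i x) = x) -> (forall i x, b i (b' i x) = x) ->
  (forall i x, d' i (d i x) = x) -> (forall i x, d i (d' i x) = x) ->
  (forall i x, b i (f i x) = f' i (a i x)) ->
  (forall i x, d i (g i x) = g' i (b i x)) ->
  split_seq (C := Cpx) f g -> split_seq (C := Cpx) f' g'.
Proof.
move=> aK a'K bK b'K dK d'K bf dg [s [q [/= qf gs gf qs sumE]]].
have f'E i x : f' i x = b i (f i (a' i x)) by rewrite bf a'K.
have g'E i x : g' i x = d i (g i (b' i x)) by rewrite dg b'K.
exists (ch_comp b (ch_comp s d')), (ch_comp a (ch_comp q b')).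
split=> i x /=; rewrite ?f'E ?g'E ?bK.
- by rewrite qf a'K.
- by rewrite gs d'K.
- by rewrite gf linear0.
- by rewrite qs linear0.
- by rewrite aK dK -linearD sumE b'K.
Qed.

Section TensorPowers.
Variables (U : kGmod) (e : 'I_r -> U) (c : 'I_r -> U -> k^o).
Hypothesis ec : is_coords e c.
Local Notation rho := (basis_rep ec).

(** The coordinate isomorphism is natural in the complex and so carries splittings in both
    directions. This lets the exact structure be studied through [rho] alone. *)
Lemma tensl_splitE (A B D : complex) (f : chmap A B) (g : chmap B D) :
  split_seq (C := Cpx) (cx_tensl_map U f) (cx_tensl_map U g) <->
  split_seq (C := Cpx) (cx_pow_map rho f) (cx_pow_map rho g).
Proof.
have inv X := @ch_inv _ _ (cx_tensl_pow ec X) (fun i => @tensl_pow_inj U e c ec (X i))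
  (fun i => @tensl_pow_surj U e c ec (X i)).
have [a [aK a'K]] := inv A; have [b [bK b'K]] := inv B.
have [d [dK d'K]] := inv D.
have nat (X Y : complex) (h : chmap X Y) i x :
    cx_tensl_pow ec Y i (cx_tensl_map U h i x) =
    cx_pow_map rho h i (cx_tensl_pow ec X i x) by apply: tensl_pow_nat.
split.
  exact: (split_seq_transport aK a'K bK b'K dK d'K (nat _ _ f) (nat _ _ g)).
apply: (split_seq_transport a'K aK b'K bK d'K dK) => i x.
  by rewrite -{1}[x]a'K -nat bK.
by rewrite -{1}[x]b'K -nat dK.
Qed.

Lemma tensr_iso (X : complex) :
  isomorphic (C := Cpx) (cx_tensr X U) (cx_pow rho X).
Proof.
have [g [fK gK]] := @ch_inv _ _ (cx_tensr_pow ec X)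
  (fun i => @tensr_pow_inj U e c ec (X i)) (fun i => @tensr_pow_surj U e c ec (X i)).
by exists (cx_tensr_pow ec X), g.
Qed.

End TensorPowers.

Lemma cx_pow_mapK (rho : matrep) (X Y : complex) (f : chmap X Y)
    (g : chmap Y X) :
  (forall i x, g i (f i x) = x) ->
  forall i x, cx_pow_map rho g i (cx_pow_map rho f i x) = x.
Proof. by move=> gf i x; apply/ffunP => a; rewrite !cx_pow_mapE gf. Qed.

Lemma pow_iso (rho : matrep) (X Y : complex) :
  isomorphic (C := Cpx) X Y ->
  isomorphic (C := Cpx) (cx_pow rho X) (cx_pow rho Y).
Proof.
move=> [f [g [gf fg]]]; exists (cx_pow_map rho f), (cx_pow_map rho g).
by split; apply: cx_pow_mapK.
Qed.

End Coordinates.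

(** * Finite generation over [k] and closure properties of the categories of complexes *)

Section FiniteGeneration.
Variable k : comPzRingType.
Implicit Types M N A B D : lmodType k.

Definition spanned M n : Prop :=
  exists e : 'I_n -> M, forall x, exists c : 'I_n -> k, x = \sum_i c i *: e i.

Lemma spanned_fin M (J : finType) (e : J -> M) :
  (forall x, exists c : J -> k, x = \sum_j c j *: e j) -> spanned M #|J|.
Proof.
move=> e_gen; exists (fun i => e (enum_val i)) => x.
have [c ->] := e_gen x; exists (fun i => c (enum_val i)).
by rewrite -[RHS](big_enum_val (A := J) (fun j => c j *: e j)).
Qed.

Lemma spanned_surj M N (f : {linear M -> N}) n :
  (forall y, exists x, f x = y) -> spanned M n -> spanned N n.
Proof.
move=> f_surj [e e_gen]; exists (f \o e) => y.
have [x <-] := f_surj y; have [c ->] := e_gen x; exists c.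
by rewrite linear_sum; apply: eq_bigr => i _; rewrite linearZ.
Qed.

Lemma spanned_ext A B D (f : {linear A -> B}) (g : {linear B -> D}) n m :
  (forall z, exists y, g y = z) -> (forall y, g y = 0 -> exists x, f x = y) ->
  spanned A n -> spanned D m -> exists l, spanned B l.
Proof.
move=> g_surj gf [e e_gen] [d d_gen].
have [d' d'E] := fin_all_exists (fun j => g_surj (d j)).
exists #|{: 'I_n + 'I_m}|.
apply: (@spanned_fin _ _ (fun j => match j with inl i => f (e i) | inr j => d' j end)).
move=> y; have [c cE] := d_gen (g y).
have [x xE] : exists x, f x = y - \sum_j c j *: d' j.
  apply: gf; rewrite linearB linear_sum cE; apply/eqP; rewrite subr_eq0.
  by apply/eqP/eq_bigr => j _; rewrite linearZ /= d'E.
have [b bE] := e_gen x.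
exists (fun j => match j with inl i => b i | inr j => c j end).
rewrite big_sumType /= -[LHS](subrK (\sum_j c j *: d' j)) -xE bE linear_sum.
by congr (_ + _); apply: eq_bigr => i _; rewrite linearZ.
Qed.

Lemma spanned_ffun r M n : spanned M n -> exists m, spanned {ffun 'I_r -> M} m.
Proof.
move=> [e e_gen]; exists #|{: 'I_r * 'I_n}|.
apply: (@spanned_fin _ _ (fun p => [ffun a => e p.2 *+ (a == p.1)])) => x.
have [c cE] := fin_all_exists (fun a => e_gen (x a)).
exists (fun p => c p.1 p.2).
rewrite -(pair_big xpredT xpredT (fun a i => c a i *: [ffun b => e i *+ (b == a)])) /=.
apply/ffunP => b; rewrite sum_ffunE cE -[LHS](sum_delta (fun a => \sum_i c a i *: e i)).
apply: eq_bigr => a _; rewrite sum_ffunE -sumrMnl; apply: eq_bigr => i _.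
by rewrite !ffunE scalerMnr.
Qed.

(** One fixed component of a generating family of the power generates [M], as constant functions
    show; such a component exists because [r > 0]. *)
Lemma spanned_ffun_inv r M n :
  (0 < r)%N -> spanned {ffun 'I_r -> M} n -> spanned M n.
Proof.
move=> r_gt0 [e e_gen]; exists (fun i => e i (Ordinal r_gt0)) => x.
have [c cE] := e_gen [ffun=> x]; exists c.
have /ffunP/(_ (Ordinal r_gt0)) := cE; rewrite ffunE sum_ffunE => ->.
by apply: eq_bigr => i _; rewrite ffunE.
Qed.

(** As the group is finite, the translates of finitely many generators over the group algebra are
    finitely many generators over [k]. Conversely, all coefficients are placed at the unit
    element. *)
Lemma kG_finite_genP gT (M : kGmod k gT) :
  kG_finite_gen M <-> exists n, spanned M n.
Proof.
split=> [[n [e e_gen]]|[n [e e_gen]]].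
  exists #|{: gT * 'I_n}|.
  apply: (@spanned_fin _ _ (fun p => kG_act M p.1 (e p.2))) => x.
  have [c ->] := e_gen x; exists (fun p => c p.1 p.2).
  exact: (pair_big xpredT xpredT (fun g i => c g i *: kG_act M g (e i))).
exists n, e => x; have [c ->] := e_gen x.
exists (fun g i => c i *+ (g == 1%g)).
rewrite [RHS](bigD1 1%g) //= [X in _ + X]big1 ?addr0 => [|g /negPf g1].
  by apply: eq_bigr => i _; rewrite eqxx kG_act1.
by apply: big1 => i _; rewrite g1 scale0r.
Qed.

End FiniteGeneration.

Section InCpx.
Variables (k : comPzRingType) (gT : finGroupType) (fg : bool) (b : boundedness).
Local Notation complex := (complex k gT).
Implicit Types X Y A B D : complex.

(** A form uniform in the four boundedness conditions, so that each closure property below has a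
    single proof. *)
Lemma in_cpxP X : in_cpx fg b X <->
  (fg -> forall i, exists n, spanned (X i) n) /\
  [/\ (b = BoundedAbove \/ b = Bounded -> bounded_above X)
    & (b = BoundedBelow \/ b = Bounded -> bounded_below X)].
Proof.
split=> -[X_fg X_b].
  split=> [f i|]; first exact/kG_finite_genP/X_fg.
  by case: b X_b => [_|h|h|[h1 h2]]; split=> // -[].
split=> [f i|]; first exact/kG_finite_genP/X_fg.
by case: b X_b => // -[X1 X2]; do ?split; (apply: X1 || apply: X2); auto.
Qed.

Lemma in_cpx_surj X Y (f : chmap X Y) :
  (forall i y, exists x, f i x = y) -> in_cpx fg b X -> in_cpx fg b Y.
Proof.
move=> f_surj /in_cpxP[X_fg [X_a X_b]]; apply/in_cpxP.
have Y0 i : (forall x : X i, x = 0) -> forall y : Y i, y = 0.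
  by move=> X0 y; have [x <-] := f_surj i y; rewrite [x]X0 linear0.
split=> [h i|].
  by have [n Xn] := X_fg h i; exists n; apply: spanned_surj Xn.
split=> h; [have [N XN] := X_a h|have [N XN] := X_b h].
  by exists N => i Ni; apply/Y0/XN.
by exists N => i Ni; apply/Y0/XN.
Qed.

Lemma in_cpx_ext A B D (f : chmap A B) (g : chmap B D) :
  short_exact f g -> in_cpx fg b A -> in_cpx fg b D -> in_cpx fg b B.
Proof.
move=> E /in_cpxP[A_fg [A_a A_b]] /in_cpxP[D_fg [D_a D_b]]; apply/in_cpxP.
have B0 i : (forall x : A i, x = 0) -> (forall x : D i, x = 0) ->
    forall y : B i, y = 0.
  move=> A0 D0 y; have [_ _ gf] := E i.
  by have /gf[x <-] := D0 (g i y); rewrite [x]A0 linear0.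
split=> [h i|].
  have [n An] := A_fg h i; have [m Dm] := D_fg h i; have [_ g_surj gf] := E i.
  by apply: (spanned_ext g_surj _ An Dm) => y; apply: (gf y).1.
split=> h.
  have [N AN] := A_a h; have [N' DN'] := D_a h.
  by exists (Order.max N N') => i; rewrite gt_max => /andP[Ni N'i];
    apply: B0; [apply: AN|apply: DN'].
have [N AN] := A_b h; have [N' DN'] := D_b h.
by exists (Order.min N N') => i; rewrite lt_min => /andP[Ni N'i];
  apply: B0; [apply: AN|apply: DN'].
Qed.

Lemma in_cpx_prod X Y :
  in_cpx fg b X -> in_cpx fg b Y -> in_cpx fg b (cx_prod X Y).
Proof.
have [i1 [i2 [p1 [p2 /biproduct_short_exact E]]]] := cx_biproduct X Y.
exact: in_cpx_ext E.
Qed.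

Lemma in_cpx_null : in_cpx fg b (cx_null k gT).
Proof.
apply/in_cpxP; split=> [_ i|]; last first.
  by split=> _; exists 0 => i _ x; apply: (@cx_null_eq0 _ _ i).
exists 0%N, (fun=> 0) => x; exists (fun=> 0); rewrite big_ord0.
exact: (@cx_null_eq0 _ _ i).
Qed.

Lemma in_cpx_pow r (rho : matrep k gT r) X :
  in_cpx fg b X -> in_cpx fg b (cx_pow rho X).
Proof.
move=> /in_cpxP[X_fg [X_a X_b]]; apply/in_cpxP.
have W0 i : (forall x : X i, x = 0) -> forall y : cx_pow rho X i, y = 0.
  by move=> X0 y; apply/ffunP => a; rewrite ffunE; apply: X0.
split=> [h i|].
  by have [n Xn] := X_fg h i; apply: (spanned_ffun r Xn).
split=> h; [have [N XN] := X_a h|have [N XN] := X_b h].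
  by exists N => i Ni; apply/W0/XN.
by exists N => i Ni; apply/W0/XN.
Qed.

Lemma in_cpx_pow_inv r (rho : matrep k gT r) X : (0 < r)%N ->
  in_cpx fg b (cx_pow rho X) -> in_cpx fg b X.
Proof.
move=> r_gt0 /in_cpxP[W_fg [W_a W_b]]; apply/in_cpxP.
have X0 i : (forall y : cx_pow rho X i, y = 0) -> forall x : X i, x = 0.
  move=> W0 x; have /ffunP/(_ (Ordinal r_gt0)) := W0 [ffun=> x].
  by rewrite !ffunE.
split=> [h i|].
  by have [n Wn] := W_fg h i; exists n; apply: spanned_ffun_inv Wn.
split=> h; [have [N WN] := W_a h|have [N WN] := W_b h].
  by exists N => i Ni; apply/X0/WN.
by exists N => i Ni; apply/X0/WN.
Qed.

End InCpx.

(** * The Frobenius structure *)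

Lemma biproductC (C : catData) (A B S : ob C) :
  is_additive C -> biproduct A B S -> biproduct B A S.
Proof.
move=> HC [i1 [i2 [p1 [p2 [? ? ? ? sumE]]]]].
by exists i2, i1, p2, p1; split=> //; apply: heq_trans (addmC HC _ _) sumE.
Qed.

Section StableCategory.
Variables (C : catData) (E : seqClass C).
Hypotheses (HC : is_additive C)
  (strict : forall (A B : ob C) (f g : Defs.hom A B),
     heq f g -> stable_eq E f g).

Lemma stable_is_biproduct (A B S : ob C) (i1 : Defs.hom A S)
    (i2 : Defs.hom B S) (p1 : Defs.hom S A) (p2 : Defs.hom S B) :
  is_biproduct i1 i2 p1 p2 ->
  is_biproduct (C := stable_category E) i1 i2 p1 p2.
Proof. by case=> h1 h2 h3 h4 h5; split; apply: strict. Qed.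

Hypotheses
  (sym : forall (A B : ob C) (f g : Defs.hom A B),
     stable_eq E f g -> stable_eq E g f)
  (trans : forall (A B : ob C) (f g h : Defs.hom A B),
     stable_eq E f g -> stable_eq E g h -> stable_eq E f h)
  (comp : forall (A B D : ob C) (g g' : Defs.hom B D) (f f' : Defs.hom A B),
     stable_eq E g g' -> stable_eq E f f' -> stable_eq E (cmp g f) (cmp g' f'))
  (add : forall (A B : ob C) (f f' g g' : Defs.hom A B),
     stable_eq E f f' -> stable_eq E g g' ->
     stable_eq E (addm f g) (addm f' g'))
  (opp : forall (A B : ob C) (f f' : Defs.hom A B),
     stable_eq E f f' -> stable_eq E (oppm f) (oppm f')).

(** The axioms are equations between maps, or ask for objects characterised by such equations; all
    of them persist under a coarser congruence. *)
Lemma stable_category_additive : is_additive (stable_category E).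
Proof.
split.
- by move=> A B f; apply/strict/(heq_refl HC).
- exact: sym.
- exact: trans.
- exact: comp.
- exact: add.
- exact: opp.
- by move=> *; apply/strict/(cmpA HC).
- by move=> *; apply/strict/(cmp1m HC).
- by move=> *; apply/strict/(cmpm1 HC).
- by move=> *; apply/strict/(addmA HC).
- by move=> *; apply/strict/(addmC HC).
- by move=> *; apply/strict/(add0m HC).
- by move=> *; apply/strict/(addNm HC).
- by move=> *; apply/strict/(cmpDl HC).
- by move=> *; apply/strict/(cmpDr HC).
- have [Z Z0] := has_zero HC; exists Z => X.
  by split=> f; apply: strict; [apply: (Z0 X).1|apply: (Z0 X).2].
- move=> A B; have [S [i1 [i2 [p1 [p2 bip]]]]] := has_biproducts HC A B.
  by exists S, i1, i2, p1, p2; apply: stable_is_biproduct.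
Qed.

End StableCategory.

Section Frobenius.
Variables (k : comPzRingType) (gT : finGroupType) (r : nat).
Local Notation complex := (complex k gT).
Local Notation Cpx := (Cpx k gT).
Local Open Scope cat_scope.

Variables (V : kGmod k gT) (rho sigma : matrep k gT r).
Hypotheses (rs : dual_reps rho sigma) (sr : dual_reps sigma rho).
Hypothesis r_gt0 : (0 < r)%N.
Hypothesis splitE : forall (A B D : complex) (f : chmap A B) (g : chmap B D),
  split_seq (C := Cpx) (cx_tensl_map V f) (cx_tensl_map V g) <->
  split_seq (C := Cpx) (cx_pow_map rho f) (cx_pow_map rho g).

Variables (fg : bool) (b : boundedness).
Local Notation C := (CpxSub k gT fg b).
Local Notation E := (V_split V (fg := fg) (b := b)).
Local Notation W := (cx_pow rho).
Local Notation W' := (cx_pow sigma).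
Local Notation Wm := (cx_pow_map rho).
Local Notation W'm := (cx_pow_map sigma).

Lemma V_split_section (A B D : ob C) (f : Defs.hom A B) (g : Defs.hom B D) :
  E f g -> short_exact f g /\ exists s : chmap (W (sval D)) (W (sval B)),
    forall i z, Wm g i (s i z) = z.
Proof.
by move=> [fg_ex /splitE [s [q [_ gs _ _ _]]]]; split=> //; exists s.
Qed.

Lemma V_split_retraction (A B D : ob C) (f : Defs.hom A B) (g : Defs.hom B D) :
  E f g -> short_exact f g /\ exists q : chmap (W (sval B)) (W (sval A)),
    forall i z, q i (Wm f i z) = z.
Proof.
by move=> [fg_ex /splitE [s [q [qf _ _ _ _]]]]; split=> //; exists q.
Qed.

Lemma inflationE (A B : ob C) (f : Defs.hom A B) : inflation E f <->
  (forall i, injective (ch_fun f i)) /\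
  exists q : chmap (W (sval B)) (W (sval A)), forall i z, q i (Wm f i z) = z.
Proof.
split=> [[D [g /V_split_retraction[fg_ex fq]]]|[f_inj [q qf]]].
  by split=> // i; have [] := fg_ex i.
have [D [g fg_ex]] := cokernel_exists f_inj.
have hD : in_cpx fg b D.
  by apply: (in_cpx_surj (f := g)) (svalP B) => i y; have [] := fg_ex i.
exists (exist _ D hD), g; split=> //; apply/splitE.
exact: short_exact_retraction (pow_short_exact rho fg_ex) _ qf.
Qed.

Lemma deflationE (B D : ob C) (g : Defs.hom B D) : deflation E g <->
  (forall i z, exists y, ch_fun g i y = z) /\
  exists s : chmap (W (sval D)) (W (sval B)), forall i z, Wm g i (s i z) = z.
Proof.
split=> [[A [f /V_split_section[fg_ex gs]]]|[g_surj [s gs]]].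
  by split=> // i; have [] := fg_ex i.
have [A [f fg_ex]] := kernel_exists g_surj.
have W_ex := pow_short_exact rho fg_ex.
have split_W := short_exact_section W_ex gs.
have hA : in_cpx fg b A.
  apply: (in_cpx_pow_inv (rho := rho)) => //.
  (* The retraction complementary to the section maps [W B] onto [W A], so [W A] inherits the
     finiteness conditions, which [in_cpx_pow_inv] passes on to [A]. *)
  have [s' [q [qf _ _ _ _]]] := split_W.
  apply: (in_cpx_surj (f := q)) (in_cpx_pow rho (svalP B)) => i y.
  by exists (Wm f i y); apply: qf.
by exists (exist _ A hA), f; split=> //; apply/splitE.
Qed.

Lemma cx_pow_map_comp (t : matrep k gT r) (X Y Z : complex)
    (f : chmap X Y) (g : chmap Y Z) (h : chmap X Z) :
  (forall i x, g i (f i x) = h i x) ->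
  forall i x, cx_pow_map t g i (cx_pow_map t f i x) = cx_pow_map t h i x.
Proof. by move=> gf i x; apply/ffunP => a; rewrite !cx_pow_mapE gf. Qed.

Lemma cx_pow_map0 (t : matrep k gT r) (X Y : complex) (f : chmap X Y) :
  (forall i x, f i x = 0%R) -> forall i x, cx_pow_map t f i x = 0%R.
Proof. by move=> f0 i x; apply/ffunP => a; rewrite cx_pow_mapE f0 ffunE. Qed.

Lemma CpxSub_additive : is_additive C.
Proof.
have H := Cpx_additive k gT; split.
- by move=> A B; apply: (heq_refl H).
- by move=> A B; apply: (heq_sym H).
- by move=> A B; apply: (heq_trans H).
- by move=> A B D; apply: (cmp_heq H).
- by move=> A B; apply: (addm_heq H).
- by move=> A B; apply: (oppm_heq H).
- by move=> A B D F; apply: (cmpA H).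
- by move=> A B; apply: (cmp1m H).
- by move=> A B; apply: (cmpm1 H).
- by move=> A B; apply: (addmA H).
- by move=> A B; apply: (addmC H).
- by move=> A B; apply: (add0m H).
- by move=> A B; apply: (addNm H).
- by move=> A B D; apply: (cmpDl H).
- by move=> A B D; apply: (cmpDr H).
- exists (exist _ _ (in_cpx_null k gT fg b)) => X.
  exact: cx_null_is_zero (sval X).
- move=> A B; exists (exist _ _ (in_cpx_prod (svalP A) (svalP B))).
  exact: cx_biproduct.
Qed.

Lemma V_split_exact_category : exact_category E.
Proof.
split.
- exact: CpxSub_additive.
- move=> A B D f g [fg_ex _]; split; split.
  + exact: short_exact_comp0.
  + move=> X h gh; split; first exact: (short_exact_lift fg_ex gh).
    move=> u v fu fv i x; have [f_inj _ _] := fg_ex i; apply: f_inj.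
    by rewrite [LHS]fu [RHS]fv.
  + exact: short_exact_comp0.
  + move=> X h hf; split; first exact: (short_exact_factor fg_ex hf).
    move=> u v ug vg i z; have [_ /(_ z)[y <-] _] := fg_ex i.
    by rewrite [LHS]ug [RHS]vg.
- move=> A B D A' B' D' f g f' g' a bb d [a' [a'a aa']] [b' [b'b bb']]
    [d' [d'd dd']] bf dg /V_split_retraction[fg_ex [q qf]].
  have f'E i x : ch_fun f' i x = ch_fun bb i (ch_fun f i (ch_fun a' i x)).
    by rewrite [RHS]bf /= [ch_fun a i _]aa'.
  have g'E i x : ch_fun g' i x = ch_fun d i (ch_fun g i (ch_fun b' i x)).
    by rewrite [RHS]dg /= [ch_fun bb i _]bb'.
  have fg'_ex : short_exact f' g'.
    move=> i; have [f_inj g_surj gf] := fg_ex i.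
    have b_inj : injective (ch_fun bb i) := can_inj (g := ch_fun b' i) (b'b i).
    have a'_inj : injective (ch_fun a' i) := can_inj (g := ch_fun a i) (aa' i).
    have d_inj : injective (ch_fun d i) := can_inj (g := ch_fun d' i) (d'd i).
    split.
    + by move=> x y; rewrite !f'E => /b_inj/f_inj/a'_inj.
    + move=> z; have [y yE] := g_surj (ch_fun d' i z).
      exists (ch_fun bb i y); rewrite g'E.
      by rewrite [ch_fun b' i _]b'b yE; apply: dd'.
    + move=> y; rewrite g'E; split.
        rewrite -(linear0 (ch_fun d i)) => /d_inj/gf[x xE].
        exists (ch_fun a i x); rewrite f'E [ch_fun a' i _]a'a xE; apply: bb'.
      move=> [x <-]; rewrite f'E [ch_fun b' i _]b'b.
      by rewrite (short_exact_comp0 fg_ex) linear0.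
  split=> //; apply/splitE.
  apply: (short_exact_retraction (pow_short_exact rho fg'_ex)
            (r := ch_comp (Wm a) (ch_comp q (Wm b')))) => i x.
  rewrite -[LHS]/(Wm a i (q i (Wm b' i (Wm f' i x)))).
  have -> : Wm b' i (Wm f' i x) = Wm f i (Wm a' i x).
    apply/ffunP => c; rewrite !cx_pow_mapE f'E; apply: b'b.
  by rewrite qf; apply: cx_pow_mapK.
- move=> A; apply/inflationE; split=> [i x y //|].
  by exists (ch_id _) => i z; apply/ffunP => c; rewrite cx_pow_mapE.
- move=> A; apply/deflationE; split=> [i z|]; first by exists z.
  by exists (ch_id _) => i z; apply/ffunP => c; rewrite cx_pow_mapE.
- move=> A B D g f /inflationE[f_inj [q qf]] /inflationE[g_inj [p pg]].
  apply/inflationE; split=> [i x y /g_inj/f_inj//|].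
  exists (ch_comp q p) => i z.
  rewrite -[LHS]/(q i (p i (Wm (ch_comp g f) i z))).
  by rewrite -(cx_pow_map_comp (f := f) (g := g) (h := ch_comp g f)) // pg qf.
- move=> A B D g f /deflationE[f_surj [q fq]] /deflationE[g_surj [p gp]].
  apply/deflationE; split=> [i z|].
    by have [y <-] := g_surj i z; have [x <-] := f_surj i y; exists x.
  exists (ch_comp q p) => i z.
  rewrite -[LHS]/(Wm (ch_comp g f) i (q i (p i z))).
  by rewrite -(cx_pow_map_comp (f := f) (g := g) (h := ch_comp g f)) // fq gp.
- move=> A B A' f a /inflationE[f_inj [q qf]].
  have [i1 [i2 [p1 [p2 [p11 p22 p21 p12 sumE]]]]] :=
    cx_biproduct (sval B) (sval A').
  (* The pushout is the cokernel of the map with components [f] and [- a] into the biproduct of [B]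
     and [A']. *)
  pose h : chmap (sval A) _ := ch_add (ch_comp i1 f) (ch_opp (ch_comp i2 a)).
  have p1h i x : p1 i (h i x) = ch_fun f i x.
    by rewrite linearB /= [p1 i _]p11 [p1 i (i2 i _)]p12 subr0.
  have p2h i x : p2 i (h i x) = (- ch_fun a i x)%R.
    by rewrite linearB /= [p2 i _]p21 [p2 i (i2 i _)]p22 sub0r.
  have h_inj i : injective (h i).
    by move=> x y /(congr1 (p1 i)); rewrite !p1h; apply: f_inj.
  have [B' [c hc]] := cokernel_exists h_inj.
  have c_surj i y : exists x, c i x = y by have [_ + _] := hc i; apply.
  have hB' : in_cpx fg b B'.
    by apply: in_cpx_surj c_surj (in_cpx_prod (svalP B) (svalP A')).
  exists (exist _ B' hB'), (ch_comp c i1), (ch_comp c i2); split.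
    split=> [i x|X x y xy].
      have /= := short_exact_comp0 hc x.
      by rewrite linearB => /eqP; rewrite subr_eq0 => /eqP.
    pose w := ch_add (ch_comp x p1) (ch_comp y p2).
    have wh i z : w i (h i z) = 0%R.
      by rewrite /w /= p1h p2h linearN [ch_fun x i _]xy /= subrr.
    split.
      have [u uc] := short_exact_factor hc wh; exists u.
      by split=> i z; rewrite [LHS]uc /= ?[p1 _ _]p11 ?[p2 _ _]p21 ?[p1 _ _]p12
         ?[p2 _ _]p22 linear0 ?addr0 ?add0r.
    move=> u v uv1 uv2 i z; have [t <-] := c_surj i z.
    rewrite -[t]sumE /= !linearD; congr (_ + _)%R; [exact: uv1|exact: uv2].
  apply/inflationE; split=> [i x y /= /eqP|].
    rewrite -subr_eq0 -!linearB => /eqP.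
    have [_ _ ch] := hc i; move=> /ch[z hz].
    (* Elements with the same image differ by some [h z] in the second factor; its first component
       [f z] vanishes. *)
    have z0 : z = 0%R.
      apply: (f_inj i); rewrite -p1h hz linear0.
      by rewrite [p1 _ _]p12.
    move: hz; rewrite z0 linear0 => /(congr1 (p2 i)); rewrite [RHS]p22 linear0.
    by move/esym/eqP; rewrite subr_eq0 => /eqP.
  (* On the image of [W h] the two terms are [W a] and its negative, because [q] undoes [W f]. Hence
     [t] descends to the pushout, where it retracts the new inflation after [W]. *)
  pose t := ch_add (ch_comp (Wm a) (ch_comp q (Wm p1))) (Wm p2).
  have th i z : t i (Wm h i z) = 0%R.
    rewrite -[LHS]/(Wm a i (q i (Wm p1 i (Wm h i z))) + Wm p2 i (Wm h i z))%R.
    rewrite (cx_pow_map_comp p1h) qf.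
    by apply/ffunP => e; rewrite !ffunE p2h subrr.
  have [q' q'E] := short_exact_factor (pow_short_exact rho hc) th.
  exists q' => i z.
  rewrite -(cx_pow_map_comp (f := i2) (g := c) (h := ch_comp c i2)) // q'E.
  rewrite -[LHS]/(Wm a i (q i (Wm p1 i (Wm i2 i z))) + Wm p2 i (Wm i2 i z))%R.
  rewrite (cx_pow_map_comp (h := ch_zero _ _)) //.
  rewrite (cx_pow_map0 (f := ch_zero _ _)) // !linear0 add0r.
  exact: cx_pow_mapK.
- move=> B D D' g d /deflationE[g_surj [s gs]].
  have [i1 [i2 [p1 [p2 [p11 p22 p21 p12 sumE]]]]] :=
    cx_biproduct (sval B) (sval D').
  pose P : ob C := exist _ _ (in_cpx_prod (svalP B) (svalP D')).
  (* The pullback is the kernel of the map with components [g] and [- d]. This map is itself a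
     deflation, because [s] followed by the first inclusion splits it after [W]; so its kernel lies
     in the category. *)
  pose h : Defs.hom P D := ch_add (ch_comp g p1) (ch_opp (ch_comp d p2)).
  have hi1 i x : ch_fun h i (i1 i x) = ch_fun g i x.
    by rewrite /= [p1 i _]p11 [p2 i _]p21 linear0 subr0.
  have hi2 i x : ch_fun h i (i2 i x) = (- ch_fun d i x)%R.
    by rewrite /= [p1 i _]p12 [p2 i _]p22 linear0 sub0r.
  have h_defl : deflation E h.
    apply/deflationE; split=> [i z|].
      by have [y <-] := g_surj i z; exists (i1 i y).
    by exists (ch_comp (Wm i1) s) => i z; rewrite -[RHS](gs i z); apply: cx_pow_map_comp.
  have [B' [j [jh _]]] := h_defl.
  have j_inj i : injective (ch_fun j i) by have [] := jh i.
  exists B', (ch_comp p1 j), (ch_comp p2 j); split.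
    split=> [i x|X x y xy].
      by apply/eqP; rewrite -subr_eq0; apply/eqP/(short_exact_comp0 jh x).
    pose w := ch_add (ch_comp i1 x) (ch_comp i2 y).
    have hw i z : ch_fun h i (w i z) = 0%R.
      by rewrite [w i z]/= linearD hi1 hi2 [ch_fun g i _]xy /= subrr.
    split.
      have [u ju] := short_exact_lift jh hw; exists u.
      by split=> i z; rewrite /= [ch_fun j _ _]ju /= linearD /= ?[p1 _ (i1 _ _)]p11
         ?[p2 _ (i1 _ _)]p21 ?[p1 _ (i2 _ _)]p12 ?[p2 _ (i2 _ _)]p22 ?addr0 ?add0r.
    move=> u v uv1 uv2 i z; apply: (j_inj i).
    rewrite -[LHS]sumE -[RHS]sumE /=; congr (i1 i _ + i2 i _)%R.
      exact: uv1.
    exact: uv2.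
  apply/deflationE; split=> [i z|].
    have [y gy] := g_surj i (ch_fun d i z).
    have [_ _ /(_ (i1 i y + i2 i z)%R)[+ _]] := jh i.
    rewrite linearD hi1 hi2 gy subrr => /(_ erefl)[x xE]; exists x.
    by rewrite /= xE linearD [p2 _ (i1 _ _)]p21 [p2 _ (i2 _ _)]p22 add0r.
  (* [z] is completed by [s (W d z)] to a compatible pair, so [t] lifts to the pullback and splits
     the new deflation after [W]. *)
  pose t := ch_add (ch_comp (Wm i1) (ch_comp s (Wm d))) (Wm i2).
  have ht i z : Wm h i (t i z) = 0%R.
    rewrite -[t i z]/(Wm i1 i (s i (Wm d i z)) + Wm i2 i z)%R linearD.
    rewrite (cx_pow_map_comp hi1) gs.
    by apply/ffunP => e; rewrite !ffunE hi2 subrr.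
  have [s' s'E] := short_exact_lift (pow_short_exact rho jh) ht.
  exists s' => i z.
  rewrite -(cx_pow_map_comp (f := j) (g := p2) (h := ch_comp p2 j)) // s'E.
  rewrite -[t i z]/(Wm i1 i (s i (Wm d i z)) + Wm i2 i z)%R linearD.
  rewrite (cx_pow_map_comp (h := ch_zero _ _)) //.
  rewrite (cx_pow_map0 (f := ch_zero _ _)) // add0r.
  exact: cx_pow_mapK.
Qed.

Definition cover (X : ob C) : ob C :=
  exist _ _ (in_cpx_pow sigma (in_cpx_pow rho (svalP X))).

(** Since [W'] is left adjoint to [W], a map from [W' (W X)] to [D] amounts to a map from [W X] to
    [W D]. That one is lifted along the section [s], and the lift is transposed back. *)
Lemma retract_projective (P : ob C) (X : complex)
    (i : chmap (sval P) (W' (W X))) (p : chmap (W' (W X)) (sval P)) :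
  (forall j x, p j (i j x) = x) -> E_projective E P.
Proof.
move=> pi A B D f g /V_split_section[fg_ex [s gs]]; split.
- move=> u fu j x; have [f_inj _ _] := fg_ex j; apply: f_inj.
  by rewrite linear0; apply: fu.
- move=> v; split=> [gv|[u fu] j x]; first exact: (short_exact_lift fg_ex gv).
  by rewrite /= -[ch_fun v j x]fu; apply: (short_exact_comp0 fg_ex).
- move=> w; pose w' := ch_comp w p.
  suff [t gt] : exists t : chmap (W' (W X)) (sval B),
      forall j n, ch_fun g j (t j n) = ch_fun w j (p j n).
    by exists (ch_comp t i) => j x; apply: etrans (gt j _) (congr1 _ (pi j x)).
  pose h := ch_comp s (ch_comp (Wm w') (cx_unit rs (W X))).
  exists (ch_comp (cx_counit sr (sval B)) (W'm h)) => j n.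
  rewrite -[LHS]/(ch_fun g j (cx_counit sr (sval B) j (W'm h j n))).
  rewrite -(cx_counit_nat sr g).
  rewrite (cx_pow_map_comp (h := ch_comp (Wm w') (cx_unit rs (W X))));
    last by move=> l y; apply: gs.
  rewrite -(cx_pow_map_comp (f := cx_unit rs (W X)) (g := Wm w')) //.
  by rewrite cx_counit_nat cx_triangle.
Qed.

(** Dually, [W'] is also right adjoint to [W]: a map from [A] to [W' (W X)] amounts to a map from
    [W A] to [W X], which the retraction [q] extends to [W B]. *)
Lemma retract_injective (I : ob C) (X : complex)
    (i : chmap (sval I) (W' (W X))) (p : chmap (W' (W X)) (sval I)) :
  (forall j x, p j (i j x) = x) -> E_injective E I.
Proof.
move=> pi A B D f g /V_split_retraction[fg_ex [q qf]]; split.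
- move=> u ug j z; have [_ /(_ z)[y <-] _] := fg_ex j.
  exact: ug.
- move=> v; split=> [vf|[u ug] j x]; first exact: (short_exact_factor fg_ex vf).
  by rewrite /= -[LHS]ug /= (short_exact_comp0 fg_ex) linear0.
- move=> w; pose w' := ch_comp i w.
  suff [t tf] : exists t : chmap (sval B) (W' (W X)),
      forall j n, t j (ch_fun f j n) = i j (ch_fun w j n).
    exists (ch_comp p t) => j x.
    by apply: etrans (congr1 (p j) (tf j x)) (pi j _).
  pose l := ch_comp (cx_counit rs (W X)) (Wm w').
  exists (ch_comp (W'm (ch_comp l q)) (cx_unit sr (sval B))) => j n.
  rewrite -[LHS]/(W'm (ch_comp l q) j (cx_unit sr (sval B) j (ch_fun f j n))).
  rewrite -(cx_unit_nat sr f) (cx_pow_map_comp (h := l)); last first.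
    by move=> m y; rewrite -[LHS]/(l m (q m (Wm f m y))) qf.
  rewrite -(cx_pow_map_comp (f := Wm w') (g := cx_counit rs (W X))) //.
  by rewrite cx_unit_nat cx_triangle'.
Qed.

(** The section after [W] is the unit at [W X] of the same adjunction, by a triangle identity. *)
Lemma counit_deflation (X : ob C) :
  deflation E (cx_counit sr (sval X) : Defs.hom (cover X) X).
Proof.
apply/deflationE; split=> [i z|]; first exact: cx_counit_surj.
by exists (cx_unit rs (W (sval X))) => i z; apply: cx_triangle'.
Qed.

Lemma unit_inflation (X : ob C) :
  inflation E (cx_unit sr (sval X) : Defs.hom X (cover X)).
Proof.
apply/inflationE; split=> [i|]; first exact: cx_unit_inj.
by exists (cx_counit rs (W (sval X))) => i z; apply: cx_triangle.
Qed.

Lemma cover_projective (X : ob C) : E_projective E (cover X).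
Proof. exact: (@retract_projective (cover X) (sval X) (ch_id _) (ch_id _)). Qed.

Lemma cover_injective (X : ob C) : E_injective E (cover X).
Proof. exact: (@retract_injective (cover X) (sval X) (ch_id _) (ch_id _)). Qed.

Lemma projective_retract (P : ob C) : E_projective E P ->
  exists s : chmap (sval P) (W' (W (sval P))),
    forall i x, cx_counit sr (sval P) i (s i x) = x.
Proof.
move=> P_proj; have [A [f fE]] := counit_deflation P.
by have [_ _ /(_ (ch_id (sval P)))] := P_proj _ _ _ _ _ fE.
Qed.

Lemma injective_retract (I : ob C) : E_injective E I ->
  exists q : chmap (W' (W (sval I))) (sval I),
    forall i x, q i (cx_unit sr (sval I) i x) = x.
Proof.
move=> I_inj; have [A [f fE]] := unit_inflation I.
by have [_ _ /(_ (ch_id (sval I)))] := I_inj _ _ _ _ _ fE.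
Qed.

Lemma V_split_frobenius : frobenius E.
Proof.
split.
- exact: V_split_exact_category.
- move=> X; exists (cover X), (cx_counit sr (sval X)).
  by split; [apply: cover_projective|apply: counit_deflation].
- move=> X; exists (cover X), (cx_unit sr (sval X)).
  by split; [apply: cover_injective|apply: unit_inflation].
- move=> X; split=> [/projective_retract[s sE]|/injective_retract[q qE]].
    exact: retract_injective sE.
  exact: retract_projective qE.
Qed.

Lemma counit_split_summand (X : complex) (s : chmap X (W' (W X))) :
  (forall i x, cx_counit sr X i (s i x) = x) ->
  summand (C := Cpx) X (W' (W X)).
Proof.
move=> sE; have [K [f fE]] := kernel_exists (cx_counit_surj sr r_gt0 (X := X)).
exists K; apply: (biproductC (Cpx_additive k gT)).
by have [j [q split_f]] := short_exact_section fE sE; exists f, j, q, (cx_counit sr X).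
Qed.

Lemma projective_summand (P : ob C) :
  E_projective E P -> summand (C := Cpx) (sval P) (W' (W (sval P))).
Proof. by move=> /projective_retract[s]; apply: counit_split_summand. Qed.

Lemma summand_retract (P Y : complex) : summand (C := Cpx) P Y ->
  exists (i : chmap P Y) (p : chmap Y P), forall j x, p j (i j x) = x.
Proof. by move=> [Q [i [_ [p [_ [pi _ _ _ _]]]]]]; exists i, p. Qed.

Lemma V_split_projectiveP (P : complex) :
  (exists hP : in_cpx fg b P, E_projective E (exist (in_cpx fg b) P hP)) <->
  (exists X, in_cpx fg b X /\ summand (C := Cpx) P (W' (W X))).
Proof.
split=> [[hP /projective_summand P_sum]|[X [hX /summand_retract[i [p pi]]]]].
  by exists P.
(* Here [P] is any complex; being an image of [W' (W X)] puts it in the category. *)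
have hP : in_cpx fg b P.
  apply: (in_cpx_surj (f := p)); last first.
    by apply: (in_cpx_pow sigma); apply: (in_cpx_pow rho) hX.
  by move=> l y; exists (i l y); apply: pi.
by exists hP; apply: (@retract_projective (exist _ P hP) X i p).
Qed.

(** Stable equality with a prescribed projective. Witnesses through the same object can be added,
    whereas factorizations through varying projectives would first have to be merged in a
    biproduct. *)
Definition counit_eq (X Y : complex) (f g : chmap X Y) : Prop :=
  exists t : chmap X (W' (W Y)),
    forall i x, cx_counit sr Y i (t i x) = (f i x - g i x)%R.

Section CounitEq.
Variables X Y Z : complex.
Implicit Types (f g h : chmap X Y).

Lemma counit_eq_strict f g : (forall i x, f i x = g i x) -> counit_eq f g.
Proof.
by move=> e; exists (ch_zero _ _) => i x; rewrite e subrr; apply: linear0.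
Qed.

Lemma counit_eq_opp f f' : counit_eq f f' -> counit_eq (ch_opp f) (ch_opp f').
Proof.
move=> [t tE]; exists (ch_opp t) => i x.
by rewrite -[ch_opp t i x]/(- t i x)%R linearN tE opprB /= opprK addrC.
Qed.

Lemma counit_eq_add f f' g g' : counit_eq f f' -> counit_eq g g' ->
  counit_eq (ch_add f g) (ch_add f' g').
Proof.
move=> [t tE] [u uE]; exists (ch_add t u) => i x.
rewrite -[ch_add t u i x]/(t i x + u i x)%R linearD tE uE.
by rewrite /= opprD addrACA.
Qed.

Lemma counit_eq_sym f g : counit_eq f g -> counit_eq g f.
Proof.
move=> [t tE]; exists (ch_opp t) => i x.
by rewrite -[ch_opp t i x]/(- t i x)%R linearN tE opprB.
Qed.

Lemma counit_eq_trans f g h :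
  counit_eq f g -> counit_eq g h -> counit_eq f h.
Proof.
move=> [t tE] [u uE]; exists (ch_add t u) => i x.
rewrite -[ch_add t u i x]/(t i x + u i x)%R linearD tE uE.
by rewrite addrA subrK.
Qed.

Lemma counit_eq_comp (g g' : chmap Y Z) f f' :
  counit_eq g g' -> counit_eq f f' ->
  counit_eq (ch_comp g f) (ch_comp g' f').
Proof.
move=> [t tE] [u uE].
(* The two terms lift the summands of [(g - g') f + g' (f - f')]; the second uses naturality of the
   counit. *)
exists (ch_add (ch_comp t f) (ch_comp (W'm (Wm g')) u)) => i x.
rewrite -[ch_add _ _ i x]/(t i (f i x) + W'm (Wm g') i (u i x))%R.
by rewrite linearD tE (cx_counit_nat sr g') uE linearB addrA subrK.
Qed.

End CounitEq.

(* As projectives lift along the counit, a map is stably zero if and only if it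
   factors through the counit at its target. *)
Lemma stable_eqP (A B : ob C) (f g : Defs.hom A B) :
  stable_eq E f g <-> @counit_eq (sval A) (sval B) f g.
Proof.
split=> [[P [P_proj [u [v uv]]]]|[t tE]].
  have [A' [h hE]] := counit_deflation B.
  have [_ _ /(_ v) [v' v'E]] := P_proj _ _ _ _ _ hE.
  exists (ch_comp v' u) => i x.
  exact: etrans (v'E i (ch_fun u i x)) (esym (uv i x)).
exists (cover B); split; first exact: cover_projective.
by exists t, (cx_counit sr (sval B)) => i x; apply: esym (tE i x).
Qed.

Lemma stable_eq_strict (A B : ob C) (f g : Defs.hom A B) :
  f == g -> stable_eq E f g.
Proof. by move=> e; apply/stable_eqP/(counit_eq_strict e). Qed.

Lemma stable_additive : is_additive (stable_category E).
Proof.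
apply: stable_category_additive.
- exact: CpxSub_additive.
- exact: stable_eq_strict.
- by move=> A B f g /stable_eqP e; apply/stable_eqP/(counit_eq_sym e).
- move=> A B f g h /stable_eqP e /stable_eqP e'.
  exact/stable_eqP/(counit_eq_trans e e').
- move=> A B D g g' f f' /stable_eqP e /stable_eqP e'.
  exact/stable_eqP/(counit_eq_comp e e').
- move=> A B f f' g g' /stable_eqP e /stable_eqP e'.
  exact/stable_eqP/(counit_eq_add e e').
- by move=> A B f f' /stable_eqP e; apply/stable_eqP/(counit_eq_opp e).
Qed.

End Frobenius.

(** * Local idempotents *)

Section RingIdempotents.
Variable R : pzRingType.
Implicit Types e f u v x y : R.

Definition inverses x y : Prop := y * x = 1 /\ x * y = 1.

(** With [u] inverse to [x + y], the product [u x] is a unit or nilpotent, and in the latter case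
    [u y = 1 - u x] is a unit. The dichotomy also turns left invertible elements into units: from
    [l z = 1] follows [l^n z^n = 1], so [z] is not nilpotent. *)
Lemma fitting_local : (1 : R) <> 0 ->
  (forall x, (exists n, x ^+ n = 0) \/ exists y, inverses x y) ->
  forall x y, (exists z, inverses (x + y) z) ->
  (exists z, inverses x z) \/ exists z, inverses y z.
Proof.
move=> nz fit x y [u [uxy _]].
have linv l z : l * z = 1 -> exists w, inverses z w.
  move=> lz; have [[n zn]|//] := fit z; case: nz.
  have <- : l ^+ n * z ^+ n = 1; last by rewrite zn mulr0.
  elim: n {zn} => [|n IHn]; first by rewrite !expr0 mulr1.
  by rewrite exprSr exprS mulrA -(mulrA _ l) lz mulr1.
have [[n uxn]|[z [zux _]]] := fit (u * x); last first.
  by left; apply: (linv (z * u)); rewrite -mulrA.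
(* The geometric series inverts [1 - u x]. *)
right; have uy : u * y = 1 - u * x by rewrite -uxy mulrDr addrC addKr.
apply: (linv ((\sum_(i < n) (u * x) ^+ i) * u)); rewrite -mulrA uy.
have comm : GRing.comm (1 - u * x) (\sum_(i < n) (u * x) ^+ i).
  apply: commr_sum => i _; apply: commrX.
  by rewrite /GRing.comm mulrBl mulrBr mul1r mulr1.
by rewrite -comm -opprB mulNr -subrX1 uxn sub0r opprK.
Qed.

(** Inverse in the corner ring [e R e], whose unit is [e]. *)
Definition corner_inverse e x y : Prop :=
  [/\ y = e * y * e, y * x = e & x * y = e].

(** Says that the corner ring [e R e] is local. *)
Definition local_idem e : Prop :=
  [/\ e * e = e, e <> 0 & forall x y, x = e * x * e -> y = e * y * e ->
      (exists z, corner_inverse e (x + y) z) ->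
      (exists z, corner_inverse e x z) \/ exists z, corner_inverse e y z].

(** Equivalence of idempotents: for split idempotents of an endomorphism ring, isomorphism of their
    images. *)
Definition idem_iso e f : Prop :=
  exists u v, [/\ u = f * u * e, v = e * v * f, v * u = e & u * v = f].

Lemma local_idem_sum e (J : finType) (B : {set J}) (x : J -> R) :
  local_idem e -> (forall j, x j = e * x j * e) ->
  (exists z, corner_inverse e (\sum_(j in B) x j) z) ->
  exists2 j, j \in B & exists z, corner_inverse e (x j) z.
Proof.
move=> [ee e0 e_loc] xe.
(* Membership in the corner is part of the induction predicate, because locality speaks of corner
   elements. The empty sum cannot be invertible, as this would give [e = 0]. *)
pose K y := y = e * y * e /\ ((exists z, corner_inverse e y z) ->
  exists2 j, j \in B & exists z, corner_inverse e (x j) z).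
suff [_] : K (\sum_(j in B) x j) by [].
elim/big_rec: _ => [|j y jB [ye IHy]].
  by split=> [|[z [_ z0 _]]]; [rewrite mulr0 mul0r|case: e0; rewrite -z0 mulr0].
split; first by rewrite mulrDr mulrDl -xe -ye.
by move=> /(e_loc _ _ (xe j) ye)[?|/IHy //]; exists j.
Qed.

(* [u * v] is a non-zero idempotent of the local corner ring at [f]. *)
Lemma local_idem_iso e f u v : e * e = e -> e <> 0 -> local_idem f ->
  u = f * u * e -> v = e * v * f -> v * u = e -> u * v = f.
Proof.
move=> ee e0 [ff _ f_loc] uE vE vu.
have fu : f * u = u by rewrite uE !mulrA ff.
have vf : v * f = v by rewrite vE -!mulrA ff.
have ue : u * e = u by rewrite uE -!mulrA ee.
pose x := u * v; have xx : x * x = x by rewrite /x mulrA -(mulrA u) vu ue.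
have fx : f * x = x by rewrite /x mulrA fu.
have xf : x * f = x by rewrite /x -mulrA vf.
have xE : x = f * x * f by rewrite fx xf.
have yE : f - x = f * (f - x) * f by rewrite mulrBr ff fx mulrBl ff xf.
have one : exists z, corner_inverse f (x + (f - x)) z.
  by exists f; rewrite [x + _]addrC subrK; split; rewrite // ff.
have [[z [_ zx _]]|[z [_ zy _]]] := f_loc x (f - x) xE yE one.
  by rewrite -[LHS]/x -fx -zx -mulrA xx.
case: e0; have x0 : x = 0.
  by rewrite -fx -zy -mulrA mulrBl fx xx subrr mulr0.
by rewrite -ee -vu mulrA -(mulrA v) -[u * v]/x x0 mulr0 mul0r.
Qed.

Section Matching.
Variables (I J : finType) (e : I -> R) (f : J -> R).
Hypothesis e_orth : forall a b, e a * e b = if a == b then e a else 0.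
Hypothesis f_orth : forall a b, f a * f b = if a == b then f a else 0.
Hypotheses (e_loc : forall a, local_idem (e a)) (f_loc : forall b, local_idem (f b)).

Let e0 a : e a <> 0. Proof. by case: (e_loc a). Qed.
Let f0 b : f b <> 0. Proof. by case: (f_loc b). Qed.

(* Exchange step: the corner of an isomorphism complementary to one of its
   invertible entries is replaced by its Schur complement. *)
Lemma idem_exchange (E F e1 f1 u v a' : R) :
  E * E = E -> F * F = F -> e1 * e1 = e1 -> f1 * f1 = f1 ->
  E * e1 = e1 -> e1 * E = e1 -> F * f1 = f1 -> f1 * F = f1 ->
  u = F * u * E -> v = E * v * F -> v * u = E -> u * v = F ->
  a' = e1 * a' * f1 -> a' * (f1 * u * e1) = e1 -> (f1 * u * e1) * a' = f1 ->
  idem_iso (E - e1) (F - f1).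
Proof.
move=> EE FF ee ff Ee eE Ff fF uE vE vu uv a'E a'a aa'.
have Fu : F * u = u by rewrite uE !mulrA FF.
have uEE : u * E = u by rewrite uE -!mulrA EE.
have Ev : E * v = v by rewrite vE !mulrA EE.
have vF : v * F = v by rewrite vE -!mulrA FF.
have ea' : e1 * a' = a' by rewrite a'E !mulrA ee.
have a'f : a' * f1 = a' by rewrite a'E -!mulrA ff.
have fua' : f1 * u * a' = f1 by rewrite -ea' mulrA.
have a'ue : a' * u * e1 = e1 by rewrite -{1}a'f -(mulrA a') -(mulrA a').
have E'E : (E - e1) * (E - e1) = E - e1.
  by rewrite mulrBr !mulrBl EE eE Ee ee subrr subr0.
have F'F : (F - f1) * (F - f1) = F - f1.
  by rewrite mulrBr !mulrBl FF fF Ff ff subrr subr0.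
have E'a' : (E - e1) * a' = 0 by rewrite -ea' mulrA mulrBl Ee ee subrr mul0r.
have a'F' : a' * (F - f1) = 0 by rewrite -a'f -mulrA mulrBr fF ff subrr mulr0.
pose w := u - u * a' * u.
have f1w : f1 * w = 0.
  by rewrite /w mulrBr !mulrA fua' subrr.
have we1 : w * e1 = 0.
  by rewrite /w mulrBl -!mulrA (mulrA a') a'ue subrr.
have F'w : (F - f1) * w = w.
  by rewrite mulrBl f1w subr0 /w mulrBr !mulrA Fu.
have wE' : w * (E - e1) = w.
  by rewrite mulrBr we1 subr0 /w mulrBl -!mulrA uEE.
(* The inverse of the Schur complement is the complementary block of the inverse [v]. *)
exists w, ((E - e1) * v * (F - f1)); split.
- by rewrite F'w wE'.
- by rewrite -!mulrA F'F !mulrA E'E.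
- rewrite -mulrA F'w -mulrA /w mulrBr !mulrA vu mulrBr mulrBl EE eE.
  by rewrite -!mulrA (mulrA (E - e1) E) mulrBl EE eE mulrA E'a' mul0r subr0.
- have FF' : F * (F - f1) = F - f1 by rewrite mulrBr FF Ff.
  rewrite !mulrA wE' /w mulrBl -(mulrA _ u v) uv mulrBl FF'.
  by rewrite -!mulrA FF' a'F' mulr0 subr0.
Qed.

Lemma orth_sum_mul (K : finType) (h : K -> R) (S : {set K}) a :
  (forall a b, h a * h b = if a == b then h a else 0) -> a \in S ->
  (\sum_(j in S) h j) * h a = h a /\ h a * (\sum_(j in S) h j) = h a.
Proof.
move=> h_orth aS; rewrite mulr_suml mulr_sumr !(bigD1 a aS) /= !h_orth eqxx.
by rewrite !big1 ?addr0 // => j /andP[_ /negPf ja];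
  rewrite h_orth ?ja // eq_sym ja.
Qed.

Lemma orth_sum_idem (K : finType) (h : K -> R) (S : {set K}) :
  (forall a b, h a * h b = if a == b then h a else 0) ->
  (\sum_(j in S) h j) * (\sum_(j in S) h j) = \sum_(j in S) h j.
Proof.
move=> h_orth; rewrite mulr_sumr; apply: eq_bigr => j jS.
by have [-> _] := orth_sum_mul h_orth jS.
Qed.

(** Induction on the size of [A]. For [a] in [A], the elements [e_a v f_b u e_a] sum to
    [e_a v u e_a = e_a], so locality makes one of them invertible; this matches [a] with [b], and
    the exchange step cancels the pair. [j0] provides values for [s] when [A] is empty. *)
Lemma idem_matching (j0 : J) (A : {set I}) (B : {set J}) :
  idem_iso (\sum_(a in A) e a) (\sum_(b in B) f b) ->
  exists s : I -> J, [/\ {in A &, injective s}, s @: A = B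
    & forall a, a \in A -> idem_iso (e a) (f (s a))].
Proof.
have [n] := ubnP #|A|; elim: n A B => // n IHn A B ltAn.
set E := \sum_(a in A) e a; set F := \sum_(b in B) f b.
move=> [u [v [uE vE vu uv]]].
have EE : E * E = E by apply: orth_sum_idem.
have FF : F * F = F by apply: orth_sum_idem.
have [A0|[a aA]] := set_0Vmem A.
  have E0 : E = 0 by rewrite /E A0 big_set0.
  have F0 : F = 0 by rewrite -uv vE E0 !mul0r mulr0.
  have B0 : B = set0.
    apply/setP => b; rewrite inE; apply/negP => bB; case: (@f0 b).
    by have [<- _] := orth_sum_mul f_orth bB; rewrite -/F F0 mul0r.
  exists (fun=> j0); split=> [x y|| x]; rewrite ?A0 ?inE //.
  by rewrite imset0 B0.
have [ee _ _] := e_loc a; have [Ea aE] := orth_sum_mul e_orth aA.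
have Fu : F * u = u by rewrite uE !mulrA FF.
have [||b bB [s [sE sx xs]]] :=
    @local_idem_sum (e a) J B (fun b => e a * v * f b * u * e a) (e_loc a).
- by move=> b; rewrite !mulrA ee -!mulrA ee.
- exists (e a); rewrite -mulr_suml -mulr_suml -mulr_sumr -/F -(mulrA _ F) Fu.
  by rewrite -(mulrA _ v) vu -/E aE ee; split; rewrite ?ee.
have [ff _ _] := f_loc b; have [Fb bF] := orth_sum_mul f_orth bB.
have sa : s * e a = s by rewrite sE -!mulrA ee.
have es : e a * s = s by rewrite sE !mulrA ee.
(* A left inverse of [f_b u e_a] by the choice of [s]; locality of [f_b] makes it two-sided. *)
pose a' := s * v * f b.
have a'E : a' = e a * a' * f b by rewrite /a' !mulrA es -!mulrA ff.
have a'u : a' * (f b * u * e a) = e a.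
  by rewrite /a' -[RHS]sx -!mulrA (mulrA s (e a)) sa (mulrA (f b) (f b)) ff.
have ua' : (f b * u * e a) * a' = f b.
  apply: (local_idem_iso ee (@e0 a) (f_loc b) _ a'E a'u).
  by rewrite !mulrA ff -!mulrA ee.
have iso := idem_exchange EE FF ee ff Ea aE Fb bF uE vE vu uv a'E a'u ua'.
have EA : E - e a = \sum_(x in A :\ a) e x.
  by rewrite /E (big_setD1 a) //= addrAC subrr add0r.
have FB : F - f b = \sum_(x in B :\ b) f x.
  by rewrite /F (big_setD1 b) //= addrAC subrr add0r.
rewrite EA FB in iso.
have [|t [t_inj tA tP]] := IHn _ _ _ iso; first by rewrite (cardsD1 a) aA in ltAn.
exists (fun x : I => if x == a then b else t x).
have tB (x : I) : x \in A -> x != a -> t x \in B :\ b.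
  by move=> xA xa; rewrite -tA imset_f // !inE xa.
split.
- move=> x y xA yA; case: eqP => [->|/eqP xa]; case: eqP => [->//|/eqP ya].
  + by move=> bt; have := tB y yA ya; rewrite -bt !inE eqxx.
  + by move=> bt; have := tB x xA xa; rewrite bt !inE eqxx.
  + by apply: t_inj; rewrite !inE ?xa ?ya.
- apply/setP => y; apply/imsetP/idP => [[x xA ->]|yB].
    by case: eqP => // /eqP xa; have := tB x xA xa; rewrite inE => /andP[].
  have [->|yb] := eqVneq y b; first by exists a; rewrite ?eqxx.
  have : y \in B :\ b by rewrite !inE yb.
  rewrite -tA => /imsetP[x]; rewrite !inE => /andP[xa xA] ->.
  by exists x; rewrite ?(negPf xa).
- move=> x xA; case: eqP => [->|/eqP xa]; last by apply: tP; rewrite !inE xa.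
  exists (f b * u * e a), a'; split=> //.
  by rewrite !mulrA ff -!mulrA ee.
Qed.

End Matching.
End RingIdempotents.

(** * Decompositions in additive categories *)

Section Additive.
Local Open Scope quotient_scope.
Variables (C : catData) (HC : is_additive C).
Local Open Scope cat_scope.
Local Notation hom := (@Defs.hom C).

#[local] Hint Extern 0 (@heq _ _ _ _ _) => apply: (heq_refl HC) : core.

#[local] Instance heq_equivalence (A B : ob C) : Equivalence (@heq C A B).
Proof.
split=> [f|f g|f g h]; [exact: heq_refl|exact: heq_sym|exact: heq_trans].
Qed.

#[local] Instance cmp_proper (A B D : ob C) :
  Proper (@heq C B D ==> @heq C A B ==> @heq C A D) (@cmp C A B D).
Proof. by move=> g g' gg f f' ff; apply: cmp_heq. Qed.

#[local] Instance addm_proper (A B : ob C) :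
  Proper (@heq C A B ==> @heq C A B ==> @heq C A B) (@addm C A B).
Proof. by move=> g g' gg f f' ff; apply: addm_heq. Qed.

#[local] Instance oppm_proper (A B : ob C) :
  Proper (@heq C A B ==> @heq C A B) (@oppm C A B).
Proof. by move=> g g' gg; apply: oppm_heq. Qed.

Section EndomorphismRing.
Variable X : ob C.

Definition endo_rel (f g : {classic hom X X}) : bool := `[< @heq C X X f g >].

Lemma endo_relP : equiv_class_of endo_rel.
Proof.
split=> [f|f g|f g h]; first by apply/asboolP; apply: heq_refl.
  by apply/asboolP/asboolP; apply: heq_sym.
by move=> /asboolP fg /asboolP gh; apply/asboolP; apply: heq_trans gh.
Qed.

Canonical endo_equiv := EquivRelPack endo_relP.
Canonical endo_encModRel := defaultEncModRel endo_rel.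

(** Ring computations in this quotient replace rewriting modulo [heq]. [{classic _}] gives the bare
    type of maps the choice structure that quotients require, and the phantom argument carries the
    axioms behind the ring structure. *)
Definition endo (_ : is_additive C) := {eq_quot endo_rel}.
Local Notation R := (endo HC).
HB.instance Definition _ : EqQuotient _ endo_rel R := EqQuotient.on R.
HB.instance Definition _ := Choice.on R.

Definition cls (f : hom X X) : R := \pi_R (f : {classic hom X X}).
Let rep (x : R) : hom X X := repr x.

Lemma clsP f g : cls f = cls g <-> f == g.
Proof. by split=> [/eqmodP/asboolP|H] //; apply/eqmodP/asboolP. Qed.

Let rep_cls f : rep (cls f) == f.
Proof. by apply/clsP; rewrite /cls /rep reprK. Qed.

Let cls_ind (T : R -> Prop) : (forall f, T (cls f)) -> forall x, T x.
Proof. by move=> H x; rewrite -[x]reprK; apply: H. Qed.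

Let e_add (x y : R) : R := cls (rep x + rep y).
Let e_opp (x : R) : R := cls (- rep x).
Let e_mul (x y : R) : R := cls (rep x \o rep y).

Let addE f g : e_add (cls f) (cls g) = cls (f + g).
Proof. by apply/clsP; rewrite !rep_cls. Qed.

Let oppE f : e_opp (cls f) = cls (- f).
Proof. by apply/clsP; rewrite rep_cls. Qed.

Let mulE f g : e_mul (cls f) (cls g) = cls (f \o g).
Proof. by apply/clsP; rewrite !rep_cls. Qed.

Let e_addA : associative e_add.
Proof. by do 3!elim/cls_ind => ?; rewrite !addE; apply/clsP; apply: (addmA HC). Qed.

Let e_addC : commutative e_add.
Proof. by do 2!elim/cls_ind => ?; rewrite !addE; apply/clsP; apply: (addmC HC). Qed.

Let e_add0 : left_id (cls 0) e_add.
Proof. by elim/cls_ind => ?; rewrite !addE; apply/clsP; apply: (add0m HC). Qed.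

Let e_addN : left_inverse (cls 0) e_opp e_add.
Proof. by elim/cls_ind => ?; rewrite oppE addE; apply/clsP; apply: (addNm HC). Qed.

HB.instance Definition _ := GRing.isZmodule.Build R e_addA e_addC e_add0 e_addN.

Let e_mulA : associative e_mul.
Proof. by do 3!elim/cls_ind => ?; rewrite !mulE; apply/clsP; apply: (cmpA HC). Qed.

Let e_mul1 : left_id (cls (Defs.idm X)) e_mul.
Proof. by elim/cls_ind => ?; rewrite mulE; apply/clsP; apply: (cmp1m HC). Qed.

Let e_1mul : right_id (cls (Defs.idm X)) e_mul.
Proof. by elim/cls_ind => ?; rewrite mulE; apply/clsP; apply: (cmpm1 HC). Qed.

Let e_mulDl : left_distributive e_mul +%R.
Proof.
do 3!elim/cls_ind => ?; rewrite [X in e_mul X _]addE !mulE [RHS]addE.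
by apply/clsP; apply: (cmpDl HC).
Qed.

Let e_mulDr : right_distributive e_mul +%R.
Proof.
do 3!elim/cls_ind => ?; rewrite [X in e_mul _ X]addE !mulE [RHS]addE.
by apply/clsP; apply: (cmpDr HC).
Qed.

HB.instance Definition _ :=
  GRing.Zmodule_isPzRing.Build R e_mulA e_mul1 e_1mul e_mulDl e_mulDr.

Lemma cls_surj (x : R) : exists f, x = cls f.
Proof. by exists (rep x); rewrite /cls /rep reprK. Qed.

Lemma clsD f g : cls (f + g) = (cls f + cls g)%R.
Proof. by rewrite [RHS]addE. Qed.

Lemma clsM f g : cls (f \o g) = (cls f * cls g)%R.
Proof. by rewrite [RHS]mulE. Qed.

Lemma cls0 : cls 0 = 0%R. Proof. by []. Qed.

Lemma cls1 : cls (Defs.idm X) = 1%R. Proof. by []. Qed.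

Lemma cls_sum n (F : 'I_n -> hom X X) :
  cls (\big[@addm C X X/0]_(a < n) F a) = (\sum_(a < n) cls (F a))%R.
Proof. exact: (big_morph cls clsD cls0). Qed.

End EndomorphismRing.

Lemma addm_self0 (A B : ob C) (f : hom A B) : f + f == f -> f == 0.
Proof.
by move=> ff; rewrite -(add0m HC f) -(addNm HC f) -(addmA HC) ff (addNm HC).
Qed.

Lemma cmp0m (A B D : ob C) (f : hom A B) : (0 : hom B D) \o f == 0.
Proof. by apply: addm_self0; rewrite -(cmpDl HC) (add0m HC). Qed.

Lemma cmpm0 (A B D : ob C) (f : hom B D) : f \o (0 : hom A B) == 0.
Proof. by apply: addm_self0; rewrite -(cmpDr HC) (add0m HC). Qed.

Lemma is_zeroP (A : ob C) : is_zero A <-> Defs.idm A == 0.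
Proof.
split=> [A0|idA X]; first exact: (A0 A).1.
by split=> f; [rewrite -(cmp1m HC f) idA cmp0m|rewrite -(cmpm1 HC f) idA cmpm0].
Qed.

Lemma is_iso_heq (A B : ob C) (f g : hom A B) : f == g -> is_iso f -> is_iso g.
Proof. by move=> fg [h [hf fh]]; exists h; rewrite -fg. Qed.

Section Split.
Variables (X Y : ob C) (i : hom Y X) (p : hom X Y).
Hypothesis pi : p \o i == Defs.idm Y.
Local Notation e := (cls (i \o p)).

Lemma split_idem : (e * e)%R = e.
Proof.
rewrite -clsM; apply/clsP.
by rewrite -(cmpA HC) (cmpA HC p) pi (cmp1m HC).
Qed.

Lemma split_corner (x : endo X HC) (f : hom X X) :
  x = cls f -> (e * x * e)%R = cls (i \o (p \o f \o i) \o p).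
Proof. by move=> ->; rewrite -!clsM; apply/clsP; rewrite !(cmpA HC). Qed.

(** Sending [f] to [p f i] and [h] to [i h p] identifies the corner at [i p] with the endomorphism
    ring of [Y]; this lemma and the next transfer invertibility along the two directions. *)
Lemma corner_inverse_is_iso (f : hom X X) :
  (exists z, corner_inverse e (cls f) z) -> is_iso (p \o f \o i).
Proof.
move=> [z [zE zf fz]]; have [g gE] := cls_surj z.
have ez : (e * z = z)%R by rewrite zE !mulrA split_idem.
have ze : (z * e = z)%R by rewrite zE -!mulrA split_idem.
have cmp3 a b : (p \o a \o i) \o (p \o b \o i) == p \o (a \o (i \o p) \o b) \o i.
  by rewrite !(cmpA HC).
have pipi : p \o (i \o p) \o i == Defs.idm Y.
  by rewrite (cmpA HC) pi (cmp1m HC).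
exists (p \o g \o i); split; rewrite cmp3.
- have -> : g \o (i \o p) \o f == i \o p by apply/clsP; rewrite !clsM -gE ze zf.
  exact: pipi.
- have -> : f \o (i \o p) \o g == i \o p.
    by apply/clsP; rewrite !clsM -gE -mulrA ez fz.
  exact: pipi.
Qed.

Lemma is_iso_corner_inverse (h : hom Y Y) :
  is_iso h -> exists z, corner_inverse e (cls (i \o h \o p)) z.
Proof.
move=> [g [gh hg]].
have cmp3 (a b : hom Y Y) :
    cls (i \o a \o p) * cls (i \o b \o p) = cls (i \o (a \o b) \o p) :> endo X HC.
  rewrite -clsM; apply/clsP.
  have -> : (i \o a \o p) \o (i \o b \o p) == i \o a \o (p \o i) \o b \o p.
    by rewrite !(cmpA HC).
  by rewrite pi (cmpm1 HC) !(cmpA HC).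
exists (cls (i \o g \o p)); split.
- rewrite (split_corner (f := i \o g \o p)) //; apply/clsP.
  have -> : p \o (i \o g \o p) \o i == (p \o i) \o g \o (p \o i).
    by rewrite !(cmpA HC).
  by rewrite pi (cmpm1 HC) (cmp1m HC).
- by rewrite cmp3; apply/clsP; rewrite gh (cmpm1 HC).
- by rewrite cmp3; apply/clsP; rewrite hg (cmpm1 HC).
Qed.

Lemma local_endo_idem : local_endo Y -> local_idem e.
Proof.
move=> [idY loc]; split; first exact: split_idem.
  move=> /clsP ip0; apply: idY.
  rewrite -(cmp1m HC (Defs.idm Y)) -{1}pi -pi.
  have -> : (p \o i) \o (p \o i) == p \o (i \o p) \o i by rewrite !(cmpA HC).
  by rewrite ip0 cmpm0 cmp0m.
move=> x y xE yE; have [x' x'E] := cls_surj x; have [y' y'E] := cls_surj y.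
rewrite x'E y'E -clsD => /corner_inverse_is_iso xy_iso.
have /loc[] : is_iso ((p \o x' \o i) + (p \o y' \o i)).
- by apply: is_iso_heq xy_iso; rewrite (cmpDr HC) (cmpDl HC).
- move=> /is_iso_corner_inverse[z zP]; left; exists z.
  by rewrite -x'E xE (split_corner x'E).
- move=> /is_iso_corner_inverse[z zP]; right; exists z.
  by rewrite -y'E yE (split_corner y'E).
Qed.

End Split.

Lemma idem_iso_isomorphic (X Y Z : ob C) (i : hom Y X) (p : hom X Y)
    (j : hom Z X) (q : hom X Z) :
  p \o i == Defs.idm Y -> q \o j == Defs.idm Z ->
  idem_iso (cls (i \o p)) (cls (j \o q)) -> isomorphic Y Z.
Proof.
move=> pi qj [u [v [uE vE vu uv]]].
have [u' u'E] := cls_surj u; have [v' v'E] := cls_surj v.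
have ee := split_idem pi; have ff := split_idem qj.
have vf : (v * cls (j \o q) = v)%R by rewrite vE -!mulrA ff.
have ue : (u * cls (i \o p) = u)%R by rewrite uE -!mulrA ee.
have H (T T' : ob C) (k : hom T X) (l : hom X T) (k' : hom T' X) (l' : hom X T')
    (a b : hom X X) : l \o k == Defs.idm T ->
    a \o (k' \o l') \o b == k \o l ->
    (l \o a \o k') \o (l' \o b \o k) == Defs.idm T.
  move=> lk ab.
  have -> : (l \o a \o k') \o (l' \o b \o k) == l \o (a \o (k' \o l') \o b) \o k.
    by rewrite !(cmpA HC).
  by rewrite ab (cmpA HC) lk (cmp1m HC).
exists (q \o u' \o i), (p \o v' \o j); split; apply: H => //.
  by apply/clsP; rewrite !clsM -u'E -v'E vf vu.
by apply/clsP; rewrite !clsM -u'E -v'E ue uv.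
Qed.

Lemma direct_sum_orth (X : ob C) n (Y : 'I_n -> ob C)
    (i : forall a, hom (Y a) X) (p : forall a, hom X (Y a)) :
  (forall a, p a \o i a == Defs.idm (Y a)) ->
  (forall a b, a <> b -> p a \o i b == 0) ->
  forall a b, (cls (i a \o p a) * cls (i b \o p b) =
    if (a == b)%B then cls (i a \o p a) else 0 :> endo X HC)%R.
Proof.
move=> pi pi0 a b; case: eqVneq => [<-|/eqP ab]; first exact: split_idem.
rewrite -clsM; apply/clsP.
have -> : (i a \o p a) \o (i b \o p b) == i a \o (p a \o i b) \o p b.
  by rewrite !(cmpA HC).
by rewrite pi0 // cmpm0 cmp0m.
Qed.

Lemma direct_sum_unique (X : ob C) n (Y : 'I_n -> ob C) m (Z : 'I_m -> ob C) :
  (forall a, local_endo (Y a)) -> (forall b, local_endo (Z b)) ->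
  is_direct_sum X Y -> is_direct_sum X Z ->
  exists s : 'I_n -> 'I_m, bijective s /\ forall a, isomorphic (Y a) (Z (s a)).
Proof.
move=> Y_loc Z_loc [i [p [pi pi0 sumY]]] [j [q [qj qj0 sumZ]]].
move: sumY sumZ => /clsP sumY /clsP sumZ; rewrite !cls_sum !cls1 in sumY sumZ.
pose e a : endo X HC := cls (i a \o p a).
pose f b : endo X HC := cls (j b \o q b).
have e_loc a : local_idem (e a) by apply: local_endo_idem (pi a) (Y_loc a).
have f_loc b : local_idem (f b) by apply: local_endo_idem (qj b) (Z_loc b).
have e_orth := direct_sum_orth pi pi0; have f_orth := direct_sum_orth qj qj0.
(* The matching needs an index on the [Z] side. If there is none, the identity of [X] is an empty
   sum, and every [e a] would vanish. *)
case: m Z Z_loc j q qj qj0 sumZ @f f_loc f_orth =>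
    [|m] Z Z_loc j q qj qj0 sumZ f f_loc f_orth.
  have e0 (a : 'I_n) : False.
    have [_ + _] := e_loc a; apply.
    by rewrite -[e a]mulr1 -sumZ big_ord0 mulr0.
  exists (fun a : 'I_n => False_rect 'I_0 (e0 a)); split=> [|a]; last by case: (e0 a).
  by exists (fun b : 'I_0 => False_rect 'I_n (notF (ltn_ord b))) => a;
    [case: (e0 a)|case: a].
have [|s [s_inj s_im sP]] :=
    @idem_matching _ _ _ e f e_orth f_orth e_loc f_loc ord0 setT setT.
  have -> : (\sum_(a in setT) e a = 1)%R.
    by rewrite -sumY; apply: eq_bigl => a; rewrite inE.
  have -> : (\sum_(b in setT) f b = 1)%R.
    by rewrite -sumZ; apply: eq_bigl => b; rewrite inE.
  by exists 1%R, 1%R; rewrite !mulr1.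
exists s; split.
  apply: inj_card_bij => [a b /s_inj|]; first by apply; rewrite inE.
  by have := leq_imset_card s [set: 'I_n]; rewrite s_im !cardsT.
by move=> a; apply: idem_iso_isomorphic (pi a) (qj (s a)) (sP a (in_setT a)).
Qed.

Lemma cls_iter (X : ob C) (f g : hom X X) n :
  cls (iter n (Defs.cmp f) g) = (cls f ^+ n * cls g)%R.
Proof.
by elim: n => [|n IHn]; rewrite ?expr0 ?mul1r //= clsM IHn exprS mulrA.
Qed.

Lemma is_isoP (X : ob C) (f : hom X X) :
  is_iso f <-> exists z, inverses (cls f) z.
Proof.
split=> [[g [gf fg]]|[z [zf fz]]].
  by exists (cls g); split; rewrite -clsM -cls1; apply/clsP.
have [g gE] := cls_surj z; exists g.
by split; apply/clsP; rewrite clsM -gE.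
Qed.

Lemma biproduct_is_zero (A B X : ob C) (i1 : hom A X) (i2 : hom B X)
    (p1 : hom X A) (p2 : hom X B) :
  is_biproduct i1 i2 p1 p2 ->
  (is_zero A <-> i1 \o p1 == 0) /\ (is_zero A <-> i2 \o p2 == Defs.idm X) /\
  (is_zero B <-> i2 \o p2 == 0) /\ (is_zero B <-> i1 \o p1 == Defs.idm X).
Proof.
move=> [pi1 pi2 pi21 pi12 sumE].
have zero (Z : ob C) (i : hom Z X) (p : hom X Z) : p \o i == Defs.idm Z ->
    (is_zero Z <-> i \o p == 0).
  move=> pi; split=> [/is_zeroP Z0|ip0].
    by rewrite -(cmp1m HC p) Z0 cmp0m cmpm0.
  apply/is_zeroP; rewrite -(cmp1m HC (Defs.idm Z)) -{1}pi -pi.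
  have -> : (p \o i) \o (p \o i) == p \o (i \o p) \o i by rewrite !(cmpA HC).
  by rewrite ip0 cmpm0 cmp0m.
have compl (f g : hom X X) : f + g == Defs.idm X -> (f == 0 <-> g == Defs.idm X).
  move=> /clsP; rewrite clsD cls1 => fg; split=> /clsP; rewrite ?cls0 ?cls1 => h;
    apply/clsP; rewrite ?cls0 ?cls1.
    by rewrite -fg h add0r.
  by apply: (addIr (cls g)); rewrite fg h add0r.
have z1 := zero _ _ _ pi1; have z2 := zero _ _ _ pi2.
have c1 := compl _ _ sumE.
have c2 := compl (i2 \o p2) (i1 \o p1).
have {c2} c2 : i2 \o p2 == 0 <-> i1 \o p1 == Defs.idm X.
  by apply: c2; rewrite (addmC HC).
by split=> //; split; [exact: iff_trans z1 c1|split=> //; exact: iff_trans z2 c2].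
Qed.

(** Nilpotency on [B] and invertibility on [A] are expressed by equations in the endomorphisms of
    [X], so they survive a quotient. The last two equations force [f] to commute with [i1 \o p1],
    both products being [f g f]. *)
Definition fitting_split (X : ob C) (f : hom X X) : Prop :=
  exists A B (i1 : hom A X) (i2 : hom B X) (p1 : hom X A) (p2 : hom X B),
  [/\ is_biproduct i1 i2 p1 p2,
      exists n, iter n (Defs.cmp f) (i2 \o p2) == 0
    & exists g, g \o f == i1 \o p1 /\ f \o g == i1 \o p1].

(** One part of each Fitting splitting vanishes, so every endomorphism is nilpotent or invertible,
    and [fitting_local] applies. *)
Lemma indecomposable_local (X : ob C) :
  (forall f : hom X X, fitting_split f) -> indecomposable X -> local_endo X.
Proof.
move=> fit [Xnz X_ind]; split; first by move/is_zeroP.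
move=> f g /is_isoP; rewrite clsD => fg_iso.
have nz : (1 : endo X HC) <> 0%R.
  by rewrite -cls1 -cls0 => /clsP/is_zeroP.
suff fitR : forall x : endo X HC,
    (exists n, x ^+ n = 0)%R \/ exists y, inverses x y.
  by case: (fitting_local nz fitR fg_iso) => /is_isoP; [left|right].
move=> x; have [h ->] := cls_surj x.
have [A [B [i1 [i2 [p1 [p2 [bip [n hn] [l [lh hl]]]]]]]]] := fit h.
have [_ [A0 [_ B0]]] := biproduct_is_zero bip.
have [|/A0 E|/B0 E] := X_ind A B; first by exists i1, i2, p1, p2.
  left; exists n; move/clsP: hn; rewrite cls_iter cls0 => <-.
  by move/clsP: E => ->; rewrite cls1 mulr1.
right; apply/is_isoP; exists l; split; [exact: heq_trans lh E|].
exact: heq_trans hl E.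
Qed.

Lemma cls_sum_conj (A X : ob C) n (F : 'I_n -> hom A A) (i : hom A X) (p : hom X A) :
  cls (i \o \big[@addm C A A/0]_(a < n) F a \o p) =
  (\sum_(a < n) cls (i \o F a \o p))%R.
Proof.
apply: (big_morph (fun h => cls (i \o h \o p))) => [f g|].
  by rewrite -clsD; apply/clsP; rewrite (cmpDr HC) (cmpDl HC).
by rewrite -cls0; apply/clsP; rewrite cmpm0 cmp0m.
Qed.

(** Indexing by a sum type lets the inclusions and projections, whose types depend on the index, be
    defined by cases. *)
Definition sum_family T n m (Y : 'I_n -> T) (Z : 'I_m -> T) (s : 'I_n + 'I_m) : T :=
  match s with inl a => Y a | inr b => Z b end.

Lemma direct_sum_cat (A B X : ob C) n (Y : 'I_n -> ob C) m (Z : 'I_m -> ob C) :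
  biproduct A B X -> is_direct_sum A Y -> is_direct_sum B Z ->
  is_direct_sum X (fun a : 'I_(n + m) => sum_family Y Z (fintype.split a)).
Proof.
move=> [i1 [i2 [p1 [p2 [pi1 pi2 pi21 pi12 sumE]]]]].
move=> [i [p [pi pi0 sumY]]] [j [q [qj qj0 sumZ]]].
pose I s : hom (sum_family Y Z s) X :=
  match s with inl a => i1 \o i a | inr b => i2 \o j b end.
pose P s : hom X (sum_family Y Z s) :=
  match s with inl a => p a \o p1 | inr b => q b \o p2 end.
have mid (T T' S S' : ob C) (k : hom T S) (l : hom S X) (l' : hom X S')
    (k' : hom S' T') : (k' \o l') \o (l \o k) == k' \o (l' \o l) \o k.
  by rewrite !(cmpA HC).
exists (fun a => I (fintype.split a)), (fun a => P (fintype.split a)); split.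
- move=> a; case: (fintype.split a) => b; rewrite /I /P mid ?pi1 ?pi2 (cmpm1 HC);
    [exact: pi|exact: qj].
- move=> a b /eqP ab; have : fintype.split a <> fintype.split b.
    by move=> /(can_inj (@splitK _ _))/eqP; rewrite (negPf ab).
  case: (fintype.split a) (fintype.split b) => [c|c] [d|d] cd; rewrite /I /P mid.
  + by rewrite pi1 (cmpm1 HC); apply: pi0 => cd'; rewrite cd' in cd.
  + by rewrite pi12 cmpm0 cmp0m.
  + by rewrite pi21 cmpm0 cmp0m.
  + by rewrite pi2 (cmpm1 HC); apply: qj0 => cd'; rewrite cd' in cd.
- apply/clsP; rewrite cls_sum.
  pose G s : endo X HC := cls (I s \o P s).
  rewrite -[LHS]/(\sum_a G (fintype.split a))%R big_split_ord /=.
  under eq_bigr => a _ do rewrite -[lshift m a]/(unsplit (inl a)) unsplitK.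
  under [X in (_ + X)%R]eq_bigr => a _ do
    rewrite -[rshift n a]/(unsplit (inr a)) unsplitK.
  have GY a : G (inl a) = cls (i1 \o (i a \o p a) \o p1).
    by apply/clsP; rewrite /I /P !(cmpA HC).
  have GZ b : G (inr b) = cls (i2 \o (j b \o q b) \o p2).
    by apply/clsP; rewrite /I /P !(cmpA HC).
  rewrite (eq_bigr _ (fun a _ => GY a)) (eq_bigr _ (fun b _ => GZ b)).
  rewrite -!cls_sum_conj -clsD; apply/clsP.
  by rewrite sumY sumZ !(cmpm1 HC).
Qed.

Lemma direct_sum0 (X : ob C) (Y : 'I_0 -> ob C) : is_zero X -> is_direct_sum X Y.
Proof.
move=> X0; exists (fun=> 0), (fun=> 0); split=> [[]//|[]//|].
by rewrite big_ord0; symmetry; apply/is_zeroP.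
Qed.

Lemma direct_sum1 (X : ob C) : is_direct_sum X (fun _ : 'I_1 => X).
Proof.
exists (fun=> Defs.idm X), (fun=> Defs.idm X); split=> [a|a b|].
- by rewrite (cmp1m HC).
- by rewrite !ord1.
- by apply/clsP; rewrite cls_sum big_ord1 clsM mulr1.
Qed.

(** Only the pieces offered by the hypothesis come with a size. A non-trivial splitting of [X]
    merely supplies an idempotent to which the hypothesis is applied; its own summands are
    discarded. *)
Lemma direct_sum_exists (size : ob C -> nat -> Prop) :
  (forall X n (f : hom X X), size X n ->
     [\/ exists m, iter m (Defs.cmp f) (Defs.idm X) == 0, is_iso f
       | exists A B a b, [/\ biproduct A B X, size A a, size B b
         & (a < n)%N && (b < n)%N]]) ->
  forall X n, size X n -> exists m (Y : 'I_m -> ob C),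
    (forall a, indecomposable (Y a)) /\ is_direct_sum X Y.
Proof.
move=> dec X n; have [N] := ubnP n; elim: N X n => // N IHN X n ltn sX.
have rec A B a b : biproduct A B X -> size A a -> size B b ->
    (a < n)%N && (b < n)%N ->
    exists m (Y : 'I_m -> ob C),
      (forall a, indecomposable (Y a)) /\ is_direct_sum X Y.
  move=> bip sA sB /andP[an bn].
  have [m [Y [Y_ind sumY]]] := IHN A a (leq_trans an ltn) sA.
  have [l [Z [Z_ind sumZ]]] := IHN B b (leq_trans bn ltn) sB.
  exists (m + l)%N, (fun a => sum_family Y Z (fintype.split a)); split.
    by move=> c; case: (fintype.split c).
  exact: direct_sum_cat bip sumY sumZ.
have [X0|Xnz] := pselect (is_zero X).
  by exists 0%N, (fun=> X); split=> [[]//|]; apply: direct_sum0.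
have [X_ind|] := pselect (indecomposable X).
  by exists 1%N, (fun=> X); split=> //; apply: direct_sum1.
move=> /not_andP[//|] /existsNP[A] /existsNP[B] /not_implyP[bip /not_orP[A0 B0]].
have [i1 [i2 [p1 [p2 bip']]]] := bip.
have [zA [_ [_ zB]]] := biproduct_is_zero bip'.
have pi : p1 \o i1 == Defs.idm A by case: bip'.
have ee : (cls (i1 \o p1) * cls (i1 \o p1) = cls (i1 \o p1) :> endo X HC)%R.
  exact: split_idem.
have [[m em]|/is_isoP[z [ze ez]]|[A' [B' [a [b [bip2 sA sB ab]]]]]] :=
    dec X n (i1 \o p1) sX.
(* A nilpotent idempotent is 0 and, in the next case, an invertible one is 1; either would make a
   summand zero. *)
- case: A0; apply/zA/clsP; move/clsP: em; rewrite cls_iter cls1 mulr1 cls0.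
  case: m => [/eqP|m]; first by rewrite expr0 -cls1 -cls0 => /eqP/clsP/is_zeroP.
  suff -> : (cls (i1 \o p1) ^+ m.+1 = cls (i1 \o p1) :> endo X HC)%R by [].
  by elim: m => [|m IHm]; rewrite ?expr1 // exprS IHm.
- by case: B0; apply/zB/clsP; rewrite -[LHS]mul1r -ze -mulrA ee ze cls1.
- exact: rec bip2 sA sB ab.
Qed.

(* With [e = a ^ n * f ^ n]: [f] is invertible on the image of [e] and
   nilpotent on its complement. *)
Lemma regular_fitting_split (X : ob C) (f a : hom X X) n :
  (forall e : hom X X, e \o e == e -> exists A B (i1 : hom A X) (i2 : hom B X)
     (p1 : hom X A) (p2 : hom X B), is_biproduct i1 i2 p1 p2 /\ i1 \o p1 == e) ->
  a \o f == f \o a -> (cls f ^+ n = cls a * cls f ^+ n.+1)%R ->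
  fitting_split f.
Proof.
move=> splits /clsP; rewrite !clsM => af reg.
set F := cls f in af reg; set al := cls a in af reg.
have comm m : GRing.comm al (F ^+ m) by apply: commrX.
have reg1 : (F ^+ n.+1 = al * F ^+ n.+2)%R.
  by rewrite exprSr reg -mulrA -exprSr.
have regj j : (F ^+ n.+1 = al ^+ j * F ^+ (n.+1 + j))%R.
  elim: j => [|j IHj]; first by rewrite mul1r addn0.
  by rewrite {1}IHj exprD reg1 -(mulrA al) -exprD mulrA -exprSr addSnnS.
(* The exponent is [n.+1] so that a factor [F] can be split off even for [n = 0]; the partial
   inverse below is [al ^+ n.+1 * F ^+ n]. *)
pose e := (al ^+ n.+1 * F ^+ n.+1)%R.
have comm' : GRing.comm (F ^+ n.+1) (al ^+ n.+1).
  by apply: commrX; apply: commr_sym; apply: comm.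
have ee : (e * e = e)%R.
  rewrite /e mulrA -(mulrA (al ^+ _)) comm' -!mulrA -exprD.
  by rewrite -[X in (_ * X)%R](regj n.+1).
have Fe : (F ^+ n.+1 * e = F ^+ n.+1)%R.
  by rewrite /e mulrA comm' -mulrA -exprD -(regj n.+1).
have [e' e'E] := cls_surj e.
have [|A [B [i1 [i2 [p1 [p2 [bip ip]]]]]]] := splits e'.
  by apply/clsP; rewrite clsM -e'E.
exists A, B, i1, i2, p1, p2; split=> //.
- exists n.+1; apply/clsP; rewrite cls_iter cls0.
  have -> : (cls (i2 \o p2) = 1 - e)%R.
    have [_ _ _ _ /clsP] := bip; rewrite clsD cls1 => <-.
    by move/clsP: ip => ->; rewrite e'E addrAC subrr add0r.
  by rewrite mulrBr mulr1 Fe subrr.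
- have [g gE] := cls_surj (al ^+ n.+1 * F ^+ n)%R.
  exists g; split; apply: (heq_trans HC _ (heq_sym HC ip)); apply/clsP;
    rewrite clsM -gE -e'E -/F.
    by rewrite -mulrA -exprSr.
  by rewrite mulrA (commrX n.+1 (commr_sym af)) -mulrA -exprS.
Qed.

End Additive.

(** * Finite complexes over a field *)

(** The equality is one of ring structures, so modules over [k] become modules over [K] by
    substitution. Once [k] is destructured it holds by computation. *)
Lemma is_field_fieldType (k : comPzRingType) :
  is_field k -> exists K : fieldType, k = K :> comPzRingType.
Proof.
move=> [k1 kV].
have nz1 : (1 : k) != 0 by apply/eqP.
have invP (x : k) : exists y, (x != 0 -> y * x = 1) /\ (x = 0 -> y = 0).
  have [->|x0] := eqVneq x 0; first by exists 0.
  have [y xy] := kV x (elimN eqP x0); exists y.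
  by split=> [_|/eqP]; [rewrite mulrC|rewrite (negPf x0)].
have [inv invE] := choice invP.
have mulVx : forall x : k, x != 0 -> inv x * x = 1 by move=> x; apply: (invE x).1.
have inv0 : inv 0 = 0 by apply: (invE 0).2.
pose nz := GRing.PzSemiRing_isNonZero.Build k nz1.
pose K0 : comNzRingType := HB.pack k nz.
pose K : fieldType := HB.pack k K0 (GRing.ComNzRing_isField.Build K0 mulVx inv0).
exists K; rewrite {}/K {}/K0 {}/nz {invP invE kV k1}.
by case: k inv nz1 mulVx inv0 => T [].
Qed.

Section FieldModules.
Variables (K : fieldType) (M : lmodType K).

(** Steinitz exchange: a generator with non-zero coefficient in [b] becomes, modulo the kernel of
    [p], a combination of the others. *)
Lemma spanned_drop (N : lmodType K) (p : {linear M -> N}) n (b : M) :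
  (forall y, exists x, p x = y) -> b <> 0 -> p b = 0 -> spanned M n ->
  (0 < n)%N && `[< spanned N n.-1 >].
Proof.
move=> p_surj b0 pb [e e_gen]; have [c cE] := e_gen b.
have [l cl] : exists l, c l != 0.
  apply: contrapT => /forallNP c0; apply: b0; rewrite cE.
  by apply: big1 => i _; have /negP := c0 i; rewrite negbK => /eqP->; rewrite scale0r.
case: n e e_gen c cE l cl => [|n] e e_gen c cE l cl; first by case: l {cl}.
apply/asboolP; exists (fun i => p (e (lift l i))) => y.
have [x <-] := p_surj y; have [d dE] := e_gen x.
exists (fun i => d (lift l i) - d l / c l * c (lift l i)).
have -> : p x = p (x - (d l / c l) *: b).
  by rewrite linearB linearZ /= pb scaler0 subr0.
have -> : x - (d l / c l) *: b = \sum_i (d i - d l / c l * c i) *: e i.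
  rewrite dE cE scaler_sumr -sumrB; apply: eq_bigr => i _.
  by rewrite scalerBl scalerA.
rewrite (bigD1_ord l) //= divfK // subrr scale0r add0r linear_sum.
by apply: eq_bigr => i _; rewrite linearZ.
Qed.

Variable f : {linear M -> M}.

(** The value at [x] of a polynomial in [f], with coefficients listed from the constant term
    upwards; vanishing low coefficients can thus be peeled off one by one. *)
Fixpoint horner_act (s : seq K) (x : M) : M :=
  if s is c :: s' then c *: x + horner_act s' (f x) else 0.

Lemma horner_act_comm s x : horner_act s (f x) = f (horner_act s x).
Proof.
elim: s x => [|c s IHs] x /=; first by rewrite linear0.
by rewrite linearD linearZ IHs.
Qed.

(** The generators present [M] as a quotient of a space of row vectors on which [f] lifts to a
    matrix, and Cayley-Hamilton descends. The factor [q] allows one product of such polynomials to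
    annihilate all degrees of a complex. *)
Lemma annihilating_poly n : spanned M n ->
  exists p : {poly K}, p != 0 /\ forall (q : {poly K}) x, horner_act (p * q) x = 0.
Proof.
move=> [e' e'_gen].
(* A zero generator is added so that the matrices have positive size and form a non-zero ring. *)
pose e (i : 'I_n.+1) : M := if unlift ord0 i is Some j then e' j else 0.
have e_gen x : exists c : 'I_n.+1 -> K, x = \sum_i c i *: e i.
  have [c ->] := e'_gen x.
  exists (fun i => if unlift ord0 i is Some j then c j else 0).
  rewrite big_ord_recl /e unlift_none scaler0 add0r.
  by apply: eq_bigr => i _; rewrite liftK.
have [a aE] := fin_all_exists (fun j => e_gen (f (e j))).
pose A : 'M[K]_n.+1 := \matrix_(i, j) a i j.
pose phi (v : 'rV[K]_n.+1) : M := \sum_j v 0 j *: e j.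
have phiD u v : phi (u + v) = phi u + phi v.
  by rewrite -big_split; apply: eq_bigr => j _; rewrite mxE scalerDl.
have phiZ c v : phi (c *: v) = c *: phi v.
  by rewrite scaler_sumr; apply: eq_bigr => j _; rewrite mxE scalerA.
have phi0 : phi 0 = 0 by apply: big1 => j _; rewrite mxE scale0r.
have f_phi v : f (phi v) = phi (v *m A).
  rewrite linear_sum.
  under eq_bigr => j _ do rewrite linearZ /= aE scaler_sumr.
  rewrite exchange_big; apply: eq_bigr => i _.
  rewrite mxE scaler_suml; apply: eq_bigr => j _.
  by rewrite scalerA mxE.
have act_phi s v : horner_act s (phi v) = phi (v *m horner_mx A (Poly s)).
  elim: s v => [|c s IHs] v; first by rewrite /= rmorph0 mulmx0 phi0.
  rewrite /= f_phi IHs cons_poly_def mulrC rmorphD rmorphM /= horner_mx_X.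
  rewrite horner_mx_C mulmxDr mul_mx_scalar phiD phiZ addrC.
  by rewrite mulmxA.
exists (char_poly A); split; first by rewrite monic_neq0 ?char_poly_monic.
move=> q x; have [c ->] := e_gen x.
have -> : \sum_i c i *: e i = phi (\row_i c i).
  by apply: eq_bigr => i _; rewrite mxE.
by rewrite act_phi polyseqK rmorphM /= Cayley_Hamilton mul0r mulmx0 phi0.
Qed.

End FieldModules.

Section FieldComplexes.
Variables (K : fieldType) (gT : finGroupType).
Local Notation complex := (complex K gT).

Definition kG_scale (M : kGmod K gT) (c : K) : kGhom M M.
Proof.
apply: (@mk_kGhom K gT M M (fun x => c *: x)).
- by move=> a x y; rewrite scalerDr !scalerA mulrC.
- by move=> g x; rewrite linearZ.
Defined.

Definition ch_scale (X : complex) (c : K) : chmap X X.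
Proof.
exists (fun i => kG_scale (X i) c).
by move=> i x; rewrite /= linearZ.
Defined.

Fixpoint ch_horner (X : complex) (f : chmap X X) (s : seq K) : chmap X X :=
  if s is c :: s' then ch_add (ch_scale X c) (ch_comp (ch_horner f s') f)
  else ch_zero X X.

Lemma ch_hornerE (X : complex) (f : chmap X X) s i x :
  ch_horner f s i x = horner_act (f i) s x.
Proof.
elim: s x => [|c s IHs] x //.
by rewrite -[LHS]/(c *: x + ch_horner f s i (f i x)) IHs.
Qed.

(** Leading zero coefficients are traded for powers of [f], counted by [m]. When the constant term
    [c] is non-zero, solving the relation for it expresses [f^m] by [f^(m+1)], with [a] equal to
    [- c^-1] times the remaining polynomial in [f]. *)
Lemma regular_of_poly (X : complex) (f : chmap X X) (p : seq K) m :
  has (fun c => c != 0) p ->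
  (forall i (x : X i), horner_act (f i) p (iter m (f i) x) = 0) ->
  exists n (a : chmap X X), (forall i x, a i (f i x) = f i (a i x)) /\
    forall i x, iter n (f i) x = a i (iter n.+1 (f i) x).
Proof.
elim: p m => [//|c p IHp] m /=; have [->|c0 _] := eqVneq c 0.
  move=> /= p0 act0; apply: (IHp m.+1) => // i x.
  by have := act0 i x; rewrite scale0r add0r.
move=> act0; exists m, (ch_comp (ch_scale X (- c^-1)) (ch_horner f p)); split=> i x.
  by rewrite /= !ch_hornerE horner_act_comm linearZ.
rewrite /= ch_hornerE; have /eqP := act0 i x.
rewrite addrC addr_eq0 => /eqP ->.
by rewrite scalerN scaleNr opprK scalerA mulVf // scale1r.
Qed.

Lemma finite_complex_regular (X : complex) (s : seq int) (f : chmap X X) :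
  (forall i, i \notin s -> forall x : X i, x = 0) ->
  (forall i, exists n, spanned (X i) n) ->
  exists n (a : chmap X X), (forall i x, a i (f i x) = f i (a i x)) /\
    forall i x, iter n (f i) x = a i (iter n.+1 (f i) x).
Proof.
move=> Xs X_fg.
have ann i : exists p : {poly K}, p != 0 /\
    forall (q : {poly K}) x, horner_act (f i) (p * q) x = 0.
  by have [n /(annihilating_poly (f i))] := X_fg i.
(* A single polynomial serves all degrees, so that [n] does not depend on the degree and [a] is a
   chain map. *)
have [p pP] := choice ann; pose P := \prod_(i <- s) p i.
have P0 : P != 0 by rewrite prodf_seq_neq0; apply/allP => i _; case: (pP i).
apply: (@regular_of_poly X f P 0).
  apply/hasP; exists (lead_coef P); last by rewrite lead_coef_eq0.
  by rewrite mem_nth // prednK // size_poly_gt0.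
move=> i x /=; have [i_s|/Xs X0] := boolP (i \in s).
  by rewrite /P (big_rem i) //=; case: (pP i).
by rewrite [LHS]X0.
Qed.

End FieldComplexes.

Section CpxSub.
Variables (k : comPzRingType) (gT : finGroupType) (fg : bool) (b : boundedness).
Local Notation C := (CpxSub k gT fg b).
Local Open Scope cat_scope.

Lemma CpxSub_idem_splits (X : ob C) (e : Defs.hom X X) : e \o e == e ->
  exists A B (i1 : Defs.hom A X) (i2 : Defs.hom B X)
    (p1 : Defs.hom X A) (p2 : Defs.hom X B),
  is_biproduct i1 i2 p1 p2 /\ i1 \o p1 == e.
Proof.
move=> ee; pose e' : chmap (sval X) (sval X) := e.
have {ee} ee i x : e' i (e' i x) = e' i x := ee i x.
pose c := ch_add (ch_id (sval X)) (ch_opp e').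
have cE i x : c i x = (x - e' i x)%R by [].
have cc i x : c i (c i x) = c i x by rewrite !cE linearB ee subrr subr0.
have sub_im (h : chmap (sval X) (sval X)) : (forall i x, h i (h i x) = h i x) ->
    exists (A : ob C) (j : chmap (sval A) (sval X)) (p : chmap (sval X) (sval A)),
      [/\ forall i, injective (j i), forall i x, j i (p i x) = h i x
        & forall i y, h i (j i y) = j i y].
  (* The image of an idempotent is described as its fixed points; this is applied to [e] and to its
     complement. *)
  move=> hh; pose S i (x : sval X i) := h i x = x.
  have S_sub : is_subcx S.
    split=> i; last by move=> x; rewrite /S ch_comm => ->.
    rewrite /S; split=> [|a x y hx hy|a x hx]; first exact: linear0.
      by rewrite linearP hx hy.
    by rewrite kG_equiv hx.
  have [A [j [j_inj jP]]] := subcx_exists S_sub.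
  have [p pE] : exists p : chmap (sval X) A, forall i x, j i (p i x) = h i x.
    by apply: ch_lift_mono => // i x; apply/jP/hh.
  have hj i y : h i (j i y) = j i y by apply: (jP i (j i y)).2; exists y.
  have hA : in_cpx fg b A.
    apply: (in_cpx_surj (f := p)) (svalP X) => i y; exists (j i y).
    by apply: (j_inj i); rewrite pE hj.
  by exists (exist _ A hA), j, p.
have [A [i1 [p1 [i1_inj ip1 hi1]]]] := sub_im _ ee.
have [B [i2 [p2 [i2_inj ip2 hi2]]]] := sub_im _ cc.
have ei2 i y : e' i (i2 i y) = 0%R.
  have /eqP := hi2 i y; rewrite cE -subr_eq0 addrAC subrr add0r oppr_eq0.
  by move/eqP.
exists A, B, i1, i2, p1, p2; split=> //; split=> i x.
- by apply: (i1_inj i); rewrite [LHS]ip1 hi1.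
- by apply: (i2_inj i); rewrite [LHS]ip2 hi2.
- by apply: (i2_inj i); rewrite [LHS]ip2 cE hi1 subrr linear0.
- by apply: (i1_inj i); rewrite [LHS]ip1 ei2 linear0.
- rewrite -[LHS]/(i1 i (p1 i x) + i2 i (p2 i x))%R.
  by rewrite ip1 ip2 cE addrC subrK.
Qed.

Lemma CpxSub_nonzero (A : ob C) :
  ~ is_zero A -> exists i (x : sval A i), x <> 0%R.
Proof.
move=> A_nz; apply: contrapT => nx; apply: A_nz.
have A0 i (x : sval A i) : x = 0%R.
  by apply: contrapT => x0; apply: nx; exists i, x.
move=> X; split=> f i x; first exact: A0.
by rewrite [x]A0 linear0; apply: esym (linear0 _).
Qed.

Lemma iter_cmpE (X : ob C) (f g : Defs.hom X X) n i x :
  ch_fun (iter n (Defs.cmp f) g) i x = iter n (ch_fun f i) (ch_fun g i x).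
Proof. by elim: n => //= n <-. Qed.

End CpxSub.

(** * From Fitting decompositions of complexes to the Krull-Schmidt property of the quotient *)

Section StableFitting.
Variables (C : catData) (E : seqClass C).
Hypothesis strict : forall (A B : ob C) (f g : Defs.hom A B),
  heq f g -> stable_eq E f g.

Lemma stable_fitting_split (X : ob C) (f : Defs.hom X X) :
  fitting_split f -> fitting_split (C := stable_category E) f.
Proof.
move=> [A [B [i1 [i2 [p1 [p2 [bip [n fn] [g [gf fg]]]]]]]]].
exists A, B, i1, i2, p1, p2; split.
- exact: (stable_is_biproduct strict bip).
- by exists n; apply: strict.
- by exists g; split; apply: strict.
Qed.

End StableFitting.

Section FittingDecomposition.
Variables (C : catData) (HC : is_additive C).
Local Open Scope cat_scope.

Lemma fitting_dichotomy (X : ob C) (f : Defs.hom X X) : fitting_split f ->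
  [\/ exists m, iter m (Defs.cmp f) (Defs.idm X) == 0, is_iso f
    | exists A B, [/\ biproduct A B X, ~ is_zero A & ~ is_zero B]].
Proof.
move=> [A [B [i1 [i2 [p1 [p2 [bip [n fn] [g [gf fg]]]]]]]]].
have [_ [zA [_ zB]]] := biproduct_is_zero HC bip.
have [A0|A0] := pselect (is_zero A).
  constructor 1; exists n; apply/(clsP HC); move/(clsP HC): fn.
  by have /(clsP HC) E := zA.1 A0; rewrite !cls_iter E.
have [B0|B0] := pselect (is_zero B).
  constructor 2; have i1p1 := zB.1 B0.
  by exists g; split; [apply: heq_trans gf i1p1|apply: heq_trans fg i1p1].
by constructor 3; exists A, B; split=> //; exists i1, i2, p1, p2.
Qed.

End FittingDecomposition.

Section StableKrullSchmidt.
Variables (C : catData) (E : seqClass C).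
Hypotheses (HC : is_additive C) (HS : is_additive (stable_category E))
  (strict : forall (A B : ob C) (f g : Defs.hom A B),
     heq f g -> stable_eq E f g)
  (fit : forall (X : ob C) (f : Defs.hom X X), fitting_split f).
Variable size : ob C -> nat -> Prop.
Hypotheses (size_exists : forall X, exists n, size X n)
  (size_drop : forall X A B n, biproduct A B X -> ~ is_zero B -> size X n ->
     exists2 a, size A a & (a < n)%N).

Lemma stable_krull_schmidt : krull_schmidt (stable_category E).
Proof.
have local (X : ob (stable_category E)) : indecomposable X -> local_endo X.
  by apply: (indecomposable_local HS) => f; apply/(stable_fitting_split strict)/fit.
split=> // [X|X n Y m Z Y_ind Z_ind].
  have [N sX] := size_exists X.
  apply: (direct_sum_exists HS (size := size)) sX.
  move=> {}X n f sX.
  have [[m fm]|[g [gf fg]]|[A [B [bip A0 B0]]]] := fitting_dichotomy HC (fit f).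
  - by constructor 1; exists m; apply: strict.
  - by constructor 2; exists g; split; apply: strict.
  - have [a sA an] := size_drop bip B0 sX.
    have [c sB cn] := size_drop (biproductC HC bip) A0 sX.
    constructor 3; exists A, B, a, c; split; rewrite ?an //.
    have [i1 [i2 [p1 [p2 bip']]]] := bip; exists i1, i2, p1, p2.
    exact: (stable_is_biproduct strict bip').
by apply: (direct_sum_unique HS) => a; apply: local.
Qed.

End StableKrullSchmidt.

Section CpxSubField.
Variables (K : fieldType) (gT : finGroupType).
Local Notation C := (CpxSub K gT true Bounded).
Local Open Scope cat_scope.

Definition total_size (X : ob C) (N : nat) : Prop :=
  exists (s : seq int) (nu : int -> nat),
  [/\ uniq s, forall i, i \notin s -> forall x : sval X i, x = 0%R,
      forall i, spanned (sval X i) (nu i) & \sum_(i <- s) nu i = N].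

Lemma total_size_exists (X : ob C) : exists N, total_size X N.
Proof.
have [/(_ isT) X_fg [[N1 hN1] [N2 hN2]]] := svalP X.
have [nu nuP] := choice (fun i => (kG_finite_genP _).1 (X_fg i)).
(* The degrees from the lower bound [N2] to the upper bound [N1], both included; if [N1 < N2] the
   list is still harmless, the complex being zero. *)
pose s := [seq (N2 + j%:Z)%R | j <- iota 0 `|N1 - N2|.+1].
exists (\sum_(i <- s) nu i), s, nu; split=> //.
  rewrite map_inj_uniq ?iota_uniq // => i j /addrI; by case.
move=> i i_s; have [lt|le] := ltP i N2; first exact: hN2.
apply: hN1; rewrite ltNge; apply: contra i_s => le'.
apply/mapP; exists `|i - N2|%N; last first.
  by rewrite gez0_abs ?subr_ge0 // addrCA subrr addr0.
rewrite mem_iota /= add0n ltnS -lez_nat !gez0_abs ?subr_ge0 ?lerB //.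
exact: le_trans le le'.
Qed.

Lemma total_size_drop (X A B : ob C) N : biproduct A B X -> ~ is_zero B ->
  total_size X N -> exists2 a, total_size A a & (a < N)%N.
Proof.
move=> [i1 [i2 [p1 [p2 [p1i1 p2i2 _ p1i2 _]]]]] /CpxSub_nonzero[i0 [y y0]].
move=> [s [nu [s_uniq s0 nuP <-]]].
have p_surj i z : exists x, ch_fun p1 i x = z.
  by exists (ch_fun i1 i z); apply: p1i1.
have y'0 : ch_fun i2 i0 y <> 0%R.
  by move=> /(congr1 (ch_fun p2 i0)); rewrite [LHS]p2i2 linear0.
have i0s : i0 \in s by apply: contrapT => /negP/s0 X0; apply/y'0/X0.
have /andP[nu0 /asboolP drop] :=
  spanned_drop (p_surj i0) y'0 (p1i2 i0 y) (nuP i0).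
pose nu' i := if i == i0 then (nu i0).-1 else nu i.
exists (\sum_(i <- s) nu' i).
  exists s, nu'; split=> // i => [i_s z|].
    by have [x <-] := p_surj i z; rewrite [x]s0 // linear0.
  rewrite /nu'; case: eqP => [->//|_].
  exact: spanned_surj (p_surj i) (nuP i).
rewrite (big_rem i0) //= [X in (_ < X)%N](big_rem i0) //= {1}/nu' eqxx.
have -> : \sum_(i <- rem i0 s) nu' i = \sum_(i <- rem i0 s) nu i.
  apply: eq_big_seq => i; rewrite mem_rem_uniq // inE => /andP[/negPf ni _].
  by rewrite /nu' ni.
by rewrite ltn_add2r prednK.
Qed.

Lemma CpxSub_fitting (X : ob C) (f : Defs.hom X X) : fitting_split f.
Proof.
have [N [s [nu [_ s0 nuP _]]]] := total_size_exists X.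
have [n [a [af reg]]] := @finite_complex_regular _ _ _ s f s0
  (fun i => ex_intro _ _ (nuP i)).
have HC := CpxSub_additive K gT true Bounded.
have powE m : (cls HC f ^+ m)%R = cls HC (iter m (Defs.cmp f) (Defs.idm X)).
  by rewrite cls_iter cls1 mulr1.
apply: (regular_fitting_split (HC := HC) (a := a) (n := n)).
- exact: CpxSub_idem_splits.
- exact: af.
- rewrite !powE -clsM; apply/clsP => i x; rewrite iter_cmpE.
  apply: etrans (reg i x) _; congr (a i _).
  by rewrite iter_cmpE.
Qed.

End CpxSubField.

(** * Invariance under isomorphism and the final assembly *)

Lemma isomorphic_summand (k : comPzRingType) (gT : finGroupType)
    (P X Y : complex k gT) :
  isomorphic (C := Cpx k gT) X Y ->
  summand (C := Cpx k gT) P X -> summand (C := Cpx k gT) P Y.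
Proof.
move=> [f [g [gf fg]]] [Q [i1 [i2 [p1 [p2 [h1 h2 h3 h4 h5]]]]]].
exists Q, (ch_comp f i1), (ch_comp f i2), (ch_comp p1 g), (ch_comp p2 g).
have {}gf i x : g i (f i x) = x := gf i x.
have {}fg i x : f i (g i x) = x := fg i x.
split=> i x; rewrite /= ?gf.
- exact: h1.
- exact: h2.
- exact: h3.
- exact: h4.
- by rewrite -linearD -[RHS]fg; congr (f i _); apply: h5.
Qed.

Lemma isomorphicC (C : catData) (A B : ob C) : isomorphic A B -> isomorphic B A.
Proof. by move=> [f [g [gf fg]]]; exists g, f. Qed.

Lemma isomorphic_trans (k : comPzRingType) (gT : finGroupType)
    (X Y Z : complex k gT) :
  isomorphic (C := Cpx k gT) X Y -> isomorphic (C := Cpx k gT) Y Z ->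
  isomorphic (C := Cpx k gT) X Z.
Proof.
move=> [f [g [gf fg]]] [f' [g' [gf' fg']]].
exists (ch_comp f' f), (ch_comp g g'); split=> i x.
  exact: etrans (congr1 (g i) (gf' i (f i x))) (gf i x).
exact: etrans (congr1 (f' i) (fg i (g' i x))) (fg' i x).
Qed.

Lemma ch_isomorphic (k : comPzRingType) (gT : finGroupType)
    (X Y : complex k gT) (f : chmap X Y) (g : chmap Y X) :
  (forall i x, g i (f i x) = x) -> (forall i y, f i (g i y) = y) ->
  isomorphic (C := Cpx k gT) X Y.
Proof. by move=> gf fg; exists f, g. Qed.

Lemma pow_swap_iso (k : comPzRingType) (gT : finGroupType) r
    (rho sigma : matrep k gT r) (X : complex k gT) :
  isomorphic (C := Cpx k gT) (cx_pow rho (cx_pow sigma X))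
    (cx_pow sigma (cx_pow rho X)).
Proof.
apply: (ch_isomorphic (f := cx_pow_swap rho sigma X)
  (g := cx_pow_swap sigma rho X)) => i x; exact: cx_pow_swapK.
Qed.

(** Tensoring with the dual first and with [V] second applies the two powers in the order opposite
    to that of the covers [W' (W X)]; the swap corrects this. *)
Lemma tens_dual_tens_iso (k : comPzRingType) (gT : finGroupType) r
    (V : kGmod k gT) (e : 'I_r -> V) (c : 'I_r -> V -> k^o)
    (ec : is_coords e c) (X : complex k gT) :
  isomorphic (C := Cpx k gT) (cx_tensr (cx_tensr X (kG_dual V)) V)
    (cx_pow (basis_rep (dual_coords ec)) (cx_pow (basis_rep ec) X)).
Proof.
apply: isomorphic_trans (tensr_iso ec _) _.
apply: isomorphic_trans (pow_iso _ (tensr_iso (dual_coords ec) X)) _.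
exact: pow_swap_iso.
Qed.

Theorem proposition3p5 (k : comPzRingType) (gT : finGroupType)
    (V : kGmod k gT) (r : nat) (r_gt0 : (0 < r)%N)
    (V_free : free_of_rank V r) :
  (forall (fg : bool) (b : boundedness),
     frobenius (V_split V (fg := fg) (b := b)) /\
     (forall P : complex k gT,
        (exists hP : in_cpx fg b P,
           E_projective (V_split V (fg := fg) (b := b))
             (exist (in_cpx fg b) P hP))
        <->
        (exists X : complex k gT, in_cpx fg b X /\
           summand (C := Cpx k gT) P (cx_tensr (cx_tensr X (kG_dual V)) V)))) /\
  (is_field k -> krull_schmidt (K_V_split V true Bounded)).
Proof.
have [e [c ec]] := coords_exist V_free.
have rs := dual_basis_reps ec; have sr := dual_repsC rs.
split=> [fg b|].
  split; first exact: (V_split_frobenius rs sr r_gt0 (tensl_splitE ec)).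
  move=> P; rewrite (V_split_projectiveP rs sr r_gt0 (tensl_splitE ec)).
  by split=> -[X [hX sumP]]; exists X; split=> //; apply: isomorphic_summand sumP;
    [apply/isomorphicC|]; apply: tens_dual_tens_iso.
(* Substitution turns [V], its basis and the stable category into objects over the field [K]. *)
move=> /is_field_fieldType[K kK]; subst k.
apply: (@stable_krull_schmidt _ _ (CpxSub_additive K gT true Bounded)
  (stable_additive rs sr r_gt0 (tensl_splitE ec) true Bounded)
  (@stable_eq_strict _ _ _ _ _ _ rs sr r_gt0 (tensl_splitE ec) true Bounded)
  (@CpxSub_fitting K gT) _ (@total_size_exists K gT)
  (@total_size_drop K gT)).
Qed.
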